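(* Let $p>0$. Suppose that there exists a Borel probability measure $\pi$ on $\mathbb{R}^2$ such that $\lambda_2(\mathrm{supp}\,\pi)=0$ and $\pi_n\to\pi$ weakly as $n\to\infty$. Then, as $n\to\infty$, $$\frac{\varepsilon_n^2}{c_n^{p/2}}\,V^{(p)}(k_n,n)\longrightarrow m_p\,\Sigma^{(p,\pi)}\quad\text{in probability in } D([0,1]^2),$$ where $$\Sigma^{(p,\pi)}_{(s,t)}:=\int_0^s\int_0^t\left(\int_{\mathbb{R}^2}\sigma^2_{(u-\xi,v-\tau)}\,\pi(d\xi,d\tau)\right)^{p/2}du\,dv,\qquad (s,t)\in[0,1]^2 .$$
   Context: $\lambda_2$ is Lebesgue measure on $\mathbb{R}^2$; $m_q:=\mathbf{E}|X|^q$ for $X\sim N(0,1)$; $\mathrm{supp}\,\pi$ is the smallest closed set of full $\pi$-measure. Ambit field. Let $W$ be a white noise on $[-1,1]^2$ with control measure $\lambda_2$, i.e. a centered Gaussian process indexed by Borel subsets of $[-1,1]^2$ with $\mathbf{E}[W(A)W(B)]=\lambda_2(A\cap B)$. Let $(\sigma_{(s,t)})_{(s,t)\in[-1,1]^2}$ be a continuous, strictly positive random field (the volatility field) independent of $W$. Let $g\in L^2(\mathbb{R}^2)$ be non-vanishing (not a.e. zero) with essential support contained in $[0,1]^2$. The underlying probability space $(\Omega,\mathcal{F},\mathbf{P})$ is the completion of the product $(\Omega_W\times\Omega_\sigma,\mathcal{F}_W\otimes\mathcal{F}_\sigma,\mathbf{P}_W\otimes\mathbf{P}_\sigma)$, where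 the first factor carries $W$ (with $\mathcal{F}_W$ generated by $W$) and the second is the canonical space $C([-1,1]^2,\mathbb{R}_+)$ of $\sigma$. The ambit field is $$Y_{(s,t)}:=\int g(s-u,t-v)\,\sigma_{(u,v)}\,W(du,dv),\qquad (s,t)\in[0,1]^2,$$ defined as a Wiener integral conditionally on $\sigma$. Power variation. For $R=(s_1,s_2]\times(t_1,t_2]\subset[0,1]^2$ put $Y(R):=Y_{(s_2,t_2)}-Y_{(s_1,t_2)}-Y_{(s_2,t_1)}+Y_{(s_1,t_1)}$. For $n\in\mathbb{N}$ and $i,j=1,\dots,n$ let $R^{(n)}_{(i,j)}:=((i-1)/n,i/n]\times((j-1)/n,j/n]$. For $k\in\mathbb{N}$, $$V^{(p)}_{(s,t)}(k,n):=\sum_{i=1}^{\lfloor ns/k\rfloor}\sum_{j=1}^{\lfloor nt/k\rfloor}\big|Y\big(R^{(n)}_{(ki,kj)}\big)\big|^p,\qquad (s,t)\in[0,1]^2 .$$ Concentration measures. $h_n(s,t):=g(s,t)-g(s-1/n,t)-g(s,t-1/n)+g(s-1/n,t-1/n)$, $c_n:=\int_{\mathbb{R}^2}h_n(z)^2dz\in(0,\infty)$, and $\pi_n$ is the probability measure on $\mathbb{R}^2$ with density $h_n^2/c_n$ with respect to $\lambda_2$. Thinning. $(k_n)_{n\in\mathbb{N}}$ is a fixed non-decreasing sequence of natural numbers such that $\varepsilon_n:=k_n/n\to0$ (it is not assumed that $k_n\to\infty$). $D([0,1]^2)$ is the two-parameter càdlàg space: functions $f:[0,1]^2\to\mathbb{R}$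 such that at every $(s,t)$, $f(s_n,t_n)\to f(s,t)$ whenever $(s_n,t_n)\to(s,t)$ within $(s,1]\times(t,1]$, and $f$ has a finite limit at $(s,t)$ along sequences within each of the other three quadrants $[0,s)\times(t,1]$, $[0,s)\times[0,t)$, $(s,1]\times[0,t)$. It is endowed with the uniform topology (sup norm). *)

(* Defs.v *)
From HB Require Import structures.
From mathcomp Require Import all_boot all_order all_algebra.
From mathcomp Require Import all_classical all_reals all_analysis.
From mathcomp Require Import measurable_realfun.

Set Implicit Arguments.
Unset Strict Implicit.
Unset Printing Implicit Defensive.
Import Order.TTheory GRing.Theory Num.Theory.
Import numFieldNormedType.Exports.
Import HBSimple.

Local Open Scope classical_set_scope.
Local Open Scope ring_scope.

Definition completion_display d (T : measurableType d) (R : realType)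
  (mu : set T -> \bar R) : measure_display.
Proof. exact: d. Qed.

Definition completion_type d (T : measurableType d) (R : realType)
  (mu : set T -> \bar R) : Type := T.

Section completion.
Local Open Scope measure_scope.
Context d (T : measurableType d) (R : realType).
Variable mu : {measure set T -> \bar R}.

Let G : set (set T) := completed_algebra_gen mu.

Let completion0 : G set0.
Proof.
by exists set0; [exact: measurable0|exists set0; [exact: negligible_set0|rewrite setU0]].
Qed.

Let completionC A : G A -> G (~` A).
Proof.
move=> [B mB] [N [M [mM M0 NM]] <-].
exists (~` B `\` M); first by apply: measurableD => //; exact: measurableC.
exists ((~` B `\` N) `&` M).
  by exists M; split => //; exact: subIsetr.
apply/seteqP; split => t /=.
  by move=> [[Bt Mt]|[[Bt Nt] Mt]] [|] //; move/NM.
move=> /not_orP[Bt Nt]; have [Mt|Mt] := pselect (M t); last by left.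
by right.
Qed.

Let completion_bigcup (F : (set T)^nat) :
  (forall k, G (F k)) -> G (\bigcup_k F k).
Proof.
move=> GF.
have /choice[BN BNP] : forall k, exists BN : set T * set T,
    [/\ measurable BN.1, mu.-negligible BN.2 & BN.1 `|` BN.2 = F k].
  by move=> k; have [B mB [N nN <-]] := GF k; exists (B, N).
exists (\bigcup_k (BN k).1).
  by apply: bigcupT_measurable => k; have [] := BNP k.
exists (\bigcup_k (BN k).2).
  by apply: negligible_bigcup => k; have [] := BNP k.
by rewrite -bigcupU; apply: eq_bigcupr => k _; have [] := BNP k.
Qed.

HB.instance Definition _ := Pointed.on (completion_type mu).
HB.instance Definition _ := @isMeasurable.Build (completion_display mu)
  (completion_type mu) G completion0 completionC completion_bigcup.

(* [mu^*] is the outer measure induced by [mu] (measure_extension.v); on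
   [A `|` N] with [A] measurable and [N] negligible it is equal to [mu A]. *)
Definition completion : set (completion_type mu) -> \bar R := mu^*.

Let completion_caratheodory (A : set T) :
  G A -> mu^*.-cara.-measurable A.
Proof.
move=> [B mB [N [M [mM M0 NM]] <-]].
apply: (@measurableU _ (caratheodory_type mu^*)).
  by apply: sub_caratheodory; exact: sub_sigma_algebra.
apply: (@measure_is_complete_caratheodory R T mu^*).
exists M; split => //.
  by apply: sub_caratheodory; exact: sub_sigma_algebra.
by rewrite -M0; exact: measurable_mu_extE.
Qed.

Let completion_measure0 : completion set0 = 0%E.
Proof. exact: mu_ext0. Qed.

Let completion_measure_ge0 A : (0 <= completion A)%E.
Proof. exact: mu_ext_ge0. Qed.

Let completion_sigma_additive : semi_sigma_additive completion.
Proof.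
move=> F mF tF mUF; apply: caratheodory_measure_sigma_additive => //.
  by move=> i; exact: completion_caratheodory (mF i).
exact: completion_caratheodory mUF.
Qed.

HB.instance Definition _ := isMeasure.Build _ _ _ completion
  completion_measure0 completion_measure_ge0 completion_sigma_additive.

End completion.
Arguments completion {d T R} mu _.

Section completion_probability.
Context d (T : measurableType d) (R : realType) (P : probability T R).

Let completion_setT : completion P [set: _] = 1%E.
Proof.
rewrite -(probability_setT P).
exact: (@measurable_mu_extE _ R T P setT measurableT).
Qed.

HB.instance Definition _ :=
  Measure_isProbability.Build _ _ _ (completion P) completion_setT.

End completion_probability.

(* [lebesgue_measure] lives on the measurable type [measurableTypeR R], whose
   carrier is [R]; points of the plane are also used at type [R * R]. *)
Definition plane (R : realType) := (measurableTypeR R * measurableTypeR R)%type.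
HB.instance Definition _ (R : realType) := Measurable.on (plane R).

Definition lambda2 {R : realType} : set (plane R) -> \bar R :=
  (@lebesgue_measure R \x @lebesgue_measure R)%E.
HB.instance Definition _ (R : realType) := Measure.on (@lambda2 R).

Definition unit_square {R : realType} : set (plane R) :=
  `[0 : R, 1]%classic `*` `[0 : R, 1]%classic.

Definition big_square {R : realType} : set (plane R) :=
  `[-1 : R, 1]%classic `*` `[-1 : R, 1]%classic.

Definition ess_supp (R : realType) (g : plane R -> R) : set (plane R) :=
  ~` \bigcup_(U in [set U : set (R * R) |
       open U /\ \forall z \ae @lambda2 R, U z -> g z = 0]) U.

(* [R * R] being second countable, this intersection itself has full measure:
   it is the smallest closed set of full measure. *)
Definition msupp (R : realType) (mu : probability (plane R) R) :
    set (plane R) :=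
  \bigcap_(C in [set C : set (R * R) | closed C /\ mu C = 1%E]) C.

Definition weak_cvg (R : realType) (mu : nat -> {measure set (plane R) -> \bar R})
    (nu : {measure set (plane R) -> \bar R}) :=
  forall f : R * R -> R, continuous f -> bounded_fun f ->
    (\int[mu n]_z (f z)%:E)%E @[n --> \oo] --> (\int[nu]_z (f z)%:E)%E.

Section white_noise.
Context d (T : measurableType d) (R : realType) (P : probability T R).

(* [normal_prob m 0] is not the Dirac mass at [m] in the library. *)
Definition gaussian (X : T -> R) :=
  measurable_fun setT X /\
  exists m s : R, forall B : set R, measurable B ->
    pushforward P X B = if s == 0 then \d_m B else normal_prob m s B.

Variable W : set (plane R) -> T -> R.

Definition white_noise :=
  [/\ forall (n : nat) (a : 'I_n -> R) (A : 'I_n -> set (plane R)),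
        (forall j, measurable (A j) /\ A j `<=` big_square) ->
        gaussian (fun w => \sum_(j < n) a j * W (A j) w),
      forall A, measurable A -> A `<=` big_square -> ('E_P[W A] = 0)%E &
      forall A B, measurable A -> A `<=` big_square ->
        measurable B -> B `<=` big_square ->
        ('E_P[(W A \* W B)%R] = lambda2 (A `&` B))%E].

Definition generated_by_noise :=
  @measurable _ T =
  <<s [set C | exists A B, [/\ measurable A, A `<=` big_square,
                 measurable B & C = W A @^-1` B]] >>.

Definition simple_wiener (phi : {sfun plane R >-> R}) (w : T) : R :=
  \sum_(x \in range phi) x * W (big_square `&` phi @^-1` [set x]) w.

(* The extension of [simple_wiener] by the L^2 isometry; [X] is thereby
   determined by [f] up to a null set only. *)
Definition wiener_integral (f : plane R -> R) (X : T -> R) :=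
  measurable_fun setT X /\
  exists phi : nat -> {sfun plane R >-> R},
    (\int[@lambda2 R]_(z in big_square) ((f z - phi n z) ^+ 2)%:E)%E
       @[n --> \oo] --> 0%E /\
    'E_P[(fun w => (X w - simple_wiener (phi n) w) ^+ 2)%R]%E
       @[n --> \oo] --> 0%E.

End white_noise.

(* An element of C([-1,1]^2, R_+), with R_+ = [0, +oo[, is encoded by its
   extension by [0] outside the square. *)
Record vol_path (R : realType) := VolPath {
  path_fun :> R * R -> R ;
  path_continuous : {within big_square, continuous path_fun} ;
  path_ge0 : forall z, big_square z -> 0 <= path_fun z ;
  path_out : forall z, ~ big_square z -> path_fun z = 0 }.

Section vol_space.
Variable R : realType.

HB.instance Definition _ := gen_eqMixin (vol_path R).
HB.instance Definition _ := gen_choiceMixin (vol_path R).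

Let zero_continuous :
  {within big_square, continuous (fun _ : R * R => 0 : R)}.
Proof. by apply: continuous_subspaceT => z; exact: cvg_cst. Qed.

HB.instance Definition _ := isPointed.Build (vol_path R)
  (@VolPath R (fun=> 0) zero_continuous
     (fun _ _ => lexx 0) (fun _ _ => erefl)).

Definition vol_cylinders : set (set (vol_path R)) :=
  [set C | exists z B, [/\ big_square z, measurable B &
             C = [set x : vol_path R | B (x z)]]].

Definition vol_space := g_sigma_algebraType vol_cylinders.

End vol_space.

Section ambit.
Context d (T : measurableType d) (R : realType).
Variables (PW : probability T R) (Psigma : probability (vol_space R) R).

Definition ambit_space := completion_type (PW \x Psigma)%E.
Definition ambit_prob : set ambit_space -> \bar R := completion (PW \x Psigma)%E.
HB.instance Definition _ := Measurable.on ambit_space.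
HB.instance Definition _ := Probability.on ambit_prob.

(* For almost every path [x] of the volatility, [Y z] is, as a function of the
   noise, the Wiener integral of the integrand given by [x]. *)
Definition ambit_field (W : set (plane R) -> T -> R) (g : R * R -> R)
    (Y : R * R -> ambit_space -> R) :=
  forall z, unit_square z ->
    measurable_fun setT (Y z) /\
    \forall x \ae Psigma, exists X : T -> R,
      wiener_integral PW W
        (fun u => g (z.1 - u.1, z.2 - u.2) * (x : vol_path R) u) X /\
      \forall w \ae PW, Y z (w, x) = X w.

End ambit.

Section power_variation.
Context (R : realType) (Omega : Type).

Definition increment (Y : R * R -> Omega -> R) (s1 s2 t1 t2 : R) (w : Omega) :=
  Y (s2, t2) w - Y (s1, t2) w - Y (s2, t1) w + Y (s1, t1) w.

Definition power_variation (p : R) (Y : R * R -> Omega -> R) (k n : nat)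
    (w : Omega) (z : R * R) : R :=
  \sum_(1 <= i < (Num.truncn (n%:R * z.1 / k%:R)).+1)
    \sum_(1 <= j < (Num.truncn (n%:R * z.2 / k%:R)).+1)
      `| increment Y (((k * i)%:R - 1) / n%:R) ((k * i)%:R / n%:R)
                     (((k * j)%:R - 1) / n%:R) ((k * j)%:R / n%:R) w | `^ p.

End power_variation.

Section concentration.
Context (R : realType) (g : {mfun plane R >-> R}).

(* Only 0 < n matters: [0^-1 = 0], so that [g_incr 0], [g_mass 0] and
   [concentration_measure 0] vanish. *)
Definition g_incr (n : nat) (z : R * R) : R :=
  g z - g (z.1 - n%:R^-1, z.2) - g (z.1, z.2 - n%:R^-1)
      + g (z.1 - n%:R^-1, z.2 - n%:R^-1).

Definition g_mass (n : nat) : R := \int[@lambda2 R]_z (g_incr n z ^+ 2).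

Definition concentration_measure (n : nat) (A : set (plane R)) : \bar R :=
  (\int[@lambda2 R]_(z in A) (g_incr n z ^+ 2 / g_mass n)%:E)%E.

Let density_ge0 n z : 0 <= g_incr n z ^+ 2 / g_mass n.
Proof.
apply: divr_ge0; first exact: sqr_ge0.
by apply: fine_ge0; apply: integral_ge0 => ? _; rewrite lee_fin sqr_ge0.
Qed.

Let measurable_density n :
  measurable_fun setT
    (fun z : plane R => (g_incr n z ^+ 2 / g_mass n)%:E).
Proof.
have m1 : measurable_fun setT (fun z : plane R => (z.1 : R) - n%:R^-1).
  by apply: measurable_funB => //; exact: measurable_fst.
have m2 : measurable_fun setT (fun z : plane R => (z.2 : R) - n%:R^-1).
  by apply: measurable_funB => //; exact: measurable_snd.
have m0 : measurable_fun setT (fun z : plane R => z.1 : measurableTypeR R).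
  exact: measurable_fst.
have m0' : measurable_fun setT (fun z : plane R => z.2 : measurableTypeR R).
  exact: measurable_snd.
have mg (u v : plane R -> measurableTypeR R) :
    measurable_fun setT u -> measurable_fun setT v ->
    measurable_fun setT (fun z => g (u z, v z)).
  move=> mu mv.
  apply: (@measurableT_comp _ _ _ _ _ _ g _ (fun z => (u z, v z) : plane R)) => //.
  exact: measurable_fun_pair.
apply/measurable_EFinP; apply: measurable_funM => //.
apply: measurable_funX.
apply: measurable_funD; last exact: mg.
by do 2![apply: measurable_funB; last exact: mg].
Qed.

Let concentration0 n : concentration_measure n set0 = 0%E.
Proof. exact: integral_set0. Qed.

Let concentration_ge0 n A : (0 <= concentration_measure n A)%E.
Proof. by apply: integral_ge0 => z _; rewrite lee_fin. Qed.

Let concentration_sigma_additive n :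
  semi_sigma_additive (concentration_measure n).
Proof.
move=> F mF tF mUF; rewrite /concentration_measure ge0_integral_bigcup//.
- apply: is_cvg_ereal_nneg_natsum_cond => k _ _.
  by apply: integral_ge0 => z _; rewrite lee_fin.
- exact: measurable_funTS.
- by move=> z _; rewrite lee_fin.
Qed.

HB.instance Definition _ n := isMeasure.Build _ _ _ (concentration_measure n)
  (concentration0 n) (concentration_ge0 n) (@concentration_sigma_additive n).

End concentration.

Section skorokhod.
Variable R : realType.

(* On the boundary of the square some quadrants are empty; the corresponding
   conditions hold vacuously. *)
Definition cadlag2 (f : R * R -> R) :=
  forall s t : R, unit_square (s, t) ->
  [/\ f z @[z --> within (`]s, 1] `*` `]t, 1]) (nbhs (s, t))] --> f (s, t),
      exists l : R, f z @[z --> within (`[0, s[ `*` `]t, 1]) (nbhs (s, t))] --> l,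
      exists l : R, f z @[z --> within (`[0, s[ `*` `[0, t[) (nbhs (s, t))] --> l &
      exists l : R, f z @[z --> within (`]s, 1] `*` `[0, t[) (nbhs (s, t))] --> l].

Definition sup_dist (f h : R * R -> R) : \bar R :=
  ereal_sup [set `|f z - h z|%:E | z in unit_square].

(* [P] is applied to a set that need not be known to be measurable; for
   [P := completion mu] it is then the outer measure of that set. *)
Definition cvg_in_probability_D (Omega : Type) (P : set Omega -> \bar R)
    (X : nat -> Omega -> R * R -> R) (Z : Omega -> R * R -> R) :=
  [/\ forall n w, cadlag2 (X n w),
      forall w, cadlag2 (Z w) &
      forall e : R, 0 < e ->
        P [set w | (e%:E < sup_dist (X n w) (Z w))%E] @[n --> \oo] --> 0%E].

End skorokhod.

Definition normal_abs_moment (R : realType) (q : R) : R :=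
  \int[normal_prob (0 : R) 1]_x (`|x| `^ q).

Definition limit_field (R : realType) (p : R)
    (pi : probability (plane R) R) (x : vol_path R) (z : R * R) : R :=
  \int[@lebesgue_measure R]_(u in `[0, z.1])
    \int[@lebesgue_measure R]_(v in `[0, z.2])
      ((\int[pi]_y (x (u - y.1, v - y.2) ^+ 2)) `^ (p / 2)).

(* Main.v *)
Require Import Defs.
From HB Require Import structures.
From mathcomp Require Import all_boot all_order all_algebra.
From mathcomp Require Import all_classical all_reals all_analysis.
From mathcomp Require Import measurable_realfun.
From mathcomp Require Import ring lra.

Set Implicit Arguments.
Unset Strict Implicit.
Unset Printing Implicit Defensive.
Import Order.TTheory GRing.Theory Num.Theory.
Import numFieldNormedType.Exports.

Local Open Scope classical_set_scope.
Local Open Scope ring_scope.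

Section density.
Import HBNNSimple.
Context d (T : measurableType d) (R : realType).
Local Open Scope ereal_scope.

Lemma ge0_integral_density (mu nu : {measure set T -> \bar R}) (g : T -> R) :
  measurable_fun setT g -> (forall x, 0 <= g x)%R ->
  (forall A, measurable A -> nu A = \int[mu]_(x in A) (g x)%:E) ->
  forall f : T -> \bar R, measurable_fun setT f -> (forall x, 0 <= f x) ->
  \int[nu]_x f x = \int[mu]_x (f x * (g x)%:E).
Proof.
move=> mg0 g00 nuE f mf f0.
have mg : measurable_fun setT (EFin \o g) by exact/measurable_EFinP.
have g0 x : 0 <= (g x)%:E by rewrite lee_fin.
pose h := nnsfun_approx measurableT mf.
have hf x : (EFin \o h n) x @[n --> \oo] --> f x by exact: cvg_nnsfun_approx.
have mh n : measurable_fun setT (EFin \o h n).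
  by apply/measurable_EFinP; exact/measurable_funP.
have h0 n x : 0 <= (EFin \o h n) x by rewrite /= lee_fin.
have ndh x a b : (a <= b)%N -> (h a x <= h b x)%R.
  by move=> ab; exact/lefP/nd_nnsfun_approx.
have simple n : \int[nu]_x (EFin \o h n) x = \int[mu]_x ((EFin \o h n) x * (g x)%:E).
  have mI r : measurable (h n @^-1` [set r]) by exact: measurable_funPTI.
  have m1 r : measurable_fun setT (fun x => (r * \1_(h n @^-1` [set r]) x)%:E).
    by apply/measurable_EFinP; apply: measurable_funM => //; exact: measurable_indic.
  transitivity (\sum_(r \in range (h n)) (r%:E * nu (h n @^-1` [set r]))).
    rewrite (eq_integral (fun x => \sum_(r \in range (h n))
        (r * \1_(h n @^-1` [set r]) x)%:E)); last first.
      by move=> x _; rewrite /= fimfunE -fsumEFin.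
    rewrite ge0_integral_fsum//; last by move=> r x _; exact: nnfun_muleindic_ge0.
    apply: eq_fsbigr => r _.
    by rewrite integralZl_indic_nnsfun// integral_indic// setIT.
  rewrite (eq_integral (fun x => \sum_(r \in range (h n))
      ((r * \1_(h n @^-1` [set r]) x)%:E * (g x)%:E))); last first.
    move=> x _; rewrite /= fimfunE -fsumEFin// ge0_mule_fsuml// => r.
    exact: nnfun_muleindic_ge0.
  rewrite ge0_integral_fsum//; last 2 first.
  - by move=> r; exact: emeasurable_funM.
  - by move=> r x _; rewrite mule_ge0//; exact: nnfun_muleindic_ge0.
  apply: eq_fsbigr => r /[!inE] -[y _ hr]; rewrite nuE//.
  rewrite integral_mkcond -ge0_integralZl//=; last 3 first.
  - exact/(measurable_restrictT (EFin \o g) (mI r)).1/measurable_funTS.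
  - by move=> x _; exact: erestrict_ge0.
  - by rewrite lee_fin -hr.
  apply: eq_integral => x _; rewrite /= EFinM -muleA; congr (_ * _).
  rewrite patchE indicE; case: ifPn => xr; first by rewrite mul1e.
  by rewrite mul0e.
transitivity (lim (\int[nu]_x (EFin \o h n) x @[n --> \oo])).
  rewrite -monotone_convergence//; last by move=> x _ a b ab; rewrite lee_fin ndh.
  by apply: eq_integral => x _; exact/esym/cvg_lim.
under eq_fun do rewrite simple.
rewrite -monotone_convergence//; last 3 first.
- by move=> n; exact: emeasurable_funM.
- by move=> n x _; rewrite mule_ge0.
- by move=> x _ a b ab; rewrite /= lee_wpmul2r// lee_fin ndh.
apply: eq_integral => x _; apply/cvg_lim => //.
by apply: cvgeZr => //; exact: hf.
Qed.

End density.

Section reflection.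
Context (R : realType).
Local Open Scope ereal_scope.

Definition flip (c x : measurableTypeR R) : measurableTypeR R := (c - x)%R.

Lemma measurable_flip c : measurable_fun setT (flip c).
Proof. by apply: measurable_funB. Qed.

HB.instance Definition _ c := isMeasurableFun.Build _ _ _ _ (flip c) (measurable_flip c).

Lemma lebesgue_flip (c : R) (A : set (measurableTypeR R)) : measurable A ->
  pushforward (@lebesgue_measure R) (flip c) A = lebesgue_measure A.
Proof.
move=> mA; apply/esym/lebesgue_measure_unique => // _ [[a b] _ <-] /=.
rewrite /pushforward (_ : flip c @^-1` _ = `[(c - b)%R, (c - a)%R[%classic); last first.
  apply/seteqP; split => x /=; rewrite /flip !in_itv/=; move=> /andP[]; lra.
rewrite !lebesgue_measure_itv/= !lte_fin ltrD2l ltrN2.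
by case: ifPn => // _; rewrite -!EFinB; congr EFin; lra.
Qed.

Definition flip2 (c u : plane R) : plane R := (flip c.1 u.1, flip c.2 u.2).

Lemma measurable_flip2 c : measurable_fun setT (flip2 c).
Proof.
apply: measurable_fun_pair => /=; apply: (measurableT_comp (measurable_flip _)).
  exact: measurable_fst.
exact: measurable_snd.
Qed.

HB.instance Definition _ c := isMeasurableFun.Build _ _ _ _ (flip2 c) (measurable_flip2 c).

Lemma lambda2_flip (c : plane R) (A : set (plane R)) : measurable A ->
  pushforward (@lambda2 R) (flip2 c) A = lambda2 A.
Proof.
move=> mA.
suff H (B C : set (measurableTypeR R)) : measurable B -> measurable C ->
    pushforward (@lambda2 R) (flip2 c) (B `*` C) = lebesgue_measure B * lebesgue_measure C.
  by apply/esym; apply: (@product_measure_unique _ _ (measurableTypeR R)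
    (measurableTypeR R) R (@lebesgue_measure R) (@lebesgue_measure R)
    (pushforward (@lambda2 R) (flip2 c))).
move=> mB mC.
rewrite -(lebesgue_flip c.1 mB) -(lebesgue_flip c.2 mC).
apply: (product_measure1E (@lebesgue_measure R) (@lebesgue_measure R)
  (A1 := flip c.1 @^-1` B) (A2 := flip c.2 @^-1` C)).
exact: measurable_funPTI.
exact: measurable_funPTI.
Qed.

Lemma ge0_integral_flip2 (c : plane R) (f : plane R -> \bar R) :
  measurable_fun setT f -> (forall x, 0 <= f x) ->
  \int[@lambda2 R]_u f (flip2 c u) = \int[@lambda2 R]_u f u.
Proof.
move=> mf f0.
transitivity (\int[pushforward (@lambda2 R) (flip2 c)]_u f u).
  by rewrite ge0_integral_pushforward.
by apply: eq_measure_integral => A mA _; exact: lambda2_flip.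
Qed.

End reflection.

Section riemann.
Context (R : realType).
Local Notation leb := (@lebesgue_measure R).

Lemma continuous_integrable_cc (f : R -> R) a b : continuous f ->
  leb.-integrable `[a, b] (EFin \o f).
Proof.
move=> cf; apply: continuous_compact_integrable; first exact: segment_compact.
exact: continuous_subspaceT.
Qed.

Lemma le_norm_Rintegral_cc (f : R -> R) (a b k : R) : a <= b -> continuous f ->
  (forall x, a <= x <= b -> `|f x| <= k) ->
  `|\int[leb]_(x in `[a, b]) f x| <= k * (b - a).
Proof.
move=> ab cf fk.
apply: (le_trans (le_normr_Rintegral _ _)) => //; first exact: continuous_integrable_cc.
apply: (@le_trans _ _ (\int[leb]_(x in `[a, b]) k)).
  apply: le_Rintegral => //.
  - apply: (@continuous_integrable_cc (fun x => `|f x|)) => x.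
    by apply: continuous_comp; [exact: cf|exact: norm_continuous].
  - by apply: (@continuous_integrable_cc (cst k)) => x; exact: cvg_cst.
rewrite Rintegral_cst//= lebesgue_measure_itv/= lte_fin.
by move: ab; rewrite le_eqVlt => /predU1P[->|->//]; rewrite ltxx/= subrr.
Qed.

Lemma Rintegral_cc_diff (f : R -> R) a b : 0 <= a -> a <= b -> continuous f ->
  \int[leb]_(x in `[0, b]) f x - \int[leb]_(x in `[0, a]) f x =
  \int[leb]_(x in `[a, b]) f x.
Proof.
move=> a0 ab cf; rewrite Rintegral_itvB ?bnd_simp//.
- apply: Rintegral_itv_obnd_cbnd.
  apply: (integrableS _ _ _ (@continuous_integrable_cc f a b cf)) => //.
  by apply: subset_itvr; rewrite bnd_simp.
- exact: continuous_integrable_cc.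
Qed.

Lemma riemann1 (f : R -> R) (e k : R) N : continuous f -> 0 < e ->
  (forall u v, `|u - v| <= e -> `|f u - f v| <= k) ->
  `|e * (\sum_(1 <= i < N.+1) f (i%:R * e)) -
    \int[leb]_(x in `[0, N%:R * e]) f x| <= N%:R * e * k.
Proof.
move=> cf e0 fk; elim: N => [|N IH].
  rewrite big_geq// !mul0r mulr0 sub0r normrN set_itv1 Rintegral_set1 normr0.
  exact: lexx.
rewrite big_nat_recr//= mulrDr.
have N0 : 0 <= N%:R * e by rewrite mulr_ge0// ltW.
have NN : N%:R * e <= N.+1%:R * e by apply: ler_wpM2r; [exact: ltW|rewrite ler_nat].
have /eqP := Rintegral_cc_diff N0 NN cf; rewrite subr_eq => /eqP ->.
set I := \int[leb]_(x in _) _; set J := \int[leb]_(x in `[0, _]) _.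
have Ik : `|e * f (N.+1%:R * e) - I| <= e * k.
  have -> : e * f (N.+1%:R * e) - I =
      \int[leb]_(x in `[N%:R * e, N.+1%:R * e]) (f (N.+1%:R * e) - f x).
    rewrite RintegralB//; last 2 first.
    - by apply: (@continuous_integrable_cc (cst _)) => x; exact: cvg_cst.
    - exact: continuous_integrable_cc.
    rewrite Rintegral_cst//= lebesgue_measure_itv/= lte_fin ltr_pM2r// ltr_nat ltnSn/=.
    by congr (_ - _); rewrite mulrC; congr *%R; rewrite -mulrBl -natrB// subSnn mul1r.
  have -> : e * k = k * (N.+1%:R * e - N%:R * e).
    by rewrite -mulrBl -natrB// subSnn mul1r mulrC.
  apply: le_norm_Rintegral_cc => // [x|x].
    by apply: cvgB; [exact: cvg_cst|exact: cf].
  move=> /andP[ax xb]; apply: fk; rewrite ger0_norm; last by rewrite subr_ge0.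
  by rewrite lerBlDr -natr1 mulrDl mul1r addrC lerD2l.
rewrite (_ : _ - _ = (e * f (N.+1%:R * e) - I) +
  (e * (\sum_(1 <= i < N.+1) f (i%:R * e)) - J)); last by ring.
apply: (le_trans (ler_normD _ _)).
by apply: (le_trans (lerD Ik IH)); rewrite -natr1; lra.
Qed.

Definition ucont2 (F : R -> R -> R) := forall k, 0 < k -> exists2 d, 0 < d &
  forall u v u' v', `|u - u'| < d -> `|v - v'| < d -> `|F u v - F u' v'| <= k.

Lemma ucont2_continuousr F u : ucont2 F -> continuous (F u).
Proof.
move=> uF v; apply/cvgrPdist_le => k /uF[d d0 dF].
near=> t; apply: dF; first by rewrite subrr normr0.
by near: t; exact: cvgr_dist_lt.
Unshelve. all: by end_near. Qed.

Lemma ucont2_int_le (F : R -> R -> R) (L k u u' : R) : ucont2 F -> 0 <= L ->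
  (forall v, `|F u v - F u' v| <= k) ->
  `|\int[leb]_(v in `[0, L]) F u v - \int[leb]_(v in `[0, L]) F u' v| <= L * k.
Proof.
move=> uF L0 Fk; rewrite -RintegralB//; last 2 first.
- exact/continuous_integrable_cc/ucont2_continuousr.
- exact/continuous_integrable_cc/ucont2_continuousr.
have := @le_norm_Rintegral_cc (fun v => F u v - F u' v) 0 L k L0.
rewrite subr0 [k * L]mulrC; apply => // v.
by apply: cvgB; exact: ucont2_continuousr.
Qed.

Lemma ucont2_int_continuous (F : R -> R -> R) L : ucont2 F -> 0 <= L ->
  continuous (fun u => \int[leb]_(v in `[0, L]) F u v).
Proof.
move=> uF L0 u; apply/cvgrPdist_le => k k0.
have L1 : 0 < L + 1 by lra.
have /uF[d d0 dF] : 0 < k / (L + 1) by rewrite divr_gt0.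
near=> t.
apply: (@le_trans _ _ (L * (k / (L + 1)))).
  apply: ucont2_int_le => // v; apply: dF; last by rewrite subrr normr0.
  by near: t; exact: cvgr_dist_lt.
rewrite mulrCA -[leRHS]mulr1 ler_pM2l// ler_pdivrMr// mul1r; lra.
Unshelve. all: by end_near. Qed.

Lemma riemann2 (F : R -> R -> R) (e k : R) N M : ucont2 F -> 0 < e ->
  (forall u v u' v', `|u - u'| <= e -> `|v - v'| <= e -> `|F u v - F u' v'| <= k) ->
  `|e ^+ 2 * (\sum_(1 <= i < N.+1) \sum_(1 <= j < M.+1) F (i%:R * e) (j%:R * e)) -
    \int[leb]_(u in `[0, N%:R * e]) \int[leb]_(v in `[0, M%:R * e]) F u v|
  <= 2 * ((N%:R * e) * (M%:R * e) * k).
Proof.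
move=> uF e0 Fk.
have M0 : 0 <= M%:R * e by rewrite mulr_ge0// ltW.
pose G u := \int[leb]_(v in `[0, M%:R * e]) F u v.
have G1 : `|e * (\sum_(1 <= i < N.+1) G (i%:R * e)) -
    \int[leb]_(x in `[0, N%:R * e]) G x| <= N%:R * e * (M%:R * e * k).
  apply: riemann1 => //; first exact: ucont2_int_continuous.
  move=> u v uv; apply: ucont2_int_le => // w; apply: Fk => //.
  by rewrite subrr normr0 ltW.
rewrite (_ : _ - _ = e * (\sum_(1 <= i < N.+1)
    (e * (\sum_(1 <= j < M.+1) F (i%:R * e) (j%:R * e)) - G (i%:R * e))) +
   (e * (\sum_(1 <= i < N.+1) G (i%:R * e)) -
    \int[leb]_(x in `[0, N%:R * e]) G x)); last first.
  by rewrite sumrB mulrBr subrKA; congr (_ - _); rewrite -mulr_sumr mulrA -expr2.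
apply: (le_trans (ler_normD _ _)); rewrite [leRHS]mulrDl mul1r.
rewrite -[_ * _ * k]mulrA; apply: lerD; last exact: G1.
rewrite normrM gtr0_norm// (mulrC N%:R e) -(mulrA e N%:R) ler_pM2l//.
apply: (le_trans (ler_norm_sum _ _ _)).
apply: (@le_trans _ _ (\sum_(1 <= i < N.+1) (M%:R * e * k))); last first.
  by rewrite sumr_const_nat subSS subn0 -[leLHS]mulr_natl.
apply: ler_sum => i _; apply: riemann1 => //; first exact: ucont2_continuousr.
by move=> u v uv; apply: Fk => //; rewrite subrr normr0 ltW.
Qed.

End riemann.

Section density_signed.
Context d (T : measurableType d) (R : realType).
Local Open Scope ereal_scope.

Lemma integral_density (mu nu : {measure set T -> \bar R}) (g : T -> R) :
  measurable_fun setT g -> (forall x, 0 <= g x)%R ->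
  (forall A, measurable A -> nu A = \int[mu]_(x in A) (g x)%:E) ->
  forall f : T -> \bar R, measurable_fun setT f ->
  \int[nu]_x f x = \int[mu]_x (f x * (g x)%:E).
Proof.
move=> mg g0 nuE f mf; rewrite integralE [RHS]integralE.
rewrite !(ge0_integral_density mg g0 nuE)//; last 2 first.
- exact: measurable_funeneg.
- exact: measurable_funepos.
by congr (_ - _); apply: eq_integral => x _;
  rewrite !(funeposE, funenegE) maxe_pMl ?lee_fin// mul0e ?muleN ?mulNe.
Qed.

Lemma integrable_density (mu nu : {measure set T -> \bar R}) (g : T -> R) :
  measurable_fun setT g -> (forall x, 0 <= g x)%R ->
  (forall A, measurable A -> nu A = \int[mu]_(x in A) (g x)%:E) ->
  forall f : T -> \bar R, measurable_fun setT f ->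
  nu.-integrable setT f -> mu.-integrable setT (fun x => f x * (g x)%:E).
Proof.
move=> mg g0 nuE f mf /integrableP[_ fi]; apply/integrableP; split.
  by apply: emeasurable_funM => //; exact/measurable_EFinP.
rewrite (ge0_integral_density mg g0 nuE) in fi => //.
  under eq_integral => x _ do rewrite abseM [`|(g x)%:E|]gee0_abs ?lee_fin//.
  exact: fi.
exact: measurableT_comp.
Qed.

End density_signed.

Section gauss.
Context (R : realType).
Local Notation leb := (@lebesgue_measure R).
Local Notation N01 := (@normal_prob R 0 1).
Local Notation phi := (@normal_pdf R 0 1).

Lemma normal_probE m s (A : set R) : normal_prob m s A = (\int[leb]_(x in A) (normal_pdf m s x)%:E)%E.
Proof. by []. Qed.

Lemma ge0_integral_normal m s (f : R -> \bar R) : measurable_fun setT f ->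
  (forall x, 0 <= f x)%E ->
  (\int[normal_prob m s]_x f x = \int[leb]_x (f x * (normal_pdf m s x)%:E))%E.
Proof.
move=> mf f0; apply: ge0_integral_density => //.
- exact: measurable_normal_pdf.
- exact: normal_pdf_ge0.
Qed.

Lemma integral_normal m s (f : R -> \bar R) : measurable_fun setT f ->
  (\int[normal_prob m s]_x f x = \int[leb]_x (f x * (normal_pdf m s x)%:E))%E.
Proof.
move=> mf; apply: integral_density => //.
- exact: measurable_normal_pdf.
- exact: normal_pdf_ge0.
Qed.

Lemma pow_normal_pdf n : exists2 C : R, 0 < C &
  forall x, x ^+ (2 * n) * phi x <= C * normal_pdf 0 (Num.sqrt 2) x.
Proof.
pose P1 := @normal_peak R 1; pose P2 := @normal_peak R (Num.sqrt 2).
have s2 : Num.sqrt 2 != 0 :> R by rewrite gt_eqF// sqrtr_gt0.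
have P10 : 0 < P1 by exact: normal_peak_gt0.
have P20 : 0 < P2 by exact: normal_peak_gt0.
exists (4 ^+ n * n`!%:R * P1 / P2) => [|x].
  by rewrite divr_gt0// !mulr_gt0// ltr0n fact_gt0.
rewrite !normal_pdfE// /normal_fun -/P1 -/P2 subr0 expr1n sqr_sqrtr//.
have -> : 4 ^+ n * n`!%:R * P1 / P2 * (P2 * expR (- x ^+ 2 / (2 *+ 2))) =
   P1 * (4 ^+ n * n`!%:R * expR (- x ^+ 2 / (2 *+ 2))).
  by field; rewrite gt_eqF.
rewrite mulrCA ler_pM2l//; set y := x ^+ 2 / 4.
have y0 : 0 <= y by rewrite divr_ge0// sqr_ge0.
rewrite exprM (_ : x ^+ 2 = 4 * y); last by rewrite /y; field.
rewrite (_ : - (4 * y) / (1 *+ 2) = - y - y); last by field.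
rewrite (_ : - (4 * y) / (2 *+ 2) = - y); last by field.
rewrite expRD mulrA ler_pM2r ?expR_gt0// exprMn -mulrA ler_pM2l ?exprn_gt0//.
rewrite expRN ler_pdivrMr ?expR_gt0//.
case: n => [|n]; first by rewrite expr0 fact0 mul1r -expR0 ler_expR.
rewrite mulrC -ler_pdivrMr ?ltr0n ?fact_gt0//.
by apply: le_trans (expR_ge1Dxn n y0); rewrite lerDr.
Qed.

Lemma integrable_normal_pow n : N01.-integrable setT (fun x : R => (x ^+ (2 * n))%:E).
Proof.
have mX : measurable_fun setT (fun x : R => (x ^+ (2 * n))%:E).
  by apply/measurable_EFinP; exact: exprn_measurable.
have [C C0 HC] := pow_normal_pdf n.
apply/integrableP; split=> //.
rewrite (eq_integral (fun x : measurableTypeR R => ((x ^+ 2) ^+ n)%:E)); last first.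
  by move=> x _; rewrite exprM gee0_abs// lee_fin exprn_ge0// sqr_ge0.
rewrite ge0_integral_normal//; last 2 first.
- by apply/measurable_EFinP; apply: measurable_funX; exact: exprn_measurable.
- by move=> x; rewrite lee_fin exprn_ge0// sqr_ge0.
apply: (@le_lt_trans _ _ (\int[leb]_x (C%:E * (normal_pdf 0 (Num.sqrt 2) x)%:E))%E).
  apply: ge0_le_integral => //.
  - move=> x _; rewrite mule_ge0// lee_fin ?normal_pdf_ge0//.
    by rewrite exprn_ge0// sqr_ge0.
  - apply/measurable_EFinP; apply: measurable_funM; last exact: measurable_normal_pdf.
    by apply: measurable_funX; exact: exprn_measurable.
  - apply/measurable_EFinP; apply: measurable_funM => //; exact: measurable_normal_pdf.
  - by move=> x _; rewrite -!EFinM lee_fin -exprM.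
rewrite ge0_integralZl//.
- by rewrite integral_normal_pdf mule1 ltry.
- by apply/measurable_EFinP; exact: measurable_normal_pdf.
- by move=> x _; rewrite lee_fin normal_pdf_ge0.
- by rewrite lee_fin ltW.
Qed.

Lemma integrable_normal_le (f : R -> R) (C : R) n : measurable_fun setT f ->
  (forall x, `|f x| <= C * (1 + x ^+ (2 * n))) -> N01.-integrable setT (EFin \o f).
Proof.
move=> mf fC.
apply: (@le_integrable _ _ _ N01 setT measurableT _
  (fun x => (C%:E * ((1 + x ^+ (2 * n))%:E))%E)).
- exact/measurable_EFinP.
- move=> x _; rewrite -EFinM !abse_EFin lee_fin.
  by rewrite (le_trans (fC x))// ler_norm.
- apply: integrableZl => //.
  under eq_fun do rewrite EFinD.
  apply: integrableD => //; last exact: integrable_normal_pow.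
  exact: (@finite_measure_integrable_cst _ _ _ N01 setT 1).
Qed.

Lemma phi_decay n : exists2 K : R, 0 < K & forall x, (1 + x ^+ (2 * n)) * phi x <= K.
Proof.
have [C0 C00 HC0] := pow_normal_pdf 0; have [C C1 HC] := pow_normal_pdf n.
exists ((C0 + C) * normal_peak (Num.sqrt 2)).
  by rewrite mulr_gt0// ?addr_gt0// normal_peak_gt0// gt_eqF// sqrtr_gt0.
move=> x; rewrite mulrDl [leRHS]mulrDl; apply: lerD.
  rewrite mul1r; have := HC0 x; rewrite expr0 mul1r => /le_trans; apply.
  by rewrite ler_pM2l// normal_pdf_ub// gt_eqF// sqrtr_gt0.
by apply: (le_trans (HC x)); rewrite ler_pM2l// normal_pdf_ub// gt_eqF// sqrtr_gt0.
Qed.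

End gauss.

Section stein.
Context (R : realType).
Local Notation leb := (@lebesgue_measure R).
Local Notation N01 := (@normal_prob R 0 1).
Local Notation phi := (@normal_pdf R 0 1).

Lemma is_derive_phi (x : R) : is_derive x (1 : R) (phi : R -> R) (- x * phi x).
Proof.
rewrite normal_pdfE//= /normal_fun; apply: is_derive_eq.
by rewrite /GRing.scale/= expr1n; field.
Qed.

Lemma cvg_integral_cc (f : R -> R) : leb.-integrable setT (EFin \o f) ->
  (\int[leb]_(x in `[(- n%:R)%R, n%:R]) (f x)%:E)%E @[n --> \oo] --> (\int[leb]_x (f x)%:E)%E.
Proof.
move=> fi.
have mf : measurable_fun setT (EFin \o f) by exact: measurable_int fi.
pose D n : set (measurableTypeR R) := `[(- n%:R)%R, n%:R]%classic.
rewrite [X in X @ _ --> _](_ : _ = (fun n => \int[leb]_x ((EFin \o f) \_ (D n)) x)%E); last first.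
  by apply/funext => n; rewrite integral_mkcond.
have [//|//|||//|_ _] := @dominated_convergence _ (measurableTypeR R) R leb setT measurableT
  (fun n => (EFin \o f) \_ (D n)) (EFin \o f) (abse \o (EFin \o f)).
- move=> n; have mD : measurable (D n) by exact: measurable_itv.
  by apply: (measurable_restrictT (EFin \o f) mD).1; apply: measurable_funTS mf.
- apply: aeW => x _.
  apply: cvg_near_cst; near=> n; rewrite patchE mem_set// /D/= in_itv/= -ler_norml.
  by near: n; exact: nbhs_infty_ger.
- exact: integrable_abse.
- by apply: aeW => x n _; rewrite patchE; case: ifPn => //=; rewrite normr0 lee_fin.
by [].
Unshelve. all: by end_near. Qed.

Lemma stein (g g' : R -> R) (C : R) n :
  (forall x, is_derive x (1 : R) g (g' x)) -> continuous g' ->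
  (forall x, `|g x| <= C * (1 + x ^+ (2 * n))) ->
  (forall x, `|g' x| <= C * (1 + x ^+ (2 * n))) ->
  (\int[N01]_x (g' x - x * g x)%:E = 0)%E.
Proof.
move=> dg cg' gC g'C.
have cg : continuous g.
  by move=> x; apply: differentiable_continuous; apply/derivable1_diffP; case: (dg x).
have C0 : 0 <= C.
  by have := le_trans (normr_ge0 _) (gC 1); rewrite expr1n pmulr_lge0.
have cI : continuous (fun x => x : R) by move=> x; exact: cvg_id.
pose h x := g' x - x * g x.
have ch : continuous h.
  by move=> x; apply: cvgB; [exact: cg'|apply: cvgM; [exact: cvg_id|exact: cg]].
have mh : measurable_fun setT h by exact: continuous_measurable_fun.
have xpow (x : R) : 0 <= x ^+ (2 * n) by rewrite exprM exprn_ge0// sqr_ge0.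
have hC x : `|h x| <= (4 * C) * (1 + x ^+ (2 * n.+1)).
  rewrite (le_trans (ler_normB _ _))// normrM.
  apply: (@le_trans _ _ ((1 + `|x|) * (C * (1 + x ^+ (2 * n))))).
    by rewrite mulrDl mul1r lerD// ler_wpM2l.
  rewrite [4 * C]mulrC mulrCA -mulrA ler_wpM2l//.
  rewrite mulnS exprD; have := xpow x; set y := x ^+ (2 * n) => y0.
  have -> : x ^+ 2 = `|x| ^+ 2 by rewrite real_normK ?num_real.
  have [t1|t1] := leP `|x| 1.
    apply: (@le_trans _ _ (2 * (1 + y))).
      by rewrite ler_wpM2r//; lra.
    have : 0 <= `|x| ^+ 2 * y by rewrite mulr_ge0// sqr_ge0.
    have : y <= 1.
      by rewrite /y exprM -real_normK ?num_real// exprn_ile1// ?sqr_ge0// expr_le1.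
    lra.
  have t2 : `|x| <= `|x| ^+ 2 by rewrite expr2 ler_peMl// ltW.
  have : 1 <= y by rewrite /y exprM -real_normK ?num_real// exprn_ege1// expr_ge1// ltW.
  move: t1 t2; set t := `|x| => t1 t2 y1.
  have t0 : 0 <= t by rewrite normr_ge0.
  have ty : t * y <= t ^+ 2 * y by rewrite ler_wpM2r.
  have t_ty : t <= t * y by rewrite ler_peMr.
  have y_ty : y <= t * y by rewrite ler_peMl// ltW.
  lra.
have hi : N01.-integrable setT (EFin \o h) by exact: (integrable_normal_le mh hC).
have cphi : continuous phi by exact: continuous_normal_pdf.
have hphi : leb.-integrable setT (EFin \o (h \* phi)).
  apply: (@integrable_density _ (measurableTypeR R) R leb N01 phi _ _ _ (EFin \o h)) => //.
  - exact: measurable_normal_pdf.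
  - exact: normal_pdf_ge0.
  - exact/measurable_EFinP.
rewrite integral_normal; last exact/measurable_EFinP.
have dF x : is_derive x (1 : R) (g \* phi) (h x * phi x).
  apply: (is_derive_eq (is_deriveM (dg x) (is_derive_phi x))).
  by rewrite /h /GRing.scale/=; ring.
have FTC m : (\int[leb]_(x in `[(- m.+1%:R)%R, m.+1%:R]) (h x * phi x)%:E =
    (g m.+1%:R * phi m.+1%:R)%:E - (g (- m.+1%:R) * phi (- m.+1%:R))%:E)%E.
  have cF : continuous (g \* phi) by move=> x; apply: cvgM; [exact: cg|exact: cphi].
  apply: (@continuous_FTC2 _ (h \* phi) (g \* phi)).
  - by rewrite gtrN.
  - by apply: continuous_subspaceT => x; apply: cvgM; [exact: ch|exact: cphi].
  - split; first by move=> x _; case: (dF x).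
      by apply: cvg_at_right_filter; exact: cF.
    by apply: cvg_at_left_filter; exact: cF.
  - by move=> x _; rewrite derive1E; case: (dF x).
have := cvg_integral_cc hphi; rewrite -(cvg_shiftS _) => /cvg_lim <-//.
apply/cvg_lim => //.
under eq_fun do rewrite FTC.
apply: cvg_EFin; first exact: nearW.
have [K K0 HK] := @phi_decay R n.+1.
have Fx m : `|g m.+1%:R * phi m.+1%:R| + `|g (- m.+1%:R) * phi (- m.+1%:R)| <= 4 * C * K * m.+1%:R^-1.
  have one (x : R) : 1 <= `|x| -> `|g x * phi x| <= 2 * C * K / `|x|.
    move=> x1; have x0 : 0 < `|x| by rewrite (lt_le_trans _ x1).
    rewrite normrM (ger0_norm (normal_pdf_ge0 0 1 x)) ler_pdivlMr//.
    have p0 := normal_pdf_ge0 0 1 x.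
    apply: (@le_trans _ _ (C * (1 + x ^+ (2 * n)) * phi x * x ^+ 2)).
      rewrite -[x ^+ 2]real_normK ?num_real// expr2.
      apply: ler_pM => //; rewrite ?mulr_ge0//.
        by rewrite ler_wpM2r.
      by rewrite ler_peMr.
    have := HK x; rewrite mulnS exprD; have := xpow x; set y := x ^+ (2 * n) => y0 HKx.
    have x2 : 1 <= x ^+ 2 by rewrite -[x ^+ 2]real_normK ?num_real// exprn_ege1.
    rewrite -!mulrA [2 * _]mulrCA ler_wpM2l//.
    apply: (@le_trans _ _ (2 * ((1 + x ^+ 2 * y) * phi x))); last by rewrite ler_wpM2l.
    rewrite [phi x * _]mulrC !mulrA ler_wpM2r//.
    have y1 : 1 <= y by rewrite /y exprM exprn_ege1.
    have : x ^+ 2 <= x ^+ 2 * y by rewrite ler_peMr// sqr_ge0.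
    lra.
  have m1 : 1 <= m.+1%:R :> R by rewrite ler1n.
  have nm : `|m.+1%:R| = m.+1%:R :> R by rewrite ger0_norm.
  have := one m.+1%:R; have := one (- m.+1%:R); rewrite normrN nm.
  move=> /(_ m1) h1 /(_ m1) h2; apply: (le_trans (lerD h2 h1)).
  set z := m.+1%:R^-1.
  by rewrite (_ : 4 * C * K * z = 2 * C * K * z + 2 * C * K * z); [|ring].
apply/norm_cvg0P.
apply: (@squeeze_cvgr _ _ _ _ (cst 0) (fun m => 4 * C * K * m.+1%:R^-1)).
- by apply: nearW => m; rewrite normr_ge0/= (le_trans _ (Fx m))// ler_normB.
- exact: cvg_cst.
- rewrite -[X in _ --> X](mulr0 (4 * C * K)); apply: cvgM; first exact: cvg_cst.
  exact: cvg_harmonic.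
Qed.

Lemma normal_mean0 : (\int[N01]_x (x%:E) = 0)%E.
Proof.
have d1 (x : R) : is_derive x (1 : R) (cst (1 : R) : R -> R) ((cst 0 : R -> R) x).
  exact: is_derive_cst.
have := @stein (cst 1) (cst 0) 1 0 d1.
have -> : (fun x : R => ((cst 0 x - x * cst 1 x)%:E)%E) = (fun x : R => ((- x)%:E)%E).
  by apply/funext => x; rewrite /= mulr1 sub0r.
move=> H; have {H} : (\int[N01]_x ((- x)%:E) = 0)%E.
  apply: H; first by move=> x; exact: cvg_cst.
  - by move=> x /=; rewrite normr1 mul1r lerDl exprM exprn_ge0// sqr_ge0.
  - by move=> x /=; rewrite normr0 mul1r addr_ge0// exprM exprn_ge0// sqr_ge0.
under eq_integral do rewrite EFinN.
rewrite integralN/=; last first.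
  have i1 : N01.-integrable setT (EFin \o (id : R -> R)).
    apply: (@integrable_normal_le R id 1 1) => // x.
    have : `|x| ^+ 2 = x ^+ 2 by rewrite real_normK ?num_real.
    rewrite muln1; nra.
  exact: integrable_add_def i1.
by move=> /eqP; rewrite oppe_eq0 => /eqP.
Qed.

Lemma normal_var1 : (\int[N01]_x ((x ^+ 2)%:E) = 1)%E.
Proof.
have d1 (x : R) : is_derive x (1 : R) (id : R -> R) ((cst 1 : R -> R) x).
  exact: is_derive_id.
have xb (x : R) : `|x| <= 1 * (1 + x ^+ (2 * 1)).
  have : `|x| ^+ 2 = x ^+ 2 by rewrite real_normK ?num_real.
  rewrite muln1; nra.
have := @stein id (cst 1) 1 1 d1.
have -> : (fun x : R => ((cst 1 x - x * id x)%:E)%E) = (fun x : R => (1 - (x ^+ 2)%:E)%E).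
  by apply/funext => x; rewrite /= expr2.
move=> H; have {H} : (\int[N01]_x (1 - (x ^+ 2)%:E) = 0)%E.
  apply: H => //; first by move=> x; exact: cvg_cst.
  by move=> x /=; rewrite normr1 mul1r lerDl exprM exprn_ge0// sqr_ge0.
have i2 := @integrable_normal_pow R 1; rewrite muln1 in i2.
rewrite integralB//; last exact: (@finite_measure_integrable_cst _ _ _ N01 setT 1).
rewrite integral_cst// mul1e/= probability_setT.
have := integrable_fin_num measurableT i2.
case: (\int[_]_x _)%E => // r _ /eqP.
by rewrite -EFinB eqe subr_eq0 => /eqP ->.
Qed.

Lemma normal_charfun (t : R) :
  \int[N01]_x cos (t * x) = expR (- (t ^+ 2 / 2)).
Proof.
pose f (t y : R) := cos (t * y).
pose F (t : R) := \int[N01]_y f t y.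
have ccos : continuous (fun y : R => cos y) by exact: continuous_cos.
have csin : continuous (fun y : R => sin y) by exact: continuous_sin.
have cmul (s : R) : continuous (fun y : R => s * y).
  by move=> y; apply: cvgM; [exact: cvg_cst|exact: cvg_id].
have ccosM (s : R) : continuous (fun y => cos (s * y)).
  by move=> y; apply: continuous_comp; [exact: cmul|exact: ccos].
have csinM (s : R) : continuous (fun y => sin (s * y)).
  by move=> y; apply: continuous_comp; [exact: cmul|exact: csin].
have cosb (y : R) : `|cos y| <= 1 by rewrite ler_norml cos_geN1 cos_le1.
have sinb (y : R) : `|sin y| <= 1 by rewrite ler_norml sin_geN1 sin_le1.
have intf s : N01.-integrable setT (EFin \o f s).
  apply: (@integrable_normal_le R (f s) 1 0); first exact: continuous_measurable_fun (ccosM s).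
  move=> y; rewrite muln0 expr0; apply: (le_trans (cosb _)); lra.
have df s y : is_derive s (1 : R) (f ^~ y) (- y * sin (s * y)).
  rewrite /f; apply: is_derive_eq.
  by rewrite /GRing.scale/=; ring.
have xb (x : R) : `|x| <= 1 * (1 + x ^+ (2 * 1)).
  have : `|x| ^+ 2 = x ^+ 2 by rewrite real_normK ?num_real.
  rewrite muln1; nra.
have isin s : N01.-integrable setT (EFin \o (fun y => - y * sin (s * y))).
  apply: (@integrable_normal_le R _ 1 1).
    apply: continuous_measurable_fun => y; apply: cvgM; last exact: csinM.
    by apply: cvgN; exact: cvg_id.
  move=> y; apply: le_trans (xb y); rewrite normrM normrN ler_piMr//.
have dF s : is_derive s (1 : R) F (\int[N01]_y (- y * sin (s * y))).
  have s1 : `]s - 1, s + 1[%classic s by rewrite /= in_itv/=; lra.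
  have i1 x : `]s - 1, s + 1[%classic x -> N01.-integrable setT (EFin \o f x) by [].
  have i2 x y : `]s - 1, s + 1[%classic x -> setT y -> derivable (f ^~ y) x 1.
    by move=> _ _; case: (df x y).
  have i3 : N01.-integrable setT (EFin \o (fun y => `|y|)).
    apply: (@integrable_normal_le R _ 1 1) => [|y].
      by apply: measurableT_comp => //.
    by rewrite normr_id.
  have i4 x y : `]s - 1, s + 1[%classic x -> setT y -> `|partial1of2 f x y| <= `|y|.
    move=> _ _; rewrite partial1of2E; have := df x y => -[_ ->].
    by rewrite normrM normrN ler_piMr.
  have D := @derivable_under_integral R _ _ N01 f setT measurableT s (s - 1) (s + 1) s1 i1 i2
    (fun y => `|y|) (fun y => normr_ge0 y) i3 i4.
  have E := @differentiation_under_integral R _ _ N01 f setT measurableT s (s - 1) (s + 1) s1 i1 i2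
    (fun y => `|y|) (fun y => normr_ge0 y) i3 i4.
  apply: DeriveDef; first exact: D.
  rewrite -derive1E E; apply: eq_Rintegral => y _.
  by rewrite partial1of2E; have [_ ->] := df s y.
have steinF s : \int[N01]_y (- y * sin (s * y)) = - s * F s.
  have d1 (x : R) : is_derive x (1 : R) (fun y => sin (s * y)) (s * cos (s * x)).
    by apply: is_derive_eq; rewrite /GRing.scale/=; ring.
  have := @stein (fun y => sin (s * y)) (fun y => s * cos (s * y)) (1 + `|s|) 0 d1.
  rewrite muln0 => H; have {H} : (\int[N01]_x (s * cos (s * x) - x * sin (s * x))%:E = 0)%E.
    apply: H.
    - by move=> y; apply: cvgM; [exact: cvg_cst|exact: ccosM].
    - by move=> y; rewrite expr0; have := sinb (s * y); have := normr_ge0 s; nra.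
    - move=> y; rewrite expr0 normrM; have := cosb (s * y); have := normr_ge0 s.
      have := normr_ge0 (cos (s * y)); nra.
  rewrite (eq_integral (fun x : measurableTypeR R =>
     ((s * f s x)%:E + (- x * sin (s * x))%:E))%E); last first.
    by move=> y _; rewrite -EFinD mulNr.
  have is' : N01.-integrable setT (fun x => (s * f s x)%:E).
    by have := integrableZl measurableT s (intf s).
  rewrite integralD// => [H|]; last exact: isin.
  rewrite /F mulNr -RintegralZl//; apply/eqP; rewrite -subr_eq0 opprK addrC.
  by rewrite /Rintegral -fineD ?H//; apply: integrable_fin_num => //; exact: isin.
pose G (s : R) := F s * expR (s ^+ 2 / 2).
have dG s : is_derive s (1 : R) G 0.
  have := dF s; rewrite steinF => dFs.
  apply: is_derive_eq.
  by rewrite /GRing.scale/=; field.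
have F0 : F 0 = 1.
  rewrite /F /f; under eq_Rintegral do rewrite mul0r cos0.
  by rewrite Rintegral_cst// mul1r/= probability_setT.
have := is_derive_0_is_cst t 0 dG; rewrite /G F0 expr0n/= mul0r expR0 mul1r.
move=> H; transitivity (F t * expR (t ^+ 2 / 2) * expR (- (t ^+ 2 / 2))).
  by rewrite -mulrA -expRD addrN expR0 mulr1.
by rewrite H mul1r.
Qed.

End stein.

Section affine.
Context (R : realType).
Local Notation leb := (@lebesgue_measure R).
Local Notation N01 := (@normal_prob R 0 1).
Local Notation phi := (@normal_pdf R 0 1).

Lemma normal_pdfN (m s : R) : normal_pdf m (- s) = normal_pdf m s.
Proof.
by apply/funext => x; rewrite /normal_pdf oppr_eq0 /normal_peak /normal_fun sqrrN.
Qed.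

Lemma normal_affine (m s : R) (G : R -> R) : s != 0 -> continuous G ->
  (forall x, 0 <= G x) ->
  (\int[normal_prob m s]_x (G x)%:E = \int[N01]_y (G (m + `|s| * y))%:E)%E.
Proof.
move=> s0 cG G0.
have cF : continuous (fun y : R => m + `|s| * y).
  by move=> y; apply: cvgD; [exact: cvg_cst|apply: cvgM; [exact: cvg_cst|exact: cvg_id]].
have cGF : continuous (fun y : R => G (m + `|s| * y)).
  by move=> y; apply: continuous_comp; [exact: cF|exact: cG].
have [t t0 [st abst]] : exists2 t, 0 < t & normal_pdf m s = normal_pdf m t /\ `|s| = t.
  exists `|s|; first by rewrite normr_gt0.
  split => //; have [s1|s1] := leP 0 s; first by rewrite ger0_norm.
  by rewrite ltr0_norm// normal_pdfN.
have tn0 : t != 0 by rewrite gt_eqF.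
have mE (f : R -> R) : continuous f -> measurable_fun setT (EFin \o f).
  by move=> cf; apply/measurable_EFinP; exact: continuous_measurable_fun.
rewrite (ge0_integral_normal _ _ (mE _ cG)); last by move=> x; rewrite lee_fin.
rewrite (ge0_integral_normal _ _ (mE _ cGF)); last by move=> x; rewrite lee_fin.
rewrite abst st in cF cGF *; under eq_integral do rewrite -EFinM.
have dF (x : R) : is_derive x (1 : R) (fun y : R => m + t * y) t.
  by apply: is_derive_eq; rewrite /GRing.scale/=; ring.
have F' : (fun y : R => m + t * y)^`()%classic = cst t.
  by apply/funext => x; rewrite derive1E; have [_ ->] := dF x.
rewrite (@increasing_ge0_integration_by_substitutionT _ (fun y : R => m + t * y)
  (fun x => G x * normal_pdf m t x)).
- apply: eq_integral => y _; rewrite F'; congr EFin.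
  transitivity (G (m + t * y) * (normal_pdf m t (m + t * y) * t)); first by rewrite mulrA.
  congr (_ * _); rewrite !normal_pdfE// /normal_fun /normal_peak.
  rewrite (_ : (m + t * y - m) ^+ 2 = t ^+ 2 * y ^+ 2); last by ring.
  rewrite (_ : - (t ^+ 2 * y ^+ 2) / (t ^+ 2 *+ 2) = - (y - 0) ^+ 2 / (1 ^+ 2 *+ 2)); last by field.
  rewrite mulrAC; congr (_ * _).
  rewrite -!mulrnAr sqrtrM ?sqr_ge0// sqrtr_sqr gtr0_norm// expr1n mul1r.
  by rewrite invfM mulrAC mulVf// mul1r.
- by move=> x y xy; rewrite ltrD2l ltr_pM2l.
- by rewrite F' => x; exact: cvg_cst.
- by rewrite F'; exact: is_cvg_cst.
- by rewrite F'; exact: is_cvg_cst.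
- by move=> x; case: (dF x).
- apply/cvgrNyPle => A.
  apply: filterS (nbhs_ninfty_le (num_real ((A - m) / t))) => x.
  by rewrite ler_pdivlMr// lerBrDl mulrC.
- apply/cvgryPge => A.
  apply: filterS (nbhs_pinfty_ge (num_real ((A - m) / t))) => x.
  by rewrite ler_pdivrMr// lerBlDl mulrC.
- by move=> x; apply: cvgM; [exact: cG|exact: continuous_normal_pdf].
- by move=> x; rewrite mulr_ge0// normal_pdf_ge0.
Qed.

Lemma normal_second_moment (m s : R) : s != 0 ->
  (\int[normal_prob m s]_x (x ^+ 2)%:E = (m ^+ 2 + s ^+ 2)%:E)%E.
Proof.
move=> s0; rewrite (@normal_affine m s (fun x => x ^+ 2)) => //; last first.
- by move=> x; exact: sqr_ge0.
- exact: exprn_continuous.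
have i1 : N01.-integrable setT (EFin \o (id : R -> R)).
  apply: (@integrable_normal_le R id 1 1) => // x.
  have : `|x| ^+ 2 = x ^+ 2 by rewrite real_normK ?num_real.
  rewrite muln1; nra.
have i2 := @integrable_normal_pow R 1; rewrite muln1 in i2.
have i0 := (@finite_measure_integrable_cst _ _ _ N01 setT (m ^+ 2) measurableT).
rewrite (eq_integral (fun y : measurableTypeR R => ((m ^+ 2)%:E +
  ((2 * m * `|s|)%:E * y%:E + (s ^+ 2)%:E * (y ^+ 2)%:E))%E)); last first.
  move=> y _; rewrite -!EFinM -!EFinD -[s ^+ 2]real_normK ?num_real//; congr EFin; ring.
have i1' := integrableZl measurableT (2 * m * `|s|) i1.
have i2' := integrableZl measurableT (s ^+ 2) i2.
rewrite integralD//; last exact: integrableD.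
rewrite integralD// !integralZl// normal_mean0 normal_var1 mule0 add0e mule1.
by rewrite integral_cst//= probability_setT mule1 EFinD.
Qed.

End affine.

Section centered_gaussian.
Context d (T : measurableType d) (R : realType) (P : probability T R).
Local Notation N01 := (@normal_prob R 0 1).

Definition centered_gaussian (X : T -> R) (v : R) :=
  [/\ measurable_fun setT X, 0 <= v & forall G : R -> R, continuous G -> (forall x, 0 <= G x) ->
    (\int[P]_w (G (X w))%:E = \int[N01]_y (G (Num.sqrt v * y))%:E)%E].

Lemma integrable_sqr (X : T -> R) : measurable_fun setT X ->
  (\int[P]_w (X w ^+ 2)%:E < +oo)%E -> P.-integrable setT (EFin \o X).
Proof.
move=> mX X2.
have i0 := (@finite_measure_integrable_cst _ _ _ P setT 1 measurableT).
apply: (@le_integrable _ _ _ P setT measurableT _ (fun w => (1%:E + (X w ^+ 2)%:E)%E)).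
- exact/measurable_EFinP.
- move=> w _; rewrite -EFinD/= lee_fin [leRHS]ger0_norm ?addr_ge0 ?sqr_ge0//.
  have : `|X w| ^+ 2 = X w ^+ 2 by rewrite real_normK ?num_real.
  nra.
- apply: integrableD => //; apply/integrableP; split.
    by apply/measurable_EFinP; apply: measurable_funX.
  by under eq_integral do rewrite gee0_abs ?lee_fin ?sqr_ge0//.
Qed.

Lemma gaussian_centered (X : T -> R) (v : R) : gaussian P X ->
  (\int[P]_w (X w)%:E = 0)%E -> (\int[P]_w (X w ^+ 2)%:E = v%:E)%E ->
  centered_gaussian X v.
Proof.
move=> [mX [m [s law]]] EX EX2.
have v0 : 0 <= v by rewrite -lee_fin -EX2 integral_ge0// => w _; rewrite lee_fin sqr_ge0.
have iX : P.-integrable setT (EFin \o X) by apply: integrable_sqr => //; rewrite EX2 ltry.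
have i0 := (@finite_measure_integrable_cst _ _ _ P setT 1 measurableT).
have i2 : P.-integrable setT (fun w => (X w ^+ 2)%:E).
  apply/integrableP; split.
    by apply/measurable_EFinP; apply: measurable_funX.
  by under eq_integral do rewrite gee0_abs ?lee_fin ?sqr_ge0//; rewrite EX2 ltry.
have EX1 : (\int[P]_w ((X w + 1) ^+ 2)%:E = (v + 1)%:E)%E.
  under eq_integral => w _.
    rewrite (_ : (X w + 1) ^+ 2 = X w ^+ 2 + (2 * X w + 1)); last by ring.
    rewrite EFinD (EFinD (2 * X w)) (EFinM 2); over.
  have i1 := integrableZl measurableT 2 iX.
  rewrite integralD//; last exact: integrableD.
  rewrite integralD// integralZl// EX EX2 mule0 add0e.
  by rewrite integral_cst//= probability_setT mule1 EFinD.
have push (G : R -> R) : measurable_fun setT G -> (forall x, 0 <= G x) ->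
    (\int[P]_w (G (X w))%:E = \int[pushforward P (X : T -> measurableTypeR R)]_x (G x)%:E)%E.
  move=> mG G0; rewrite ge0_integral_pushforward//; first exact/measurable_EFinP.
  by move=> y _; rewrite lee_fin.
have mpow (c : R) : measurable_fun setT (fun x : R => (x + c) ^+ 2).
  by apply: measurable_funX; apply: measurable_funD.
have [s0|s0] := eqVneq s 0.
  have law0 (G : R -> R) : measurable_fun setT G -> (forall x : R, 0 <= G x) ->
     (\int[P]_w (G (X w))%:E = (G m)%:E)%E.
    move=> mG G0; rewrite push//.
    rewrite (@eq_measure_integral _ (measurableTypeR R) _ _ (\d_(m : measurableTypeR R))); last first.
      by move=> A mA _; have := law A mA; rewrite s0 eqxx.
    rewrite integral_dirac//=; first by rewrite diracT mul1e.
    exact/measurable_EFinP.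
  have m2 : m ^+ 2 = v.
    have := law0 (fun x => (x + 0) ^+ 2) (mpow 0).
    under eq_integral do rewrite addr0.
    by rewrite EX2 => /(_ (fun x => sqr_ge0 _)) [->]; rewrite addr0.
  have m21 : (m + 1) ^+ 2 = v + 1.
    have := law0 (fun x => (x + 1) ^+ 2) (mpow 1).
    by rewrite EX1 => /(_ (fun x => sqr_ge0 _)) [->].
  have m0 : m = 0 by rewrite -m2 in m21; lra.
  have {}v0 : v = 0 by rewrite -m2 m0 expr0n.
  split => //; first by rewrite v0.
  move=> G cG G0; rewrite law0//; last exact: continuous_measurable_fun.
  rewrite (eq_integral (fun _ : measurableTypeR R => (G m)%:E)).
    by rewrite integral_cst//= probability_setT mule1.
  by move=> y _; rewrite v0 sqrtr0 mul0r m0.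
have lawE (G : R -> R) : continuous G -> (forall x : R, 0 <= G x) ->
    (\int[P]_w (G (X w))%:E = \int[normal_prob m s]_x (G x)%:E)%E.
  move=> cG G0; rewrite push//; last exact: continuous_measurable_fun.
  rewrite [LHS](@eq_measure_integral _ _ _ _ (normal_prob m s))//.
  by move=> A mA _; have := law A mA; rewrite (negbTE s0).
have cpow (c : R) : continuous (fun x : R => (x + c) ^+ 2).
  move=> x; apply: (@continuous_comp _ _ _ (fun x => x + c) (fun x => x ^+ 2)).
    by apply: cvgD; [exact: cvg_id|exact: cvg_cst].
  exact: exprn_continuous.
have m2 : m ^+ 2 + s ^+ 2 = v.
  have := lawE (fun x => x ^+ 2) (@exprn_continuous _ 2).
  by rewrite EX2 normal_second_moment// => /(_ (fun x => sqr_ge0 _)) [->].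
have m21 : (m + 1) ^+ 2 + s ^+ 2 = v + 1.
  have := lawE (fun x => (x + 1) ^+ 2) (cpow 1) (fun x => sqr_ge0 _).
  rewrite EX1 (@normal_affine _ m s (fun x => (x + 1) ^+ 2))//; last by move=> x; exact: sqr_ge0.
  under eq_integral do rewrite addrAC.
  rewrite -(@normal_affine _ (m + 1) s (fun x => x ^+ 2))//; last 2 first.
  - exact: exprn_continuous.
  - by move=> x; exact: sqr_ge0.
  by rewrite normal_second_moment// => -[->].
have m0 : m = 0 by rewrite -m2 in m21; lra.
have sv : Num.sqrt v = `|s| by rewrite -m2 m0 expr0n add0r sqrtr_sqr.
split => [//|//|G cG G0].
rewrite (lawE G cG G0) (normal_affine m s0 cG G0) sv.
by apply: eq_integral => y _; rewrite m0 add0r.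
Qed.

Lemma centered_gaussian_cos (X : T -> R) v : centered_gaussian X v ->
  \int[P]_w cos (X w) = expR (- (v / 2)).
Proof.
move=> [mX v0 law].
have c1 : continuous (fun x : R => 1 + cos x).
  by move=> x; apply: cvgD; [exact: cvg_cst|exact: continuous_cos].
have c0 (x : R) : 0 <= 1 + cos x by have := cos_geN1 x; lra.
have aux dd (T' : measurableType dd) (Q : probability T' R) (Z : T' -> R) : measurable_fun setT Z ->
    (\int[Q]_w (1 + cos (Z w))%:E = 1 + (\int[Q]_w cos (Z w))%:E)%E.
  move=> mZ.
  have i1 : Q.-integrable setT (EFin \o (fun w => cos (Z w))).
    apply: measurable_bounded_integrable => //.
    - by rewrite (@le_lt_trans _ _ 1%E) ?ltry// probability_le1.
    - apply: (measurableT_comp (f := @cos R)) => //.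
      by apply: continuous_measurable_fun; exact: continuous_cos.
    - exists 1; split; rewrite ?num_real// => y y1 w _ /=.
      by apply: le_trans (ltW y1); rewrite ler_norml cos_geN1 cos_le1.
  under eq_integral do rewrite EFinD.
  rewrite integralD//; last exact: (@finite_measure_integrable_cst _ _ _ Q setT 1).
  rewrite integral_cst//= probability_setT mule1 /Rintegral fineK//.
  exact: integrable_fin_num.
have := law _ c1 c0; rewrite aux// (@aux _ _ N01 (fun y => Num.sqrt v * y)).
  rewrite -!EFinD => -[/addrI ->].
  by rewrite normal_charfun sqr_sqrtr.
exact: mulrl_measurable.
Qed.

Lemma measurable_abs_powR (q : R) : measurable_fun setT (fun y : R => `|y| `^ q).
Proof.
have /measurableT_comp := measurable_powR q; apply.
exact: normr_measurable.
Qed.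

Lemma normal_abs_moment_fin (q : R) : 0 <= q ->
  (\int[N01]_y (`|y| `^ q)%:E = (normal_abs_moment q)%:E)%E.
Proof.
move=> q0; rewrite /normal_abs_moment /Rintegral fineK//.
apply: integrable_fin_num => //.
have [n qn] : exists n : nat, q <= (2 * n)%:R.
  exists (Num.truncn q).+1; rewrite ltW// (lt_le_trans (truncnS_gt _))// ler_nat.
  by rewrite leq_pmull.
apply: (@integrable_normal_le R (fun y => `|y| `^ q) 1 n).
  exact: measurable_abs_powR.
move=> x; rewrite mul1r ger0_norm ?powR_ge0//.
have xe : x ^+ (2 * n) = `|x| ^+ (2 * n) by rewrite !exprM real_normK ?num_real.
rewrite xe; have [x1|x1] := leP 1 `|x|.
  rewrite (@le_trans _ _ (`|x| `^ (2 * n)%:R))//; first by rewrite ler_powR.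
  by rewrite powR_mulrn// lerDr.
rewrite (@le_trans _ _ 1)//; last by rewrite lerDl exprn_ge0.
rewrite (_ : 1 = 1 `^ q); last by rewrite powR1.
by apply: ge0_ler_powR => //; rewrite ?nnegrE// ltW.
Qed.

Lemma normal_abs_moment_scale (q v : R) : 0 <= q -> 0 <= v ->
  (\int[N01]_y (`|Num.sqrt v * y| `^ q)%:E = (v `^ (q / 2) * normal_abs_moment q)%:E)%E.
Proof.
move=> q0 v0; rewrite EFinM -normal_abs_moment_fin//.
rewrite -ge0_integralZl//.
- apply: eq_integral => y _; rewrite -EFinM normrM powRM// ger0_norm ?sqrtr_ge0//.
  by rewrite -powR12_sqrt// -powRrM [2^-1 * q]mulrC.
- apply/measurable_EFinP.
  exact: measurable_abs_powR.
- by rewrite lee_fin powR_ge0.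
Qed.

End centered_gaussian.

Section powR_ucont.
Context (R : realType).

Lemma powR_ucont (q B k : R) : 0 < q -> 0 <= B -> 0 < k ->
  exists2 e : R, 0 < e & forall y y' : R, 0 <= y <= B -> 0 <= y' <= B -> `|y - y'| < e ->
    `|y `^ q - y' `^ q| <= k.
Proof.
move=> q0 B0 k0.
pose k' := Num.min (2^-1) (k / (B `^ q + 1)).
have Bq : 0 < B `^ q + 1 by rewrite ltr_wpDl// powR_ge0.
have k'0 : 0 < k' by rewrite lt_min invr_gt0 ltr0n/= divr_gt0.
have k'1 : k' <= 2^-1 by rewrite ge_min lexx.
have k'k : B `^ q * k' <= k.
  apply: (@le_trans _ _ (B `^ q * (k / (B `^ q + 1)))).
    by rewrite ler_wpM2l ?powR_ge0// ge_min lexx orbT.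
  by rewrite mulrCA -[leRHS]mulr1 ler_pM2l// ler_pdivrMr// mul1r lerDl.
pose r := (1 - k') `^ q^-1.
have k'lt : 0 < 1 - k' by lra.
have r0 : 0 < r by rewrite powR_gt0.
have rq : r `^ q = 1 - k' by rewrite -powRrM mulVf ?gt_eqF// powRr1// ltW.
have r1 : r < 1.
  rewrite ltNge; apply/negP => r1.
  have : 1 `^ q <= r `^ q by apply: ge0_ler_powR => //; rewrite ?nnegrE ?ltW.
  by rewrite powR1 rq; lra.
pose h := k `^ q^-1.
have h0 : 0 < h by rewrite powR_gt0.
have hq : h `^ q = k by rewrite -powRrM mulVf ?gt_eqF// powRr1// ltW.
exists ((1 - r) * h); first by rewrite mulr_gt0// subr_gt0.
move=> y y'; wlog yy' : y y' / y <= y'.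
  move=> H; have [/H//|/ltW /H {}H] := leP y y'.
  by move=> hy hy'; rewrite (distrC y) (distrC (y `^ q)); exact: H.
move=> /andP[y0 yB] /andP[y'0 y'B]; rewrite !(distrC y) !(distrC (y `^ q)).
have yq : y `^ q <= y' `^ q by apply: ge0_ler_powR => //; rewrite ?nnegrE ?ltW.
rewrite ger0_norm ?subr_ge0// ger0_norm ?subr_ge0// => yyh.
have [y'h|hy'] := leP y' h.
  rewrite lerBlDr (@le_trans _ _ k) ?lerDl ?powR_ge0// -hq.
  by apply: ge0_ler_powR => //; rewrite ?nnegrE ?ltW.
have ry : r * y' <= y.
  have : (1 - r) * h <= (1 - r) * y' by rewrite ler_wpM2l ?subr_ge0 ?ltW.
  by move=> H; have := le_trans (ltW yyh) H; rewrite mulrBl mul1r lerD2l lerN2.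
have : (r * y') `^ q <= y `^ q.
  by apply: ge0_ler_powR => //; rewrite ?nnegrE ?mulr_ge0 ?(ltW q0) ?(ltW r0).
rewrite (powRM _ (ltW r0) y'0) rq => rqy.
have : y' `^ q * k' <= B `^ q * k'.
  by apply: ler_wpM2r; [exact: ltW|apply: ge0_ler_powR => //; rewrite ?nnegrE ?(ltW q0)].
move=> H; apply: le_trans (le_trans H k'k); rewrite lerBlDr -lerBlDl.
by move: rqy; rewrite mulrBl mul1r [k' * _]mulrC.
Qed.

End powR_ucont.

Section bernstein.
Context (R : realType).

Fixpoint bern n (g : nat -> R) (y : R) : R :=
  if n is m.+1 then (1 - y) * bern m g y + y * bern m (fun k => g k.+1) y else g 0%N.

Lemma bern_affine n (a b : R) g y : bern n (fun k => a * g k + b) y = a * bern n g y + b.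
Proof.
elim: n g => [//|n IH] g /=.
by rewrite (IH g) (IH (fun k => g k.+1)); ring.
Qed.

Lemma bern_le n g h y : 0 <= y <= 1 -> (forall k, (k <= n)%N -> `|g k| <= h k) ->
  `|bern n g y| <= bern n h y.
Proof.
move=> /andP[y0 y1]; elim: n g h => [|n IH] g h gh /=; first exact: gh.
apply: (le_trans (ler_normD _ _)); rewrite !normrM (ger0_norm y0) ger0_norm ?subr_ge0//.
apply: lerD; apply: ler_wpM2l; rewrite ?subr_ge0//.
  by apply: IH => k kn; apply: gh; exact: leqW.
by apply: IH => k kn; apply: gh.
Qed.

Lemma bern_sqr n (a y : R) :
  bern n (fun k => (k%:R - a) ^+ 2) y = n%:R * y * (1 - y) + (n%:R * y - a) ^+ 2.
Proof.
elim: n a => [|n IH] a /=; first by rewrite !mul0r !add0r.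
rewrite (IH a).
have -> : (fun k : nat => (k.+1%:R - a) ^+ 2) = (fun k : nat => (k%:R - (a - 1)) ^+ 2).
  by apply/funext => k; rewrite -natr1; ring.
by rewrite (IH (a - 1)) -natr1; ring.
Qed.

Lemma bern_powR (q k : R) : 0 < q -> 0 < k ->
  exists n g, forall y : R, 0 <= y <= 1 -> `|y `^ q - bern n g y| <= k.
Proof.
move=> q0 k0; have k20 : 0 < k / 2 by lra.
have [e e0 He] := powR_ucont q0 ler01 k20.
pose C := (e ^+ 2)^-1.
have C0 : 0 < C by rewrite invr_gt0 exprn_gt0.
pose n := (Num.truncn (C / (k / 2))).+1.
have nn : C / (k / 2) < n%:R by exact: truncnS_gt.
have n0 : 0 < n%:R :> R by rewrite ltr0n.
exists n, (fun i => (i%:R / n%:R) `^ q) => y y01.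
have i01 (i : nat) : (i <= n)%N -> 0 <= (i%:R / n%:R : R) <= 1.
  by move=> ni; rewrite divr_ge0//= ler_pdivrMr// mul1r ler_nat.
have pw1 (z : R) : 0 <= z <= 1 -> 0 <= z `^ q <= 1.
  move=> /andP[z0 z1]; rewrite powR_ge0/= (_ : 1 = 1 `^ q); last by rewrite powR1.
  by apply: ge0_ler_powR => //; rewrite ?nnegrE ?ltW// ler01.
rewrite (_ : _ - _ = bern n (fun i => -1 * (i%:R / n%:R) `^ q + y `^ q) y); last first.
  by rewrite bern_affine; ring.
have key (z : R) : 0 <= z <= 1 -> `|y `^ q - z `^ q| <= C * (z - y) ^+ 2 + k / 2.
  move=> z01; have [ez|ez] := ltP `|y - z| e.
    by apply: (le_trans (He _ _ y01 z01 ez)); rewrite lerDr mulr_ge0 ?sqr_ge0// ltW.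
  have : 1 <= C * (z - y) ^+ 2.
    rewrite mulrC ler_pdivlMr ?exprn_gt0// mul1r -[leRHS]real_normK ?num_real//.
    by apply: lerXn2r; rewrite ?nnegrE ?(ltW e0)// distrC.
  have := pw1 _ y01; have := pw1 _ z01; rewrite ler_norml; lra.
apply: (@le_trans _ _ (bern n (fun i => (C / n%:R ^+ 2) * (i%:R - n%:R * y) ^+ 2 + k / 2) y)).
  apply: bern_le => // i ni; rewrite mulN1r addrC; apply: (le_trans (key _ (i01 i ni))).
  rewrite lerD2r le_eqVlt; apply/orP; left; apply/eqP; field.
  by rewrite gt_eqF.
rewrite bern_affine bern_sqr subrr expr0n/= addr0.
have -> : C / n%:R ^+ 2 * (n%:R * y * (1 - y)) = C / n%:R * (y * (1 - y)).
  by field; rewrite gt_eqF.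
have Cn : C / n%:R < k / 2 by rewrite ltr_pdivrMr// mulrC -ltr_pdivrMr.
have Cn0 : 0 <= C / n%:R by rewrite divr_ge0// ltW.
move: y01 => /andP[y0 y1].
have : C / n%:R * (y * (1 - y)) <= C / n%:R * 1.
  by rewrite ler_wpM2l//; nra.
lra.
Qed.

End bernstein.

Section trig.
Context (R : realType).

Definition trig (l : seq (R * R)) (x : R) : R := \sum_(a <- l) a.1 * cos (a.2 * x).

Definition is_trig (f : R -> R) := exists l, f = trig l.

Lemma is_trig_cst c : is_trig (fun _ => c).
Proof.
by exists [:: (c, 0)]; apply/funext => x; rewrite /trig big_seq1/= mul0r cos0 mulr1.
Qed.

Lemma is_trig_cos c : is_trig (fun x => cos (c * x)).
Proof. by exists [:: (1, c)]; apply/funext => x; rewrite /trig big_seq1/= mul1r. Qed.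

Lemma is_trigD f g : is_trig f -> is_trig g -> is_trig (fun x => f x + g x).
Proof.
move=> [l ->] [m ->]; exists (l ++ m).
by apply/funext => x; rewrite /trig big_cat.
Qed.

Lemma is_trigZ c f : is_trig f -> is_trig (fun x => c * f x).
Proof.
move=> [l ->]; exists [seq (c * a.1, a.2) | a <- l].
apply/funext => x; rewrite /trig big_map mulr_sumr.
by apply: eq_bigr => a _; rewrite mulrA.
Qed.

Lemma is_trig_sum I (s : seq I) (f : I -> R -> R) : (forall i, is_trig (f i)) ->
  is_trig (fun x => \sum_(i <- s) f i x).
Proof.
move=> tf; elim: s => [|i s IH].
  by under eq_fun do rewrite big_nil; exact: is_trig_cst.
by under eq_fun do rewrite big_cons; exact: is_trigD.
Qed.

Lemma is_trigM f g : is_trig f -> is_trig g -> is_trig (fun x => f x * g x).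
Proof.
move=> [l ->] [m ->].
have -> : (fun x => trig l x * trig m x) = (fun x => \sum_(a <- l) \sum_(b <- m)
    ((a.1 * b.1 / 2) * (cos ((a.2 + b.2) * x) + cos ((a.2 - b.2) * x)))).
  apply/funext => x; rewrite /trig mulr_suml; apply: eq_bigr => a _.
  rewrite mulr_sumr; apply: eq_bigr => b _.
  by rewrite mulrDl mulrBl cosD cosB; field.
apply: is_trig_sum => a; apply: is_trig_sum => b.
by apply: is_trigZ; apply: is_trigD; exact: is_trig_cos.
Qed.

Lemma is_trig_bern n g f : is_trig f -> is_trig (fun x => bern n g (f x)).
Proof.
move=> tf; elim: n g => [|n IH] g /=; first exact: is_trig_cst.
apply: is_trigD; last exact: is_trigM.
apply: is_trigM => //.
have -> : (fun x => 1 - f x) = (fun x => 1 + -1 * f x) by apply/funext => x; rewrite mulN1r.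
by apply: is_trigD; [exact: is_trig_cst|exact: is_trigZ].
Qed.

Lemma sin_bounds (t : R) : 0 <= t -> `|sin t| <= t /\ t - `|sin t| <= t ^+ 2.
Proof.
rewrite le_eqVlt => /predU1P[<-|t0]; first by rewrite sin0 normr0 expr0n subrr lexx.
have csin (a b : R) : {within `[a, b], continuous (fun y : R => sin y)}.
  by apply: continuous_subspaceT; exact: continuous_sin.
have ccos (a b : R) : {within `[a, b], continuous (fun y : R => cos y)}.
  by apply: continuous_subspaceT; exact: continuous_cos.
have [c] := @MVT R _ _ 0 t t0 (fun x _ => is_derive_sin x) (csin 0 t).
rewrite in_itv/= sin0 !subr0 => /andP[c0 ct] sE.
have [e] := @MVT R _ _ 0 c c0 (fun x _ => is_derive_cos x) (ccos 0 c).
rewrite in_itv/= cos0 !subr0 => /andP[e0 ec] cE.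
have cosb : `|cos c| <= 1 by rewrite ler_norml cos_geN1 cos_le1.
have se := sin_le1 e.
split; first by rewrite sE normrM (gtr0_norm t0) ler_piMl// ltW.
apply: (@le_trans _ _ (t - sin t)); first by rewrite lerD2l lerN2 ler_norm.
have c1 : 1 - cos c <= t by nra.
rewrite sE; nra.
Qed.

Lemma trig_approx_powR (p k : R) : 0 < p -> 0 < k ->
  exists l, forall x, `| `|x| `^ p - trig l x| <= k * (1 + `|x| `^ (p + 1)).
Proof.
move=> p0 k0; pose M := (k / 2)^-1.
have k2 : 0 < k / 2 by lra.
have M0 : 0 < M by rewrite invr_gt0.
have [e e0 He] := powR_ucont p0 (ltW M0) k2.
pose t := e / (2 * M ^+ 2).
have t0 : 0 < t by rewrite divr_gt0// mulr_gt0// exprn_gt0.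
have tMe : t * M ^+ 2 < e.
  rewrite (_ : t * M ^+ 2 = e / 2); last by rewrite /t; field; rewrite gt_eqF.
  lra.
clearbody t.
have p20 : 0 < p / 2 by lra.
have kt0 : 0 < k / 2 * t `^ p by rewrite mulr_gt0// powR_gt0.
have [n [g Hg]] := bern_powR p20 kt0.
pose y (x : R) := (1 + -1 * cos (2 * t * x)) / 2.
have yE x : y x = `|sin (t * `|x|)| ^+ 2.
  rewrite /y real_normK ?num_real// (_ : cos (2 * t * x) = cos ((t * `|x|) *+ 2)); last first.
    have [x0|x0] := leP 0 x; first by rewrite ger0_norm//; congr cos; ring.
    by rewrite ltr0_norm// -cosN; congr cos; ring.
  by rewrite cos_mulr2n sin2cos2; field.
have ty : is_trig (fun x => (t `^ p)^-1 * bern n g (y x)).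
  apply: is_trigZ; apply: is_trig_bern.
  have -> : y = (fun x => 2^-1 * (1 + -1 * cos (2 * t * x))).
    by apply/funext => x; rewrite /y mulrC.
  by apply: is_trigZ; apply: is_trigD; [exact: is_trig_cst|apply: is_trigZ; exact: is_trig_cos].
have [l lE] := ty; exists l => x; rewrite -lE.
have tp0 : 0 < t `^ p by rewrite powR_gt0.
have y01 : 0 <= y x <= 1.
  rewrite /y; have := cos_geN1 (2 * t * x); have := cos_le1 (2 * t * x); lra.
pose s := `|sin (t * `|x|)| / t.
have s0 : 0 <= s by rewrite divr_ge0// ltW.
have [sin1 sin2] : `|sin (t * `|x|)| <= t * `|x| /\ t * `|x| - `|sin (t * `|x|)| <= (t * `|x|) ^+ 2.
  by apply: sin_bounds; rewrite mulr_ge0// ltW.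
have sx : s <= `|x| by rewrite /s ler_pdivrMr// [leRHS]mulrC.
have yp : y x `^ (p / 2) = t `^ p * s `^ p.
  rewrite -(powRM _ (ltW t0) s0) yE -powR_mulrn// -powRrM; congr (_ `^ _); last by field.
  by rewrite /s mulrCA mulfV ?gt_eqF// mulr1.
have A1 : `|s `^ p - (t `^ p)^-1 * bern n g (y x)| <= k / 2.
  rewrite -(ler_pM2l tp0) -{1}(gtr0_norm tp0) -normrM mulrBr mulrA divff ?gt_eqF// mul1r.
  by rewrite -yp [leRHS]mulrC; exact: Hg.
have A2 : `| `|x| `^ p - s `^ p| <= k / 2 * (1 + `|x| `^ (p + 1)).
  have xp0 : 0 <= `|x| `^ (p + 1) by exact: powR_ge0.
  have [xM|Mx] := leP `|x| M.
    apply: (@le_trans _ _ (k / 2)); last by apply: ler_peMr; [exact: ltW|rewrite lerDl].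
    apply: He; rewrite ?normr_ge0 ?s0 ?xM ?(le_trans sx)//.
    rewrite ger0_norm ?subr_ge0//; apply: le_lt_trans tMe.
    rewrite -(ler_pM2l t0) /s mulrBr mulrCA mulfV ?gt_eqF// mulr1.
    apply: (le_trans sin2); rewrite exprMn expr2 -!mulrA ler_pM2l// ler_pM2l//.
    by apply: lerXn2r => //; rewrite nnegrE ?ltW.
  have x0 : 0 < `|x| by exact: lt_trans Mx.
  have sp : s `^ p <= `|x| `^ p by apply: ge0_ler_powR => //; rewrite ?nnegrE ?ltW.
  rewrite ger0_norm ?subr_ge0//.
  have xpp : `|x| `^ (p + 1) = `|x| `^ p * `|x|.
    by rewrite powRD ?powRr1//; apply/implyP => _; rewrite (gt_eqF x0).
  have : `|x| `^ p * M <= `|x| `^ p * `|x| by rewrite ler_wpM2l ?powR_ge0// ltW.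
  have s'0 : 0 <= s `^ p by exact: powR_ge0.
  rewrite -xpp /M -(ler_pM2l k2) mulrCA mulfV ?gt_eqF// mulr1; lra.
have : 0 <= k / 2 * `|x| `^ (p + 1) by rewrite mulr_ge0 ?powR_ge0// ltW.
move: A1 A2; rewrite !ler_norml; lra.
Qed.

End trig.

Section square_integrable.
Context d (T : measurableType d) (R : realType) (mu : {measure set T -> \bar R}).

Definition sqint (X : T -> R) :=
  measurable_fun setT X /\ (\int[mu]_x (X x ^+ 2)%:E < +oo)%E.

Definition inner (X Y : T -> R) : R := \int[mu]_x (X x * Y x).

Lemma sqint_sqr (X : T -> R) : sqint X -> mu.-integrable setT (fun x => (X x ^+ 2)%:E).
Proof.
move=> [mX X2]; apply/integrableP; split.
  by apply/measurable_EFinP; exact: measurable_funX.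
by under eq_integral do rewrite gee0_abs ?lee_fin ?sqr_ge0//.
Qed.

Lemma sqint_mul (X Y : T -> R) : sqint X -> sqint Y ->
  mu.-integrable setT (EFin \o (fun x => X x * Y x)).
Proof.
move=> sX sY; have [mX _] := sX; have [mY _] := sY.
apply: (@le_integrable _ _ _ mu setT measurableT _ (fun x => ((X x ^+ 2)%:E + (Y x ^+ 2)%:E)%E)).
- by apply/measurable_EFinP; exact: measurable_funM.
- move=> x _; rewrite -EFinD/= lee_fin [leRHS]ger0_norm ?addr_ge0 ?sqr_ge0// ler_norml.
  nra.
- by apply: integrableD => //; exact: sqint_sqr.
Qed.

Lemma innerxx (X : T -> R) : sqint X -> (\int[mu]_x (X x ^+ 2)%:E = (inner X X)%:E)%E.
Proof.
by move=> sX; rewrite /inner /Rintegral fineK//; apply: integrable_fin_num => //; exact: sqint_sqr.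
Qed.

Lemma innerC (X Y : T -> R) : inner X Y = inner Y X.
Proof. by rewrite /inner; under eq_Rintegral do rewrite mulrC. Qed.

Lemma inner_ge0 (X : T -> R) : 0 <= inner X X.
Proof. by apply: Rintegral_ge0 => x _; rewrite -expr2 sqr_ge0. Qed.

Lemma sqintZ a (X : T -> R) : sqint X -> sqint (fun x => a * X x).
Proof.
move=> sX; have [mX _] := sX; split; first exact: measurable_funM.
under eq_integral do rewrite exprMn EFinM.
rewrite integralZl//; last exact: sqint_sqr.
by rewrite innerxx// -EFinM ltry.
Qed.

Lemma le_sqint (X Y : T -> R) : measurable_fun setT X -> (forall x, `|X x| <= `|Y x|) ->
  sqint Y -> sqint X.
Proof.
move=> mX XY [mY Y2]; split => //; apply: le_lt_trans Y2; apply: ge0_le_integral => //.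
- by move=> x _; rewrite lee_fin sqr_ge0.
- by apply/measurable_EFinP; exact: measurable_funX.
- by apply/measurable_EFinP; exact: measurable_funX.
- move=> x _; rewrite lee_fin -[leLHS]real_normK ?num_real// -[leRHS]real_normK ?num_real//.
  by apply: lerXn2r; rewrite ?nnegrE.
Qed.

Lemma ge0_le_sqrD (X Y : T -> R) : measurable_fun setT X -> measurable_fun setT Y ->
  (\int[mu]_x ((X x + Y x) ^+ 2)%:E <=
   2%:E * \int[mu]_x (X x ^+ 2)%:E + 2%:E * \int[mu]_x (Y x ^+ 2)%:E)%E.
Proof.
move=> mX mY.
have m2 (Z : T -> R) : measurable_fun setT Z -> measurable_fun setT (fun x => (Z x ^+ 2)%:E).
  by move=> mZ; apply/measurable_EFinP; exact: measurable_funX.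
have p2 (Z : T -> R) x : setT x -> (0 <= (Z x ^+ 2)%:E)%E by rewrite lee_fin sqr_ge0.
have Z2 (Z : T -> R) : measurable_fun setT Z ->
    (2%:E * \int[mu]_x (Z x ^+ 2)%:E = \int[mu]_x (2%:E * (Z x ^+ 2)%:E))%E.
  by move=> mZ; rewrite ge0_integralZl//; [exact: m2|exact: p2].
rewrite !Z2// -ge0_integralD//; last 4 first.
- by move=> x _; rewrite mule_ge0// lee_fin sqr_ge0.
- exact/measurable_funeM/m2.
- by move=> x _; rewrite mule_ge0// lee_fin sqr_ge0.
- exact/measurable_funeM/m2.
apply: ge0_le_integral => //.
- by move=> x _; rewrite lee_fin sqr_ge0.
- by apply/m2; exact: measurable_funD.
- by apply: emeasurable_funD; exact/measurable_funeM/m2.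
- by move=> x _; rewrite -!EFinM -EFinD lee_fin; have := sqr_ge0 (X x - Y x); rewrite !expr2; nra.
Qed.

Lemma sqintD (X Y : T -> R) : sqint X -> sqint Y -> sqint (fun x => X x + Y x).
Proof.
move=> sX sY; have [mX _] := sX; have [mY _] := sY; split.
  exact: measurable_funD.
apply: (le_lt_trans (ge0_le_sqrD mX mY)).
by rewrite !innerxx// -!EFinM -EFinD ltry.
Qed.

Lemma sqint0 : sqint (fun=> 0).
Proof.
split; first exact: measurable_cst.
by under eq_integral do rewrite expr0n/=; rewrite integral0 ltry.
Qed.

Lemma sqint_sum I (s : seq I) (a : I -> R) (X : I -> T -> R) :
  (forall i, sqint (X i)) -> sqint (fun x => \sum_(i <- s) a i * X i x).
Proof.
move=> sX; elim: s => [|i s IH].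
  by under eq_fun do rewrite big_nil; exact: sqint0.
under eq_fun do rewrite big_cons; apply: sqintD => //.
exact: sqintZ.
Qed.

Lemma innerDl (X Y Z : T -> R) : sqint X -> sqint Y -> sqint Z ->
  inner (fun x => X x + Y x) Z = inner X Z + inner Y Z.
Proof.
move=> sX sY sZ; rewrite /inner -RintegralD//; last 2 first.
- exact: sqint_mul.
- exact: sqint_mul.
by apply: eq_Rintegral => x _; rewrite mulrDl.
Qed.

Lemma innerZl a (X Z : T -> R) : sqint X -> sqint Z ->
  inner (fun x => a * X x) Z = a * inner X Z.
Proof.
move=> sX sZ; rewrite /inner -RintegralZl//; last exact: sqint_mul.
by apply: eq_Rintegral => x _; rewrite mulrA.
Qed.

Lemma inner_suml I (s : seq I) (a : I -> R) (X : I -> T -> R) (Z : T -> R) :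
  (forall i, sqint (X i)) -> sqint Z ->
  inner (fun x => \sum_(i <- s) a i * X i x) Z = \sum_(i <- s) a i * inner (X i) Z.
Proof.
move=> sX sZ; elim: s => [|i s IH].
  rewrite big_nil /inner; under eq_Rintegral do rewrite big_nil mul0r.
  by rewrite /Rintegral integral0.
rewrite big_cons -IH -innerZl// -innerDl//; last 2 first.
- exact: sqintZ.
- exact: sqint_sum.
by rewrite /inner; apply: eq_Rintegral => x _; rewrite big_cons.
Qed.

Lemma inner_sum I (s : seq I) (a : I -> R) (X : I -> T -> R) :
  (forall i, sqint (X i)) ->
  inner (fun x => \sum_(i <- s) a i * X i x) (fun x => \sum_(i <- s) a i * X i x) =
  \sum_(i <- s) \sum_(j <- s) a i * a j * inner (X i) (X j).
Proof.
move=> sX; rewrite inner_suml//; last exact: sqint_sum.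
apply: eq_bigr => i _; rewrite innerC inner_suml// mulr_sumr.
by apply: eq_bigr => j _; rewrite innerC mulrA.
Qed.

(* |X|^2 and |Y|^2 are close when X - Y is small *)
Lemma inner_dist (X Y : T -> R) k : sqint X -> sqint Y -> 0 < k ->
  `|inner Y Y - inner X X| <= k * inner X X +
    (1 + k^-1) * inner (fun x => X x - Y x) (fun x => X x - Y x).
Proof.
move=> sX sY k0.
have sD : sqint (fun x => X x - Y x).
  have := sqintD sX (sqintZ (-1) sY); congr sqint.
  by apply/funext => x; rewrite mulN1r.
have iX := sqint_mul sX sX; have iY := sqint_mul sY sY; have iD := sqint_mul sD sD.
rewrite /inner -RintegralB// -[X in _ <= X + _]RintegralZl// -[X in _ <= _ + X]RintegralZl//.
rewrite -RintegralD//; last 2 first.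
- exact: (integrableZl _ _ iX).
- exact: (integrableZl _ _ iD).
apply: (le_trans (le_normr_Rintegral _ _)) => //.
  exact: (integrableB measurableT iY iX).
apply: le_Rintegral => //.
- apply: (@integrable_abse _ _ _ mu setT (fun x => (Y x * Y x)%:E - (X x * X x)%:E)%E).
  exact: integrableB.
- apply: (@integrableD _ _ _ mu setT measurableT (fun x => (k * (X x * X x))%:E)
    (fun x => ((1 + k^-1) * ((X x - Y x) * (X x - Y x)))%:E)).
    exact: (integrableZl _ _ iX).
  exact: (integrableZl _ _ iD).
move=> x _; set a := X x; set b := Y x.
have -> : b * b - a * a = (a - b) ^+ 2 - 2 * a * (a - b) by ring.
have H : forall s : R, s ^+ 2 = 1 -> s * (2 * a * (a - b)) <= k * (a * a) + k^-1 * ((a - b) * (a - b)).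
  move=> s s2; have := sqr_ge0 (k * a - s * (a - b)).
  have -> : (k * a - s * (a - b)) ^+ 2 = k * (k * (a * a) + k^-1 * ((a - b) * (a - b)) - s * (2 * a * (a - b))).
    rewrite sqrrB [(s * (a - b)) ^+ 2]exprMn s2; field; rewrite gt_eqF//.
  by rewrite pmulr_rge0// subr_ge0.
have H1 := H 1 (expr1n _ _); have HN : (-1) ^+ 2 = 1 :> R by rewrite sqrrN expr1n.
have H2 := H (-1) HN; rewrite ler_norml; have := sqr_ge0 (a - b).
rewrite expr2; lra.
Qed.

End square_integrable.

Section elementary.
Import HBSimple.
Context d (T : measurableType d) (R : realType) (P : probability T R).
Variable W : set (plane R) -> T -> R.
Hypothesis hW : white_noise P W.
Local Notation lam := (@lambda2 R).

Lemma measurable_big_square : measurable (@big_square R).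
Proof. by apply: measurableX; exact: measurable_itv. Qed.

Lemma lambda2_big_square : (lam big_square < +oo)%E.
Proof.
rewrite /lambda2 /big_square [X in (X < _)%E]product_measure1E//=.
by rewrite !lebesgue_measure_itv/= lte_fin; case: ifPn => _; rewrite -?EFinB -?EFinM ?mule0 ltry.
Qed.

Definition elem_ok (l : seq (R * set (plane R))) := forall i,
  measurable (nth (0, set0) l i).2 /\ (nth (0, set0) l i).2 `<=` big_square.

Definition elem_int (l : seq (R * set (plane R))) (w : T) : R :=
  \sum_(a <- l) a.1 * W a.2 w.

Definition elem_fun (l : seq (R * set (plane R))) (u : plane R) : R :=
  \sum_(a <- l) a.1 * \1_(a.2) u.

Lemma elem_ok_cat l m : elem_ok l -> elem_ok m -> elem_ok (l ++ m).
Proof. by move=> ol om i; rewrite nth_cat; case: ifPn. Qed.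

Definition elem_scale (c : R) (l : seq (R * set (plane R))) := [seq (c * a.1, a.2) | a <- l].

Lemma elem_ok_scale c l : elem_ok l -> elem_ok (elem_scale c l).
Proof.
move=> ol i; have [il|il] := ltnP i (size l).
  by rewrite (nth_map (0, set0))//=; exact: ol.
by rewrite nth_default ?size_map//=; split => //; exact: sub0set.
Qed.

Lemma elem_int_cat l m w : elem_int (l ++ m) w = elem_int l w + elem_int m w.
Proof. by rewrite /elem_int big_cat. Qed.

Lemma elem_fun_cat l m u : elem_fun (l ++ m) u = elem_fun l u + elem_fun m u.
Proof. by rewrite /elem_fun big_cat. Qed.

Lemma elem_int_scale c l w : elem_int (elem_scale c l) w = c * elem_int l w.
Proof.
by rewrite /elem_int big_map mulr_sumr; apply: eq_bigr => a _; rewrite mulrA.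
Qed.

Lemma elem_fun_scale c l u : elem_fun (elem_scale c l) u = c * elem_fun l u.
Proof.
by rewrite /elem_fun big_map mulr_sumr; apply: eq_bigr => a _; rewrite mulrA.
Qed.

Lemma noise_sqint A : measurable A -> A `<=` big_square -> sqint P (W A).
Proof.
move=> mA Ab; have [gW _ cW] := hW; split.
  have [//|] := gW 1%N (fun=> 1) (fun=> A).
  by under eq_fun do rewrite big_ord1 mul1r.
have := cW A A mA Ab mA Ab; rewrite unlock setIid => /= WA.
under eq_integral do rewrite expr2.
rewrite WA; apply: le_lt_trans lambda2_big_square.
by apply: le_measure; rewrite ?inE//; exact: measurable_big_square.
Qed.

Lemma inner_noise A B : measurable A -> A `<=` big_square ->
  measurable B -> B `<=` big_square ->
  inner P (W A) (W B) = fine (lam (A `&` B)).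
Proof.
move=> mA Ab mB Bb; have [_ _ cW] := hW.
by have := cW A B mA Ab mB Bb; rewrite unlock /inner /Rintegral /= => ->.
Qed.

Lemma indic_sqint A : measurable A -> A `<=` big_square -> sqint lam \1_A.
Proof.
move=> mA Ab; split; first exact: measurable_indic.
rewrite (eq_integral (fun x => (\1_A x)%:E)); last first.
  by move=> x _; rewrite indicE; case: (_ \in _); rewrite ?expr1n// expr0n.
rewrite integral_indic// setIT; apply: le_lt_trans lambda2_big_square.
by apply: le_measure; rewrite ?inE//; exact: measurable_big_square.
Qed.

Lemma inner_indic A B : measurable A -> measurable B ->
  inner lam \1_A \1_B = fine (lam (A `&` B)).
Proof.
move=> mA mB; rewrite /inner /Rintegral -[A `&` B]setIT -integral_indic//; last exact: measurableI.
by congr fine; apply: eq_integral => x _; rewrite indicI.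
Qed.

Lemma elem_intE l : elem_int l = (fun w => \sum_(i < size l)
  (nth (0, set0) l i).1 * W (nth (0, set0) l i).2 w).
Proof. by apply/funext => w; rewrite /elem_int (big_nth (0, set0)) big_mkord. Qed.

Lemma elem_funE l : elem_fun l = (fun u => \sum_(i < size l)
  (nth (0, set0) l i).1 * \1_((nth (0, set0) l i).2) u).
Proof. by apply/funext => w; rewrite /elem_fun (big_nth (0, set0)) big_mkord. Qed.

Lemma elem_int_sqint l : elem_ok l -> sqint P (elem_int l).
Proof.
move=> ol; rewrite elem_intE.
apply: (@sqint_sum _ _ _ P 'I_(size l) _ (fun i => (nth (0, set0) l i).1) (fun i => W (nth (0, set0) l i).2)) => i.
by have [? ?] := ol i; exact: noise_sqint.
Qed.

Lemma elem_fun_sqint l : elem_ok l -> sqint lam (elem_fun l).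
Proof.
move=> ol; rewrite elem_funE.
apply: (@sqint_sum _ _ _ lam 'I_(size l) _ (fun i => (nth (0, set0) l i).1) (fun i => \1_((nth (0, set0) l i).2))) => i.
by have [? ?] := ol i; exact: indic_sqint.
Qed.

Lemma elem_isometry l : elem_ok l ->
  inner P (elem_int l) (elem_int l) = inner lam (elem_fun l) (elem_fun l).
Proof.
move=> ol; rewrite elem_intE elem_funE.
rewrite (@inner_sum _ _ _ P 'I_(size l) _ (fun i => (nth (0, set0) l i).1) (fun i => W (nth (0, set0) l i).2)); last first.
  by move=> i; have [? ?] := ol i; exact: noise_sqint.
rewrite (@inner_sum _ _ _ lam 'I_(size l) _ (fun i => (nth (0, set0) l i).1) (fun i => \1_((nth (0, set0) l i).2))); last first.
  by move=> i; have [? ?] := ol i; exact: indic_sqint.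
apply: eq_bigr => i _; apply: eq_bigr => j _; congr (_ * _).
by have [? ?] := ol i; have [? ?] := ol j; rewrite inner_noise// inner_indic.
Qed.

Lemma elem_gaussian l : elem_ok l ->
  centered_gaussian P (elem_int l) (inner lam (elem_fun l) (elem_fun l)).
Proof.
move=> ol; have [gW eW _] := hW; apply: gaussian_centered.
- by rewrite elem_intE; apply: gW => j; exact: ol.
- rewrite elem_intE; under eq_integral do rewrite -sumEFin.
  rewrite integral_sum//; last first.
    move=> i; under eq_fun do rewrite EFinM; apply: integrableZl => //.
    by have [? ?] := ol i; have [? ?] := noise_sqint (proj1 (ol i)) (proj2 (ol i)); exact: integrable_sqr.
  rewrite big1// => i _; under eq_integral do rewrite EFinM.
  have [mA Ab] := ol i; have [? ?] := noise_sqint mA Ab.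
  rewrite integralZl//; last exact: integrable_sqr.
  by have := eW _ mA Ab; rewrite unlock => ->; rewrite mule0.
- by rewrite innerxx ?elem_isometry//; exact: elem_int_sqint.
Qed.

Definition noise_limit (f : plane R -> R) (X : T -> R) :=
  [/\ measurable_fun setT f, measurable_fun setT X &
  exists l : nat -> seq (R * set (plane R)),
  [/\ forall n, elem_ok (l n),
    (\int[lam]_u ((f u - elem_fun (l n) u) ^+ 2)%:E)%E @[n --> \oo] --> 0%E &
    (\int[P]_w ((X w - elem_int (l n) w) ^+ 2)%:E)%E @[n --> \oo] --> 0%E]].

Lemma wiener_noise_limit (f : plane R -> R) X : measurable_fun setT f ->
  (forall u, ~ big_square u -> f u = 0) ->
  wiener_integral P W f X -> noise_limit f X.
Proof.
move=> mf f0 [mX [phi [cf cX]]]; split => //.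
pose l n : seq (R * set (plane R)) :=
  [seq (x, big_square `&` phi n @^-1` [set x]) | x <- finmap.enum_fset (fset_set (range (phi n)))].
have ol n : elem_ok (l n).
  move=> i; have [il|il] := ltnP i (size (finmap.enum_fset (fset_set (range (phi n))))).
    rewrite (nth_map 0)//=; split; last exact: subIsetl.
    by apply: measurableI; [exact: measurable_big_square|exact: measurable_funPTI].
  by rewrite nth_default ?size_map//=; split => //; exact: sub0set.
exists l; split => //.
  rewrite [X in X @ _](_ : _ = (fun n : nat =>
    (\int[lam]_(z in big_square) ((f z - phi n z) ^+ 2)%:E)%E))//.
  apply/funext => n; rewrite [RHS]integral_mkcond; apply: eq_integral => u _; rewrite patchE.
  have -> : elem_fun (l n) u = if u \in big_square then phi n u else 0.
    rewrite /elem_fun big_map/=; case: ifPn => ub.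
      rewrite [RHS]fimfunE fsbig_finite//; apply: eq_bigr => x _.
      by rewrite indicI /= [\1_big_square u]indicE ub mul1r.
    rewrite big1// => x _; rewrite indicE in_setI (negbTE ub)/= mulr0//.
  case: ifPn => // /negP ub; rewrite f0 ?subr0 ?expr0n//.
  by move=> bu; apply: ub; rewrite inE.
rewrite [X in X @ _](_ : _ = (fun n : nat =>
    'E_P[(fun w : T => ((X w - simple_wiener W (phi n) w) ^+ 2)%R)]%E))//.
apply/funext => n; rewrite unlock.
apply: eq_integral => w _; rewrite /= /simple_wiener fsbig_finite//.
by rewrite /elem_int big_map.
Qed.

Lemma noise_limitD f g X Y a b : noise_limit f X -> noise_limit g Y ->
  noise_limit (fun u => a * f u + b * g u) (fun w => a * X w + b * Y w).
Proof.
move=> [mf mX [l [ol fl Xl]]] [mg mY [m [om gm Ym]]].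
have mE k : measurable_fun setT (elem_fun (l k)) by have [] := elem_fun_sqint (ol k).
have mE' k : measurable_fun setT (elem_fun (m k)) by have [] := elem_fun_sqint (om k).
have mI k : measurable_fun setT (elem_int (l k)) by have [] := elem_int_sqint (ol k).
have mI' k : measurable_fun setT (elem_int (m k)) by have [] := elem_int_sqint (om k).
split.
- by apply: measurable_funD; exact: measurable_funM.
- by apply: measurable_funD; exact: measurable_funM.
exists (fun n => elem_scale a (l n) ++ elem_scale b (m n)).
have key dd (S : measurableType dd) (mu : {measure set S -> \bar R}) (F G : S -> R) (FF GG : nat -> S -> R) :
    measurable_fun setT F -> measurable_fun setT G ->
    (forall n, measurable_fun setT (FF n)) -> (forall n, measurable_fun setT (GG n)) ->
    (\int[mu]_w ((F w - FF n w) ^+ 2)%:E)%E @[n --> \oo] --> 0%E ->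
    (\int[mu]_w ((G w - GG n w) ^+ 2)%:E)%E @[n --> \oo] --> 0%E ->
    (\int[mu]_w ((a * F w + b * G w - (a * FF n w + b * GG n w)) ^+ 2)%:E)%E @[n --> \oo] --> 0%E.
  move=> mF mG mFF mGG cF cG.
  have mm n : measurable_fun setT (fun w => F w - FF n w) by exact: measurable_funB.
  have mm' n : measurable_fun setT (fun w => G w - GG n w) by exact: measurable_funB.
  apply: (@squeeze_cvge _ _ _ _ (fun=> 0%E) _ (fun n =>
    2%:E * ((a ^+ 2)%:E * \int[mu]_w ((F w - FF n w) ^+ 2)%:E) +
    2%:E * ((b ^+ 2)%:E * \int[mu]_w ((G w - GG n w) ^+ 2)%:E))%E).
  - apply: nearW => n; rewrite integral_ge0/=; last by move=> w _; rewrite lee_fin sqr_ge0.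
    have Z c (H : S -> R) : measurable_fun setT H -> ((c ^+ 2)%:E * \int[mu]_w ((H w) ^+ 2)%:E =
        \int[mu]_w ((c * H w) ^+ 2)%:E)%E.
      move=> mH; rewrite -ge0_integralZl//.
      - by apply: eq_integral => w _; rewrite -EFinM exprMn.
      - by apply/measurable_EFinP; exact: measurable_funX.
      - by move=> w _; rewrite lee_fin sqr_ge0.
      - by rewrite lee_fin sqr_ge0.
    rewrite !Z//; apply: le_trans (ge0_le_sqrD _ _ _); last 2 first.
    - exact: measurable_funM.
    - exact: measurable_funM.
    rewrite le_eqVlt; apply/orP; left; apply/eqP; apply: eq_integral => w _.
    by congr ((_ ^+ 2)%:E); ring.
  - exact: cvg_cst.
  - rewrite [X in _ --> X](_ : _ = 2%:E * ((a ^+ 2)%:E * 0) + 2%:E * ((b ^+ 2)%:E * 0))%E; last first.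
      by rewrite !mule0 adde0.
    apply: cvgeD; first by rewrite !mule0.
      by apply: cvgeZl => //; apply: cvgeZl => //; exact: cF.
    by apply: cvgeZl => //; apply: cvgeZl => //; exact: cG.
split.
- by move=> n; apply: elem_ok_cat; exact: elem_ok_scale.
- under eq_fun do under eq_integral do rewrite elem_fun_cat !elem_fun_scale.
  exact: key.
- under eq_fun do under eq_integral do rewrite elem_int_cat !elem_int_scale.
  exact: key.
Qed.

End elementary.

Section noise_limit_law.
Context d (T : measurableType d) (R : realType) (P : probability T R).
Variable W : set (plane R) -> T -> R.
Hypothesis hW : white_noise P W.
Local Notation lam := (@lambda2 R).

Lemma continuous_abs_powR (q : R) : 0 < q -> continuous (fun x : R => `|x| `^ q).
Proof.
move=> q0 x; apply/cvgrPdist_le => k k0.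
have x1 : 0 <= `|x| + 1 by rewrite addr_ge0.
have [e e0 He] := powR_ucont q0 x1 k0.
near=> t.
have xt : `|x - t| < Num.min 1 e.
  by near: t; apply: cvgr_dist_lt; rewrite // lt_min ltr01 e0.
have := ler_normB x (x - t); rewrite subKr => tx.
move: xt; rewrite lt_min => /andP[xt1 xte].
apply: He; rewrite ?normr_ge0/=; first by rewrite lerDl.
  by apply: (le_trans tx); rewrite lerD2l ltW.
by apply: le_lt_trans xte; exact: ler_dist_dist.
Unshelve. all: by end_near. Qed.

Lemma expRN_lip (a b : R) : 0 <= a -> 0 <= b -> `|expR (- a) - expR (- b)| <= `|a - b|.
Proof.
wlog ab : a b / a <= b.
  move=> H a0 b0; have [/H|/ltW /H H'] := leP a b; first exact.
  by rewrite distrC (distrC a); exact: H'.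
move=> a0 b0.
have e1 : expR (- b) = expR (- a) * expR (- (b - a)) by rewrite -expRD; congr expR; ring.
have e2 := expR_ge1Dx (- (b - a)).
have e3 : expR (- a) <= 1 by rewrite -expR0 ler_expR; lra.
have e4 := expR_ge0 (- a).
have e5 : expR (- (b - a)) <= 1 by rewrite -expR0 ler_expR; lra.
rewrite distrC (distrC a) ler0_norm; last by rewrite e1; nra.
by rewrite ger0_norm ?subr_ge0// e1; nra.
Qed.

Lemma cos_lip (a b : R) : `|cos a - cos b| <= `|a - b|.
Proof.
wlog ab : a b / a < b.
  move=> H; have [/H//|/H|->] := ltgtP a b; last by rewrite !subrr normr0.
  by rewrite distrC (distrC b).
have ccos : {within `[a, b], continuous (fun y : R => cos y)}.
  by apply: continuous_subspaceT; exact: continuous_cos.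
have [c _ E] := @MVT R _ _ a b ab (fun x _ => is_derive_cos x) ccos.
rewrite distrC E (distrC a) normrM ler_piMl// normrN ler_norml.
by rewrite sin_geN1 sin_le1.
Qed.

Lemma noise_limit_approx f X k : noise_limit P W f X -> 0 < k ->
  exists l, [/\ elem_ok l, sqint lam (fun u => f u - elem_fun l u),
    sqint P (fun w => X w - elem_int W l w),
    inner lam (fun u => f u - elem_fun l u) (fun u => f u - elem_fun l u) <= k &
    inner P (fun w => X w - elem_int W l w) (fun w => X w - elem_int W l w) <= k].
Proof.
move=> [mf mX [l [ol cl cX]]] k0.
have small dd (S : measurableType dd) (mu : {measure set S -> \bar R}) (F : nat -> S -> R) :
    (forall n, measurable_fun setT (F n)) ->
    (\int[mu]_x (F n x ^+ 2)%:E)%E @[n --> \oo] --> 0%E ->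
    \forall n \near \oo, sqint mu (F n) /\ inner mu (F n) (F n) <= k.
  move=> mF /fine_cvgP[cfin /cvgrPdist_le /(_ _ k0) c0]; near=> n.
  have fn : (\int[mu]_x (F n x ^+ 2)%:E)%E \is a fin_num by near: n.
  split; first by split => //; rewrite ltey_eq fn.
  have : `|0 - fine (\int[mu]_x (F n x ^+ 2)%:E)%E| <= k.
    by near: n.
  rewrite sub0r normrN => /(le_trans (ler_norm _)); apply: le_trans.
  by rewrite /inner /Rintegral; under eq_integral do rewrite -expr2.
have S1 : \forall n \near \oo, sqint lam (fun u => f u - elem_fun (l n) u) /\
    inner lam (fun u => f u - elem_fun (l n) u) (fun u => f u - elem_fun (l n) u) <= k.
  apply: small => // n; apply: measurable_funB => //.
  by have [] := elem_fun_sqint (ol n).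
have S2 : \forall n \near \oo, sqint P (fun w => X w - elem_int W (l n) w) /\
    inner P (fun w => X w - elem_int W (l n) w) (fun w => X w - elem_int W (l n) w) <= k.
  apply: small => // n; apply: measurable_funB => //.
  by have [] := elem_int_sqint hW (ol n).
near \oo => n; exists (l n).
have [? ?] : sqint lam (fun u => f u - elem_fun (l n) u) /\
    inner lam (fun u => f u - elem_fun (l n) u) (fun u => f u - elem_fun (l n) u) <= k.
  by near: n.
have [? ?] : sqint P (fun w => X w - elem_int W (l n) w) /\
    inner P (fun w => X w - elem_int W (l n) w) (fun w => X w - elem_int W (l n) w) <= k.
  by near: n.
by split.
Unshelve. all: by end_near. Qed.

Lemma noise_limit_sqint f X : noise_limit P W f X -> sqint lam f.
Proof.
move=> nf; have [l [ol sf _ _ _]] := noise_limit_approx nf ltr01.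
have := sqintD sf (elem_fun_sqint ol); congr sqint.
by apply/funext => u; rewrite subrK.
Qed.

Lemma noise_limit_norm f X k l : noise_limit P W f X -> 0 < k -> elem_ok l ->
  inner lam (fun u => f u - elem_fun l u) (fun u => f u - elem_fun l u) <= k ^+ 2 ->
  `|inner lam (elem_fun l) (elem_fun l) - inner lam f f| <= k * (inner lam f f + 1 + k).
Proof.
move=> nf k0 ol fl.
have := inner_dist (noise_limit_sqint nf) (elem_fun_sqint ol) k0.
move=> /le_trans; apply.
rewrite -addrA mulrDr lerD2l; apply: (@le_trans _ _ ((1 + k^-1) * k ^+ 2)).
  by rewrite ler_wpM2l// addr_ge0// invr_ge0 ltW.
by rewrite le_eqVlt; apply/orP; left; apply/eqP; field; rewrite gt_eqF.
Qed.

Lemma cos_int_dist (X Y : T -> R) k : measurable_fun setT X -> measurable_fun setT Y ->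
  0 < k -> sqint P (fun w => X w - Y w) ->
  inner P (fun w => X w - Y w) (fun w => X w - Y w) <= k ^+ 2 ->
  `|\int[P]_w cos (X w) - \int[P]_w cos (Y w)| <= k.
Proof.
move=> mX mY k0 sXY XYk.
have icos (Z : T -> R) : measurable_fun setT Z -> P.-integrable setT (EFin \o (fun w => cos (Z w))).
  move=> mZ; apply: measurable_bounded_integrable => //.
  - by rewrite (@le_lt_trans _ _ 1%E) ?ltry// probability_le1.
  - apply: (measurableT_comp (f := @cos R)) => //.
    by apply: continuous_measurable_fun; exact: continuous_cos.
  - exists 1; split; rewrite ?num_real// => y y1 w _ /=.
    by apply: le_trans (ltW y1); rewrite ler_norml cos_geN1 cos_le1.
have iX := icos _ mX; have iY := icos _ mY.
rewrite -RintegralB//; apply: (le_trans (le_normr_Rintegral _ _)) => //.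
  exact: (integrableB measurableT iX iY).
have i2 := sqint_mul sXY sXY.
have i0 := (@finite_measure_integrable_cst _ _ _ P setT k measurableT).
have i2' : P.-integrable setT (EFin \o (fun w => k^-1 * ((X w - Y w) * (X w - Y w)))).
  exact: (integrableZl measurableT k^-1 i2).
have i3 : P.-integrable setT (EFin \o (fun w => 2^-1 * (k^-1 * ((X w - Y w) * (X w - Y w)) + k))).
  exact: (integrableZl measurableT 2^-1 (integrableD measurableT i2' i0)).
apply: (@le_trans _ _ (\int[P]_w (2^-1 * (k^-1 * ((X w - Y w) * (X w - Y w)) + k)))).
  apply: le_Rintegral => //.
    exact: (integrable_abse (integrableB measurableT iX iY)).
  move=> w _; apply: (le_trans (cos_lip _ _)).
  rewrite -expr2 -[_ ^+ 2]real_normK ?num_real//; set t := `|_|.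
  have := sqr_ge0 (t - k).
  have -> : (t - k) ^+ 2 = 2 * k * (2^-1 * (k^-1 * t ^+ 2 + k) - t) by field; rewrite gt_eqF.
  by rewrite pmulr_rge0 ?mulr_gt0// subr_ge0.
rewrite RintegralZl//; last exact: (integrableD measurableT i2' i0).
rewrite RintegralD// RintegralZl// Rintegral_cst//= probability_setT/= mulr1.
have : k^-1 * inner P (fun w => X w - Y w) (fun w => X w - Y w) <= k.
  by rewrite ler_pdivrMl// -expr2.
rewrite /inner; lra.
Qed.

Lemma noise_limit_cos f X : noise_limit P W f X ->
  \int[P]_w cos (X w) = expR (- (inner lam f f / 2)).
Proof.
move=> nf; have [_ mX _] := nf; set v := inner lam f f.
have v0 : 0 <= v by exact: inner_ge0.
have key k : 0 < k -> k <= 1 -> `|\int[P]_w cos (X w) - expR (- (v / 2))| <= k * (v + 3).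
  move=> k0 k1; have k20 : 0 < k ^+ 2 by rewrite exprn_gt0.
  have [l [ol sf sX fk Xk]] := noise_limit_approx nf k20.
  have gl := elem_gaussian hW ol; have [mI u0 _] := gl.
  have H1 := cos_int_dist mX mI k0 sX Xk.
  have H2 := noise_limit_norm nf k0 ol fk.
  rewrite (centered_gaussian_cos gl) in H1.
  set u := inner lam (elem_fun l) (elem_fun l) in H1 H2 u0.
  have := @expRN_lip (u / 2) (v / 2); rewrite !divr_ge0// => /(_ isT isT).
  rewrite -mulrBl normrM (ger0_norm (_ : 0 <= 2^-1))// => H3.
  have kk : k * (v + 1 + k) <= k * (v + 2) by rewrite ler_pM2l//; lra.
  have := le_trans H2 kk; rewrite -/v => H4.
  have -> : \int[P]_w cos (X w) - expR (- (v / 2)) =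
    (\int[P]_w cos (X w) - expR (- (u / 2))) + (expR (- (u / 2)) - expR (- (v / 2))) by ring.
  apply: (le_trans (ler_normD _ _)); have := normr_ge0 (u - v); lra.
apply/eqP; rewrite -subr_eq0 -normr_le0; apply/ler_addgt0Pl => e e0; rewrite addr0.
pose k := Num.min 1 (e / (v + 3)).
have v3 : 0 < v + 3 by lra.
have k0 : 0 < k by rewrite lt_min ltr01/= divr_gt0.
have k1 : k <= 1 by rewrite ge_min lexx.
apply: (le_trans (key k k0 k1)); rewrite -ler_pdivlMr//.
by rewrite ge_min lexx orbT.
Qed.

Lemma noise_limit_moment f X q : noise_limit P W f X -> 0 < q ->
  (\int[P]_w (`|X w| `^ q)%:E <= ((inner lam f f + 1) `^ (q / 2) * normal_abs_moment q + 1)%:E)%E.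
Proof.
move=> nf q0; have [_ mX _] := nf; set v := inner lam f f.
have v0 : 0 <= v by exact: inner_ge0.
set K := (X in (_ <= X)%E).
pose G (n : nat) (x : R) : R := (Num.min `|x| n%:R) `^ q.
have G0 n x : 0 <= G n x by exact: powR_ge0.
have mG n (Z : T -> R) : measurable_fun setT Z -> measurable_fun setT (fun w => (G n (Z w))%:E).
  move=> mZ; apply/measurable_EFinP.
  have /measurableT_comp := measurable_powR q; apply.
  by apply: measurable_minr => //; apply: measurableT_comp.
have GK n : (\int[P]_w (G n (X w))%:E <= K)%E.
  have h0 : 0 < 2^-1 :> R by [].
  have [e e0 He] := powR_ucont q0 (ler0n R n) h0.
  pose C := n%:R `^ q / e ^+ 2.
  have C0 : 0 <= C by rewrite divr_ge0 ?powR_ge0// exprn_ge0// ltW.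
  pose k := Num.min 1 (Num.min (v + 2)^-1 (2 * (C + 1))^-1).
  have k0 : 0 < k by rewrite !lt_min ltr01/= !invr_gt0; apply/andP; split; lra.
  have k1 : k <= 1 by rewrite ge_min lexx.
  have kv : k * (v + 2) <= 1.
    by rewrite -ler_pdivlMr; [rewrite mul1r !ge_min lexx orbT|lra].
  have kC : C * k ^+ 2 <= 2^-1.
    have : k * (2 * (C + 1)) <= 1.
      by rewrite -ler_pdivlMr; [rewrite mul1r !ge_min lexx !orbT|lra].
    have : k ^+ 2 <= k by rewrite expr2 ler_piMl// ltW.
    have : 0 <= k ^+ 2 by rewrite sqr_ge0.
    nra.
  have k20 : 0 < k ^+ 2 by rewrite exprn_gt0.
  have [l [ol sf sX fk Xk]] := noise_limit_approx nf k20.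
  have gl := elem_gaussian hW ol; have [mI u0 lawI] := gl.
  have := noise_limit_norm nf k0 ol fk.
  set u := inner lam (elem_fun l) (elem_fun l) in u0 lawI *; rewrite -/v => uv.
  have uv1 : u <= v + 1.
    have : `|u - v| <= k * (v + 2) by apply: le_trans uv _; rewrite ler_pM2l//; lra.
    by rewrite ler_norml; lra.
  have EI : (\int[P]_w (`|elem_int W l w| `^ q)%:E = (u `^ (q / 2) * normal_abs_moment q)%:E)%E.
    have H := lawI (fun x => `|x| `^ q) (continuous_abs_powR q0) (fun x => powR_ge0 _ _).
    by rewrite [LHS]H normal_abs_moment_scale// ltW.
  have Gk (a b : R) : G n a <= `|b| `^ q + (C * (a - b) ^+ 2 + 2^-1).
    have minb (c : R) : 0 <= Num.min `|c| n%:R <= n%:R.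
      by rewrite le_min normr_ge0 ler0n/= ge_min lexx orbT.
    have Gb : G n b <= `|b| `^ q.
      have /andP[mb0 _] := minb b.
      by apply: ge0_ler_powR; rewrite ?nnegrE ?(ltW q0)// ge_min lexx.
    have [ab|ab] := ltP `|a - b| e.
      have mab : `|Num.min `|a| n%:R - Num.min `|b| n%:R| < e.
        apply: le_lt_trans ab; have := lerB_dist a b; have := lerB_dist b a.
        rewrite distrC; have [an|an] := leP `|a| n%:R; have [bn|bn] := leP `|b| n%:R;
          rewrite ler_norml ?subrr; lra.
      have := He _ _ (minb a) (minb b) mab; rewrite ler_norml -/(G n a) -/(G n b).
      have : 0 <= C * (a - b) ^+ 2 by rewrite mulr_ge0// sqr_ge0.
      lra.
    have Ga : G n a <= n%:R `^ q.
      have /andP[ma0 man] := minb a.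
      by apply: ge0_ler_powR; rewrite ?nnegrE ?(ltW q0).
    have : n%:R `^ q <= C * (a - b) ^+ 2.
      rewrite /C mulrAC ler_pdivlMr ?exprn_gt0// ler_wpM2l ?powR_ge0//.
      rewrite -[leRHS]real_normK ?num_real//.
      by apply: lerXn2r; rewrite ?nnegrE ?(ltW e0).
    have := powR_ge0 `|b| q; lra.
  apply: (@le_trans _ _ (\int[P]_w ((`|elem_int W l w| `^ q)%:E +
     (C%:E * ((X w - elem_int W l w) ^+ 2)%:E + (2^-1)%:E)))%E).
    apply: ge0_le_integral => //.
    - by move=> w _; rewrite lee_fin.
    - exact: mG.
    - apply: emeasurable_funD.
        by apply/measurable_EFinP; have /measurableT_comp := measurable_abs_powR q; apply.
      apply: emeasurable_funD => //; apply: measurable_funeM; apply/measurable_EFinP.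
      by apply: measurable_funX; exact: measurable_funB.
    - by move=> w _; rewrite -EFinM -!EFinD lee_fin.
  have m1 : measurable_fun setT (fun w => ((X w - elem_int W l w) ^+ 2)%:E).
    by apply/measurable_EFinP; apply: measurable_funX; exact: measurable_funB.
  have m2 : measurable_fun setT (fun w => (`|elem_int W l w| `^ q)%:E).
    by apply/measurable_EFinP; have /measurableT_comp := measurable_abs_powR q; apply.
  rewrite ge0_integralD//; last 2 first.
  - by move=> w _; rewrite adde_ge0// -EFinM lee_fin mulr_ge0// sqr_ge0.
  - by apply: emeasurable_funD => //; exact: measurable_funeM.
  rewrite ge0_integralD//; last 2 first.
  - by move=> w _; rewrite -EFinM lee_fin mulr_ge0// sqr_ge0.
  - exact: measurable_funeM.
  rewrite ge0_integralZl//; last by move=> w _; rewrite lee_fin sqr_ge0.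
  rewrite innerxx// integral_cst//= probability_setT mule1 EI -EFinM -!EFinD lee_fin.
  apply: lerD.
    rewrite ler_wpM2r//; first by apply: Rintegral_ge0 => y _; exact: powR_ge0.
    by apply: ge0_ler_powR; rewrite ?nnegrE//; lra.
  have : C * inner P (fun w => X w - elem_int W l w) (fun w => X w - elem_int W l w) <= C * k ^+ 2.
    by rewrite ler_wpM2l.
  lra.
have ndG w a b : (a <= b)%N -> ((G a (X w))%:E <= (G b (X w))%:E)%E.
  move=> ab; rewrite lee_fin; apply: ge0_ler_powR;
      rewrite ?nnegrE ?(ltW q0) ?le_min ?normr_ge0 ?ler0n//.
  by rewrite ge_min lexx/= ge_min ler_nat ab orbT.
have -> : (\int[P]_w (`|X w| `^ q)%:E = limn (fun n => \int[P]_w (G n (X w))%:E))%E.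
  rewrite -monotone_convergence//; last 3 first.
  - by move=> n; exact: mG.
  - by move=> n w _; rewrite lee_fin.
  - by move=> w _ a b; exact: ndG.
  apply: eq_integral => w _; apply/esym/cvg_lim => //.
  apply: cvg_near_cst; near=> n; congr EFin; rewrite /G min_l//.
  by near: n; exact: nbhs_infty_ger.
apply: lime_le; last exact: nearW.
apply: ereal_nondecreasing_is_cvgn => a b ab; apply: ge0_le_integral => //.
- by move=> w _; rewrite lee_fin.
- exact: mG.
- exact: mG.
- by move=> w _; exact: ndG.
Unshelve. all: by end_near. Qed.

End noise_limit_law.

Section bounded.
Context d (T : measurableType d) (R : realType) (P : probability T R).

Lemma bounded_sqint (X : T -> R) (M : R) : measurable_fun setT X ->
  (forall w, `|X w| <= M) -> sqint P X.
Proof.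
move=> mX XM; apply: (@le_sqint _ _ _ P X (cst M)) => //.
  by move=> w /=; apply: (le_trans (XM w)); exact: ler_norm.
split; first exact: measurable_cst.
by rewrite (eq_integral (cst (M ^+ 2)%:E))// integral_cst//= probability_setT mule1 ltry.
Qed.

Lemma bounded_integrable (X : T -> R) (M : R) : measurable_fun setT X ->
  (forall w, `|X w| <= M) -> P.-integrable setT (EFin \o X).
Proof. by move=> mX XM; have [? ?] := bounded_sqint mX XM; exact: integrable_sqr. Qed.

Lemma measurable_cosM (X : T -> R) c : measurable_fun setT X ->
  measurable_fun setT (fun w => cos (c * X w)).
Proof.
move=> mX; have mc : measurable_fun setT (@cos R).
  by apply: continuous_measurable_fun; exact: continuous_cos.
by apply: (measurableT_comp mc); exact: measurable_funM.
Qed.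

End bounded.

Section normal_trig.
Context (R : realType).
Local Notation N01 := (@normal_prob R 0 1).

Lemma normal_trig_integral (l : seq (R * R)) (v : R) : 0 <= v ->
  (\int[N01]_y (trig l (Num.sqrt v * y))%:E =
   (\sum_(a <- l) a.1 * expR (- (a.2 ^+ 2 * v / 2)))%:E)%E /\
  N01.-integrable setT (EFin \o (fun y => trig l (Num.sqrt v * y))).
Proof.
move=> v0.
have cosb (x : R) : `|cos x| <= 1 by rewrite ler_norml cos_geN1 cos_le1.
have icos (a : R * R) : N01.-integrable setT (EFin \o (fun y : R => cos (a.2 * (Num.sqrt v * y)))).
  apply: (@bounded_integrable _ _ _ N01 _ 1) => //.
  apply: measurable_cosM; exact: mulrl_measurable.
have icos' (a : R * R) : N01.-integrable setT (fun y : R => (a.1 * cos (a.2 * (Num.sqrt v * y)))%:E).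
  by have := integrableZl measurableT a.1 (icos a).
split; last first.
  have := @integrable_sum _ _ _ N01 setT measurableT _ l xpredT (fun a y => (a.1 * cos (a.2 * (Num.sqrt v * y)))%:E) (fun a _ => icos' a).
  by rewrite (_ : (fun y => _) = (EFin \o (fun y => trig l (Num.sqrt v * y))))// funeqE => y; rewrite sumEFin.
under eq_integral do rewrite /trig -sumEFin.
rewrite integral_sum//.
rewrite -sumEFin; apply: eq_bigr => a _; under eq_integral do rewrite EFinM.
rewrite integralZl//; last exact: icos.
rewrite EFinM; congr (_ * _)%E.
have <- : \int[N01]_x cos (a.2 * Num.sqrt v * x) = expR (- (a.2 ^+ 2 * v / 2)).
  by rewrite normal_charfun exprMn sqr_sqrtr.
rewrite /Rintegral fineK; last first.
  apply: integrable_fin_num => //; apply: (@bounded_integrable _ _ _ N01 _ 1) => //.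
  by apply: measurable_cosM.
by apply: eq_integral => y _; rewrite mulrA.
Qed.

Lemma normal_trig_abs_powR (l : seq (R * R)) (p k v : R) : 0 < p -> 0 <= v ->
  (forall x, `| `|x| `^ p - trig l x| <= k * (1 + `|x| `^ (p + 1))) ->
  `|\sum_(a <- l) a.1 * expR (- (a.2 ^+ 2 * v / 2)) - normal_abs_moment p * v `^ (p / 2)|
  <= k * (1 + v `^ ((p + 1) / 2) * normal_abs_moment (p + 1)).
Proof.
move=> p0 v0 lP.
have mP q : measurable_fun setT (fun y : R => `|Num.sqrt v * y| `^ q).
  by have /measurableT_comp := measurable_abs_powR q; apply; exact: mulrl_measurable.
have iP q : 0 <= q -> N01.-integrable setT (EFin \o (fun y : R => `|Num.sqrt v * y| `^ q)).
  move=> q0; apply/integrableP; split; first by apply/measurable_EFinP; exact: mP.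
  under eq_integral => y _ do rewrite gee0_abs ?lee_fin ?powR_ge0//.
  by rewrite normal_abs_moment_scale// ltry.
have [E1 I1] := normal_trig_integral l v0.
have i0 := (@finite_measure_integrable_cst _ _ _ N01 setT 1 measurableT).
have p10 : 0 <= p + 1 by lra.
have I2 := iP _ (ltW p0); have I3 := iP _ p10.
have I4 : N01.-integrable setT (EFin \o (fun y => 1 + `|Num.sqrt v * y| `^ (p + 1))).
  exact: (integrableD measurableT i0 I3).
have -> : \sum_(a <- l) a.1 * expR (- (a.2 ^+ 2 * v / 2)) - normal_abs_moment p * v `^ (p / 2) =
    \int[N01]_y (trig l (Num.sqrt v * y) - `|Num.sqrt v * y| `^ p).
  rewrite RintegralB//; congr (_ - _); first by rewrite /Rintegral E1.
  by rewrite /Rintegral (normal_abs_moment_scale (ltW p0) v0)/= mulrC.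
apply: (le_trans (le_normr_Rintegral _ _)) => //.
  exact: (integrableB measurableT I1 I2).
have -> : k * (1 + v `^ ((p + 1) / 2) * normal_abs_moment (p + 1)) =
    \int[N01]_y (k * (1 + `|Num.sqrt v * y| `^ (p + 1))).
  rewrite RintegralZl// RintegralD// Rintegral_cst//= probability_setT/= mulr1.
  by rewrite /Rintegral normal_abs_moment_scale.
apply: le_Rintegral => //.
- exact: (integrable_abse (integrableB measurableT I1 I2)).
- exact: (integrableZl measurableT k I4).
- by move=> y _; rewrite distrC; exact: lP.
Qed.

End normal_trig.

Section weak_law.
Context d (T : measurableType d) (R : realType) (P : probability T R).
Variable W : set (plane R) -> T -> R.
Hypothesis hW : white_noise P W.
Local Notation lam := (@lambda2 R).

Lemma inner_lin2 (f g : plane R -> R) (a b : R) : sqint lam f -> sqint lam g ->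
  inner lam (fun u => a * f u + b * g u) (fun u => a * f u + b * g u) =
  a ^+ 2 * inner lam f f + 2 * a * b * inner lam f g + b ^+ 2 * inner lam g g.
Proof.
move=> sf sg; have saf := sqintZ a sf; have sbg := sqintZ b sg.
have sD := sqintD saf sbg.
rewrite innerDl// !innerZl// ![inner lam _ (fun u => _ + _)]innerC !innerDl// !innerZl//.
by rewrite (innerC lam g f); ring.
Qed.

Lemma noise_cos_mean f X c : noise_limit P W f X ->
  \int[P]_w cos (c * X w) = expR (- (c ^+ 2 * inner lam f f / 2)).
Proof.
move=> nf; have sf := noise_limit_sqint hW nf.
have := noise_limit_cos hW (noise_limitD hW c 0 nf nf).
rewrite inner_lin2// !mulr0 !mul0r expr0n/= mul0r !addr0 => <-.
by apply: eq_Rintegral => w _; rewrite mul0r addr0.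
Qed.

Lemma noise_cos_cov f g X Y c : noise_limit P W f X -> noise_limit P W g Y ->
  `|inner P (fun w => cos (c * X w) - expR (- (c ^+ 2 * inner lam f f / 2)))
            (fun w => cos (c * Y w) - expR (- (c ^+ 2 * inner lam g g / 2)))|
  <= c ^+ 2 * `|inner lam f g|.
Proof.
move=> nf ng; have sf := noise_limit_sqint hW nf; have sg := noise_limit_sqint hW ng.
have [_ mX _] := nf; have [_ mY _] := ng.
set v := inner lam f f; set u := inner lam g g; set r := inner lam f g.
set ev := expR _; set eu := expR _.
have EX : \int[P]_w cos (c * X w) = ev by exact: noise_cos_mean.
have EY : \int[P]_w cos (c * Y w) = eu by exact: noise_cos_mean.
have cosb (x : R) : `|cos x| <= 1 by rewrite ler_norml cos_geN1 cos_le1.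
have mcX := measurable_cosM c mX; have mcY := measurable_cosM c mY.
have Ep := noise_limit_cos hW (noise_limitD hW c c nf ng).
have Em := noise_limit_cos hW (noise_limitD hW c (- c) nf ng).
rewrite inner_lin2// -/v -/u -/r in Ep; rewrite inner_lin2// -/v -/u -/r in Em.
have mp : measurable_fun setT (fun w => cos (c * X w + c * Y w)).
  have [_ m _] := noise_limitD hW c c nf ng.
  by have := measurable_cosM 1 m; under eq_fun do rewrite mul1r.
have mm : measurable_fun setT (fun w => cos (c * X w + - c * Y w)).
  have [_ m _] := noise_limitD hW c (- c) nf ng.
  by have := measurable_cosM 1 m; under eq_fun do rewrite mul1r.
have ip := bounded_integrable P mp (fun w => cosb _).
have im := bounded_integrable P mm (fun w => cosb _).
have iX := bounded_integrable P mcX (fun w => cosb _).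
have iY := bounded_integrable P mcY (fun w => cosb _).
have i0 := (@finite_measure_integrable_cst _ _ _ P setT (ev * eu) measurableT).
have -> : inner P (fun w => cos (c * X w) - ev) (fun w => cos (c * Y w) - eu) =
    2^-1 * (\int[P]_w cos (c * X w + c * Y w) + \int[P]_w cos (c * X w + - c * Y w))
    - ev * eu.
  have i1 : P.-integrable setT (EFin \o (fun w => 2^-1 * (cos (c * X w + c * Y w) + cos (c * X w + - c * Y w)))).
    exact: (integrableZl measurableT 2^-1 (integrableD measurableT ip im)).
  have i2 : P.-integrable setT (EFin \o (fun w => eu * cos (c * X w))).
    exact: (integrableZl measurableT eu iX).
  have i3 : P.-integrable setT (EFin \o (fun w => ev * cos (c * Y w))).
    exact: (integrableZl measurableT ev iY).
  have i12 : P.-integrable setT (EFin \o (fun w => 2^-1 * (cos (c * X w + c * Y w) + cos (c * X w + - c * Y w)) - eu * cos (c * X w))).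
    exact: (integrableB measurableT i1 i2).
  have i123 : P.-integrable setT (EFin \o (fun w => 2^-1 * (cos (c * X w + c * Y w) + cos (c * X w + - c * Y w)) - eu * cos (c * X w) - ev * cos (c * Y w))).
    exact: (integrableB measurableT i12 i3).
  transitivity (\int[P]_w (2^-1 * (cos (c * X w + c * Y w) + cos (c * X w + - c * Y w)) - eu * cos (c * X w) - ev * cos (c * Y w) + ev * eu)).
    by apply: eq_Rintegral => w _; rewrite mulNr cosD cosB; field.
  have isum : P.-integrable setT (EFin \o (fun w => cos (c * X w + c * Y w) + cos (c * X w + - c * Y w))).
    exact: (integrableD measurableT ip im).
  rewrite RintegralD// RintegralB// RintegralB// !RintegralZl//.
  by rewrite RintegralD// Rintegral_cst//= probability_setT/= EX EY; ring.
  exact: (@finite_measure_integrable_cst _ _ _ P setT eu measurableT).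
rewrite Ep Em.
have s1 : 0 <= c ^+ 2 * v + 2 * c * c * r + c ^+ 2 * u.
  by have := inner_ge0 lam (fun w => c * f w + c * g w); rewrite inner_lin2.
have s2 : 0 <= c ^+ 2 * v + 2 * c * - c * r + (- c) ^+ 2 * u.
  by have := inner_ge0 lam (fun w => c * f w + - c * g w); rewrite inner_lin2.
have s0 : 0 <= c ^+ 2 * v + c ^+ 2 * u.
  by rewrite addr_ge0// mulr_ge0 ?sqr_ge0// inner_ge0.
have -> : ev * eu = expR (- ((c ^+ 2 * v + c ^+ 2 * u) / 2)).
  by rewrite -expRD; congr expR; ring.
have d1 := expRN_lip (divr_ge0 s1 (ler0n R 2)) (divr_ge0 s0 (ler0n R 2)).
have d2 := expRN_lip (divr_ge0 s2 (ler0n R 2)) (divr_ge0 s0 (ler0n R 2)).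
move: d1 d2; set e1 := expR _; set e2 := expR _; set e0 := expR _.
have -> : (c ^+ 2 * v + 2 * c * c * r + c ^+ 2 * u) / 2 - (c ^+ 2 * v + c ^+ 2 * u) / 2 = c ^+ 2 * r by field.
have -> : (c ^+ 2 * v + 2 * c * - c * r + (- c) ^+ 2 * u) / 2 - (c ^+ 2 * v + c ^+ 2 * u) / 2 = - (c ^+ 2 * r) by field.
rewrite normrN normrM (ger0_norm (sqr_ge0 c)).
by rewrite !ler_norml; lra.
Qed.

Lemma noise_cos_lln (I : Type) (s : seq I) (w c : R) (A : I -> T -> R) (H : I -> plane R -> R) :
  (forall i, noise_limit P W (H i) (A i)) ->
  let S := fun x => \sum_(i <- s) w * (cos (c * A i x) - expR (- (c ^+ 2 * inner lam (H i) (H i) / 2))) in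
  sqint P S /\
  inner P S S <= c ^+ 2 * (w ^+ 2 * \sum_(i <- s) \sum_(j <- s) `|inner lam (H i) (H j)|).
Proof.
move=> nA S.
pose X i x := cos (c * A i x) - expR (- (c ^+ 2 * inner lam (H i) (H i) / 2)).
have sX i : sqint P (X i).
  have [_ mA _] := nA i; apply: (@bounded_sqint _ _ _ P _ (1 + 1)).
    by apply: measurable_funB => //; exact: measurable_cosM.
  move=> x; apply: (le_trans (ler_normB _ _)); apply: lerD.
    by rewrite ler_norml cos_geN1 cos_le1.
  rewrite ger0_norm ?expR_ge0// -expR0 ler_expR oppr_le0.
  by rewrite divr_ge0// mulr_ge0 ?sqr_ge0// inner_ge0.
split; first exact: (sqint_sum s (fun=> w) sX).
rewrite (inner_sum s (fun=> w) sX) mulrA mulr_sumr; apply: ler_sum => i _.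
rewrite mulr_sumr; apply: ler_sum => j _.
rewrite -expr2 [c ^+ 2 * _]mulrC -[leRHS]mulrA; apply: ler_wpM2l; first exact: sqr_ge0.
by apply: (le_trans (ler_norm _)); exact: noise_cos_cov.
Qed.

Lemma noise_abs_powR_lln (p V e : R) : 0 < p -> 0 <= V -> 0 < e -> exists2 t, 0 < t &
  forall (I : Type) (s : seq I) (w : R) (A : I -> T -> R) (H : I -> plane R -> R),
  0 <= w -> w * (size s)%:R <= 1 ->
  (forall i, noise_limit P W (H i) (A i)) ->
  (forall i, inner lam (H i) (H i) <= V) ->
  w ^+ 2 * (\sum_(i <- s) \sum_(j <- s) `|inner lam (H i) (H j)|) <= t ->
  (\int[P]_x `|\sum_(i <- s) w * (`|A i x| `^ p -
     normal_abs_moment p * inner lam (H i) (H i) `^ (p / 2))|%:E <= e%:E)%E.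
Proof.
move=> p0 V0 e0; have p10 : 0 < p + 1 by lra.
have mq0 q : 0 <= normal_abs_moment (R := R) q.
  by apply: Rintegral_ge0 => y _; exact: powR_ge0.
pose K := 1 + ((V + 1) `^ ((p + 1) / 2) * normal_abs_moment (p + 1) + 1).
have K1 : 1 <= K.
  by rewrite lerDl addr_ge0// mulr_ge0// powR_ge0.
pose k := e / (4 * K).
have k0 : 0 < k by rewrite divr_gt0//; lra.
have [l lP] := trig_approx_powR p0 k0.
pose L := \sum_(a <- l) `|a.1| * (1 + a.2 ^+ 2).
have L0 : 0 <= L by apply: sumr_ge0 => a _; rewrite mulr_ge0// addr_ge0 ?sqr_ge0.
pose h := e / (2 * (L + 1)).
have h0 : 0 < h by rewrite divr_gt0//; lra.
exists (h ^+ 2); first by rewrite exprn_gt0.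
move=> I s w A H w0 ws nA HV rho.
pose v i := inner lam (H i) (H i).
have v0 i : 0 <= v i by exact: inner_ge0.
have mA i : measurable_fun setT (A i) by have [] := nA i.
have p120 : 0 <= (p + 1) / 2 by rewrite divr_ge0// ltW.
have V10 : 0 <= V + 1 by rewrite addr_ge0.
have vV i : v i <= V + 1 by apply: (le_trans (HV i)); rewrite lerDl.
pose S (c : R) x := \sum_(i <- s) w * (cos (c * A i x) - expR (- (c ^+ 2 * v i / 2))).
pose Ef (v : R) := \sum_(a <- l) a.1 * expR (- (a.2 ^+ 2 * v / 2)).
have EfP i : `|Ef (v i) - normal_abs_moment p * v i `^ (p / 2)| <= k * K.
  apply: (le_trans (normal_trig_abs_powR p0 (v0 i) lP)); rewrite ler_pM2l//.
  rewrite lerD2l -[leLHS]addr0 lerD//; apply: ler_wpM2r => //.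
  by apply: ge0_ler_powR; rewrite ?nnegrE ?V10 ?vV ?v0 ?p120.
pose F1 x := \sum_(a <- l) `|a.1| * (2^-1 * (h^-1 * S a.2 x ^+ 2 + h)).
pose F2 x := \sum_(i <- s) w * (k * (1 + `|A i x| `^ (p + 1))).
have bound x : `|\sum_(i <- s) w * (`|A i x| `^ p - normal_abs_moment p * v i `^ (p / 2))| <=
    F1 x + F2 x + k * K.
  have -> : \sum_(i <- s) w * (`|A i x| `^ p - normal_abs_moment p * v i `^ (p / 2)) =
    \sum_(a <- l) a.1 * S a.2 x + \sum_(i <- s) w * (`|A i x| `^ p - trig l (A i x)) +
    \sum_(i <- s) w * (Ef (v i) - normal_abs_moment p * v i `^ (p / 2)).
    under [in RHS]eq_bigr do rewrite mulr_sumr.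
    rewrite exchange_big/= -big_split/= -big_split/=; apply: eq_bigr => i _.
    have -> : \sum_(a <- l) a.1 * (w * (cos (a.2 * A i x) - expR (- (a.2 ^+ 2 * v i / 2)))) =
       w * (trig l (A i x) - Ef (v i)).
      rewrite /trig /Ef -sumrB mulr_sumr; apply: eq_bigr => a _; ring.
    by ring.
  apply: (le_trans (ler_normD _ _)); apply: lerD.
    apply: (le_trans (ler_normD _ _)); apply: lerD.
      apply: (le_trans (ler_norm_sum _ _ _)); apply: ler_sum => a _.
      rewrite normrM ler_wpM2l// -[S a.2 x ^+ 2]real_normK ?num_real//.
      set t := `|_|; have := sqr_ge0 (t - h).
      have -> : (t - h) ^+ 2 = 2 * h * (2^-1 * (h^-1 * t ^+ 2 + h) - t) by field; rewrite gt_eqF.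
      by rewrite (pmulr_rge0 _ (mulr_gt0 (ltr0n R 2) h0)) subr_ge0.
    apply: (le_trans (ler_norm_sum _ _ _)); apply: ler_sum => i _.
    by rewrite normrM (ger0_norm w0) ler_wpM2l.
  apply: (le_trans (ler_norm_sum _ _ _)).
  apply: (@le_trans _ _ (\sum_(i <- s) w * (k * K))).
    by apply: ler_sum => i _; rewrite normrM (ger0_norm w0) ler_wpM2l.
  rewrite big_const_seq count_predT iter_addr addr0 -mulr_natr mulrAC ler_piMl//.
  by rewrite mulr_ge0//; lra.
have mS c : measurable_fun setT (S c).
  by have [[]] := noise_cos_lln s w c nA.
have s_ok c := noise_cos_lln s w c nA.
have mpw i : measurable_fun setT (fun x => `|A i x| `^ (p + 1)).
  by have /measurableT_comp := measurable_abs_powR (p + 1); apply.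
have mF1 (a : R * R) : measurable_fun setT (fun x => `|a.1| * (2^-1 * (h^-1 * S a.2 x ^+ 2 + h))).
  apply: measurable_funM => //; apply: measurable_funM => //; apply: measurable_funD => //.
  by apply: measurable_funM => //; exact: measurable_funX.
have pF1 (a : R * R) x : 0 <= `|a.1| * (2^-1 * (h^-1 * S a.2 x ^+ 2 + h)).
  rewrite mulr_ge0// mulr_ge0// addr_ge0// ?(ltW h0)// mulr_ge0 ?sqr_ge0//.
  by rewrite invr_ge0 ltW.
have mF2 i : measurable_fun setT (fun x => w * (k * (1 + `|A i x| `^ (p + 1)))).
  by apply: measurable_funM => //; apply: measurable_funM => //; exact: measurable_funD.
have pF2 i x : 0 <= w * (k * (1 + `|A i x| `^ (p + 1))).
  by rewrite mulr_ge0// mulr_ge0 ?(ltW k0)// addr_ge0// powR_ge0.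
have IF1 : (\int[P]_x (F1 x)%:E <= (e / 4)%:E)%E.
  under eq_integral do rewrite /F1 -sumEFin.
  rewrite ge0_integral_sum//; last 2 first.
  - by move=> a; apply/measurable_EFinP; exact: mF1.
  - by move=> a x _; rewrite lee_fin pF1.
  apply: (@le_trans _ _ (\sum_(a <- l) (`|a.1| * (1 + a.2 ^+ 2) * (h / 2))%:E)%E).
    apply: lee_sum => a _.
    have [sS SS] := s_ok a.2.
    have iS := sqint_mul sS sS.
    have i0 := (@finite_measure_integrable_cst _ _ _ P setT h measurableT).
    have i1 : P.-integrable setT (EFin \o (fun x => h^-1 * (S a.2 x * S a.2 x))).
      exact: (integrableZl measurableT h^-1 iS).
    have i2 : P.-integrable setT (EFin \o (fun x => h^-1 * (S a.2 x * S a.2 x) + h)).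
      exact: (integrableD measurableT i1 i0).
    have i3 : P.-integrable setT (EFin \o (fun x => (`|a.1| / 2) * (h^-1 * (S a.2 x * S a.2 x) + h))).
      exact: (integrableZl measurableT (`|a.1| / 2) i2).
    rewrite (eq_integral (EFin \o (fun x => (`|a.1| / 2) * (h^-1 * (S a.2 x * S a.2 x) + h)))); last first.
      by move=> x _; rewrite /= expr2 mulrA.
    rewrite -[leLHS]fineK; last exact: integrable_fin_num.
    rewrite lee_fin -/(Rintegral _ _ _) RintegralZl// RintegralD// RintegralZl//.
    rewrite Rintegral_cst//= probability_setT/= mulr1 -/(inner P (S a.2) (S a.2)).
    have : inner P (S a.2) (S a.2) <= a.2 ^+ 2 * h ^+ 2.
      by apply: (le_trans SS); rewrite ler_wpM2l ?sqr_ge0.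
    rewrite -(ler_pM2l (_ : 0 < h^-1)) ?invr_gt0// => HS.
    have -> : `|a.1| * (1 + a.2 ^+ 2) * (h / 2) = `|a.1| / 2 * (h^-1 * (a.2 ^+ 2 * h ^+ 2) + h).
      by field; rewrite gt_eqF.
    by rewrite ler_wpM2l ?divr_ge0// lerD2r.
  rewrite sumEFin lee_fin -mulr_suml -/L.
  have -> : e / 4 = h / 2 * (L + 1) by rewrite /h; field; lra.
  by rewrite mulrC ler_pM2l ?divr_gt0//; lra.
have IF2 : (\int[P]_x (F2 x)%:E <= (e / 4)%:E)%E.
  under eq_integral do rewrite /F2 -sumEFin.
  rewrite ge0_integral_sum//; last 2 first.
  - by move=> a; apply/measurable_EFinP; exact: mF2.
  - by move=> a x _; rewrite lee_fin pF2.
  apply: (@le_trans _ _ (\sum_(i <- s) (w * (k * K))%:E)%E).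
    apply: lee_sum => i _; under eq_integral do rewrite mulrA EFinM EFinD.
    rewrite ge0_integralZl//; last 3 first.
    - by apply: emeasurable_funD => //; apply/measurable_EFinP; exact: mpw.
    - by move=> x _; rewrite -EFinD lee_fin addr_ge0// powR_ge0.
    - by rewrite lee_fin mulr_ge0// ltW.
    rewrite ge0_integralD//; last by apply/measurable_EFinP; exact: mpw.
    rewrite integral_cst// mul1e/= probability_setT mulrA [leRHS]EFinM.
    apply: lee_wpmul2l; first by rewrite lee_fin mulr_ge0// ltW.
    rewrite /K EFinD leeD2l//; apply: (le_trans (noise_limit_moment hW (nA i) p10)).
    rewrite lee_fin lerD2r ler_wpM2r//.
    apply: ge0_ler_powR => //; rewrite ?nnegrE ?addr_ge0 ?v0// /v.
    by rewrite lerD2r.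
  rewrite sumEFin lee_fin big_const_seq count_predT iter_addr addr0.
  have -> : w * (k * K) *+ size s = w * (size s)%:R * (k * K) by rewrite -[LHS]mulr_natr; ring.
  have kK0 : 0 <= k * K by rewrite mulr_ge0//; lra.
  apply: (@le_trans _ _ (1 * (k * K))); first exact: ler_wpM2r.
  by rewrite mul1r le_eqVlt; apply/orP; left; apply/eqP; rewrite /k; field; lra.
have mF1s : measurable_fun setT (EFin \o F1).
  apply/measurable_EFinP; rewrite /F1; elim: (l) => [|a l' IH].
    by under eq_fun do rewrite big_nil; exact: measurable_cst.
  by under eq_fun do rewrite big_cons; exact: measurable_funD.
have mF2s : measurable_fun setT (EFin \o F2).
  apply/measurable_EFinP; rewrite /F2; elim: (s) => [|a l' IH].
    by under eq_fun do rewrite big_nil; exact: measurable_cst.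
  by under eq_fun do rewrite big_cons; exact: measurable_funD.
have F10 x : 0 <= F1 x by apply: sumr_ge0 => a _.
have F20 x : 0 <= F2 x by apply: sumr_ge0 => a _.
have kK : k * K = e / 4 by rewrite /k; field; lra.
apply: (@le_trans _ _ (\int[P]_x ((F1 x)%:E + ((F2 x)%:E + (e / 4)%:E)))%E).
  apply: ge0_le_integral => //.
  - apply/measurable_EFinP; apply: measurableT_comp => //.
    rewrite /F2; elim: (s) => [|i l' IH].
      by under eq_fun do rewrite big_nil; exact: measurable_cst.
    under eq_fun do rewrite big_cons; apply: measurable_funD => //.
    apply: measurable_funM => //; apply: measurable_funB => //.
    by have /measurableT_comp := measurable_abs_powR p; apply.
  - by apply: emeasurable_funD => //; exact: emeasurable_funD.
  - by move=> x _; rewrite -!EFinD lee_fin addrA -kK.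
rewrite ge0_integralD//; last 2 first.
- by move=> x _; rewrite -EFinD lee_fin addr_ge0// divr_ge0// ltW.
- exact: emeasurable_funD.
rewrite ge0_integralD//; last by move=> x _; rewrite lee_fin divr_ge0// ltW.
rewrite integral_cst//= probability_setT mule1.
apply: (le_trans (leeD IF1 (leeD IF2 (lexx _)))); rewrite -!EFinD lee_fin; lra.
- by move=> x _; rewrite lee_fin.
- by move=> x _; rewrite lee_fin.
Qed.

End weak_law.

Section plane_topology.
Context (R : realType).

Definition ratbox (q : (rat * rat) * (rat * rat)) : set (R * R) :=
  `]ratr q.1.1, ratr q.1.2[ `*` `]ratr q.2.1, ratr q.2.2[.

Lemma measurable_ratbox q : measurable (ratbox q : set (plane R)).
Proof. by apply: measurableX; exact: measurable_itv. Qed.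

Lemma ratbox_nbhs (z : R * R) (U : set (R * R)) : open U -> U z ->
  exists q, ratbox q z /\ ratbox q `<=` U.
Proof.
move=> oU Uz; have /nbhs_ballP[e /= e0 eU] : nbhs z U by exact: open_nbhs_nbhs.
have box (a : R) : exists q : rat * rat, [/\ a - e < ratr q.1, ratr q.1 < a, a < ratr q.2 & ratr q.2 < a + e].
  have h1 : a - e < a by rewrite ltrBlDr ltrDl.
  have h2 : a < a + e by rewrite ltrDl.
  have [q1] := rat_in_itvoo h1; have [q2] := rat_in_itvoo h2.
  by rewrite !in_itv/= => /andP[? ?] /andP[? ?]; exists (q1, q2).
have [q1 [a1 a2 a3 a4]] := box z.1; have [q2 [b1 b2 b3 b4]] := box z.2.
exists (q1, q2); split; first by split; rewrite /= in_itv/=; apply/andP.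
move=> y [] /=; rewrite !in_itv/= => /andP[c1 c2] /andP[c3 c4]; apply: eU.
by split => /=; rewrite /ball/= ltr_norml; lra.
Qed.

Definition nth_ratbox (n : nat) : set (R * R) :=
  if unpickle n is Some q then ratbox q else set0.

Lemma measurable_nth_ratbox n : measurable (nth_ratbox n : set (plane R)).
Proof. by rewrite /nth_ratbox; case: unpickle => [q|]; [exact: measurable_ratbox|exact: measurable0]. Qed.

Lemma nth_ratbox_nbhs (z : R * R) (U : set (R * R)) : open U -> U z ->
  exists n, nth_ratbox n z /\ nth_ratbox n `<=` U.
Proof.
move=> oU Uz; have [q [qz qU]] := ratbox_nbhs oU Uz.
by exists (pickle q); rewrite /nth_ratbox pickleK.
Qed.

Lemma open_measurable_plane (U : set (R * R)) : open U -> measurable (U : set (plane R)).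
Proof.
move=> oU; rewrite (_ : U = \bigcup_n (if `[< nth_ratbox n `<=` U >] then nth_ratbox n else set0)).
  apply: bigcupT_measurable => n; case: ifPn => _; first exact: measurable_nth_ratbox.
  exact: measurable0.
apply/seteqP; split => [z Uz|z [n _]].
  have [n [nz nU]] := nth_ratbox_nbhs oU Uz; exists n => //.
  by case: ifPn => // /negP; apply: contra_notP => _; exact/asboolP.
by case: ifPn => // /asboolP nU /nU.
Qed.

Lemma closed_measurable_plane (U : set (R * R)) : closed U -> measurable (U : set (plane R)).
Proof.
move=> cU; rewrite -[U]setCK; apply: measurableC; apply: open_measurable_plane.
exact: closed_openC.
Qed.

Lemma continuous_measurable_plane (f : R * R -> R) : continuous f ->
  measurable_fun setT (f : plane R -> R).
Proof.
move=> cf; apply: (measurability _ (RGenOpens.measurableE R)) => _ [_ [a [b ->]] <-].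
rewrite setTI; apply: open_measurable_plane; apply: open_comp => //.
Qed.

(* Lindelof *)
Lemma negligible_open_cover (mu : {measure set (plane R) -> \bar R})
    (F : set (set (R * R))) (E : set (R * R)) :
  (forall U, F U -> open U /\ mu.-negligible (U `&` E : set (plane R))) ->
  mu.-negligible (\bigcup_(U in F) U `&` E : set (plane R)).
Proof.
move=> FP.
pose G n : set (plane R) := if `[< exists2 U, F U & nth_ratbox n `<=` U >] then nth_ratbox n `&` E else set0.
apply: (@negligibleS _ _ _ _ (\bigcup_n G n)).
  move=> z [[U FU Uz] Ez]; have [oU _] := FP U FU.
  have [n [nz nU]] := nth_ratbox_nbhs oU Uz; exists n => //.
  rewrite /G; case: ifPn => [_|/negP]; first by split.
  by apply: contra_notP => _; apply/asboolP; exists U.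
apply: negligible_bigcup => n; rewrite /G; case: ifPn => [/asboolP[U FU nU]|_].
  by have [_] := FP U FU; apply: negligibleS => z [/nU].
exact: negligible_set0.
Qed.

Lemma msupp_closed (mu : probability (plane R) R) : closed (msupp mu : set (R * R)).
Proof. by apply: closed_bigI => C []. Qed.

Lemma msupp_full (mu : probability (plane R) R) : mu (~` msupp mu) = 0%E.
Proof.
have mS : measurable (~` msupp mu).
  by apply: measurableC; apply: closed_measurable_plane; exact: msupp_closed.
apply/(negligibleP _ mS).
have := @negligible_open_cover mu [set U | exists2 C, closed C /\ mu (C : set (plane R)) = 1%E & U = ~` C] setT.
rewrite setIT => H; apply: (@negligibleS _ _ _ _ _ _ _ (H _)).
  move=> z nz; apply: contrapT => h; apply: nz => C [cC C1].
  by apply: contrapT => nCz; apply: h; exists (~` C) => //; exists C.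
move=> _ [C [cC C1] ->]; split; first exact: closed_openC.
have mC : measurable (C : set (plane R)) by exact: closed_measurable_plane.
rewrite setIT; apply/negligibleP; first exact: measurableC.
by have := probability_setC mu mC; rewrite C1 subee.
Qed.

Lemma ess_supp_ae (g : plane R -> R) (A : set (plane R)) : ess_supp g `<=` A ->
  (@lambda2 R).-negligible [set z | ~ A z /\ g z <> 0].
Proof.
move=> gA.
have := @negligible_open_cover (@lambda2 R) [set U : set (R * R) |
       open U /\ \forall z \ae @lambda2 R, U z -> g z = 0] [set z | g z <> 0].
move=> H; apply: (@negligibleS _ _ _ _ _ _ _ (H _)).
  move=> z [nAz gz]; split => //.
  by apply: contrapT => nz; apply: nAz; apply: gA.
move=> U [oU [N [mN N0 UN]]]; split => //; exists N; split => //.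
by move=> z [Uz gz]; apply: UN => /= /(_ Uz).
Qed.

End plane_topology.

Section distance.
Context (R : realType).
Variable K : set (R * R).
Hypothesis K0 : K !=set0.
Hypothesis cK : closed K.

Definition dist_to (z : R * R) : R := inf [set `|z - k| | k in K].

Lemma dist_to_le z k : K k -> dist_to z <= `|z - k|.
Proof.
move=> Kk; apply: ge_inf; last by exists k.
by exists 0 => _ [y _ <-].
Qed.

Lemma dist_to_ge0 z : 0 <= dist_to z.
Proof.
apply: lb_le_inf; first by have [k Kk] := K0; exists `|z - k|; exists k.
by move=> _ [y _ <-].
Qed.

Lemma dist_to_lip z y : `|dist_to z - dist_to y| <= `|z - y|.
Proof.
suff H a b : dist_to a - dist_to b <= `|a - b|.
  by rewrite ler_norml lerNl opprB H andbT distrC H.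
rewrite lerBlDr addrC -lerBlDr; apply: lb_le_inf.
  by have [k Kk] := K0; exists `|b - k|; exists k.
move=> _ [k Kk <-]; rewrite lerBlDr; apply: (le_trans (dist_to_le a Kk)).
by rewrite (_ : a - k = (b - k) + (a - b)) ?ler_normD// [RHS]addrC subrKA.
Qed.

Lemma dist_to0 z : K z -> dist_to z = 0.
Proof.
move=> Kz; apply/eqP; rewrite eq_le dist_to_ge0 andbT.
by have := dist_to_le z Kz; rewrite subrr normr0.
Qed.

Lemma dist_to_gt0 z : ~ K z -> 0 < dist_to z.
Proof.
move=> nKz; have : nbhs z (~` K) by apply: open_nbhs_nbhs; split => //; exact: closed_openC.
move=> /nbhs_ballP[e /= e0 eK]; apply: (lt_le_trans e0); apply: lb_le_inf.
  by have [k Kk] := K0; exists `|z - k|; exists k.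
move=> _ [k Kk <-]; rewrite leNgt; apply/negP => zk; apply: (eK k) => //.
by rewrite -ball_normE.
Qed.

(* a Lipschitz tent equal to 1 on K and vanishing at distance 1/m *)
Definition tent (m : nat) (z : R * R) : R := Num.max 0 (1 - m.+1%:R * dist_to z).

Lemma tent_ge0 m z : 0 <= tent m z.
Proof. by rewrite le_max lexx. Qed.

Lemma tent_le1 m z : tent m z <= 1.
Proof. by rewrite ge_max ler01/= gerBl mulr_ge0// dist_to_ge0. Qed.

Lemma tent1 m z : K z -> tent m z = 1.
Proof. by move=> Kz; rewrite /tent dist_to0// mulr0 subr0 max_r. Qed.

Lemma tent_lip m z y : `|tent m z - tent m y| <= m.+1%:R * `|z - y|.
Proof.
have := dist_to_lip z y; rewrite -(ler_pM2l (ltr0Sn R m)).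
rewrite -{1}(ger0_norm (ler0n R m.+1)) -normrM mulrBr; set a := _ * _; set b := _ * _.
rewrite /tent -/a -/b => H; apply: le_trans H.
have [?|?] := leP 0 (1 - a); have [?|?] := leP 0 (1 - b); rewrite ?subrr ?normr0//.
- by rewrite opprB addrC subrKA distrC lexx.
- by rewrite ler_norml; have := ler_norm (b - a); rewrite distrC; lra.
- by rewrite ler_norml; have := ler_norm (a - b); lra.
Qed.

Lemma tent_cvg z : ~ K z -> tent m z @[m --> \oo] --> 0.
Proof.
move=> nKz; have d0 := dist_to_gt0 nKz.
apply: cvg_near_cst; near=> m; rewrite /tent max_l// subr_le0 -ler_pdivrMr// div1r.
apply: (@le_trans _ _ m%:R); last by rewrite ler_nat.
by near: m; exact: nbhs_infty_ger.
Unshelve. all: by end_near. Qed.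

End distance.

Section translation.
Context (R : realType).
Local Notation lam := (@lambda2 R).

Lemma negligible_shift (a : R * R) (N : set (plane R)) : lam.-negligible N ->
  lam.-negligible [set z : plane R | N (z.1 - a.1, z.2 - a.2)].
Proof.
move=> [M [mM M0 NM]].
exists (flip2 (0, 0) @^-1` (flip2 (- a.1, - a.2) @^-1` M)); split.
- by apply: measurable_funPTI; exact: measurable_funPTI.
- rewrite -[LHS]/(pushforward lam (flip2 (0, 0)) (flip2 (- a.1, - a.2) @^-1` M)).
  rewrite lambda2_flip; last exact: measurable_funPTI.
  by rewrite -[LHS]/(pushforward lam (flip2 (- a.1, - a.2)) M) lambda2_flip.
- move=> z /= /NM; rewrite /flip2 /flip/=; congr M; congr pair; ring.
Qed.

Lemma unit_square_closed : closed (@unit_square R : set (R * R)).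
Proof.
rewrite /unit_square (_ : _ `*` _ = (fst @^-1` `[0, 1]%classic) `&` (snd @^-1` `[0 : R, 1]%classic)).
  apply: closedI; apply: closed_comp; try exact: interval_closed.
    by move=> z _; exact: cvg_fst.
  by move=> z _; exact: cvg_snd.
by [].
Qed.

End translation.

Section concentration_facts.
Context (R : realType) (g : {mfun plane R >-> R}).
Hypothesis gsupp : ess_supp g `<=` unit_square.
Local Notation lam := (@lambda2 R).
Local Notation h := (g_incr g).
Local Notation c := (g_mass g).

Lemma measurable_g_shift (a : R * R) :
  measurable_fun setT (fun z : plane R => g (z.1 - a.1, z.2 - a.2)).
Proof.
apply: (@measurableT_comp _ _ _ _ _ _ g _ (fun z : plane R => (z.1 - a.1, z.2 - a.2) : plane R)) => //.
by apply: measurable_fun_pair; apply: measurable_funB.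
Qed.

Lemma g_incrE n : h n = (fun z : plane R => g (z.1 - 0, z.2 - 0) - g (z.1 - n%:R^-1, z.2 - 0)
   - g (z.1 - 0, z.2 - n%:R^-1) + g (z.1 - n%:R^-1, z.2 - n%:R^-1)).
Proof. by apply/funext => -[z1 z2]; rewrite /g_incr/= !subr0. Qed.

Lemma measurable_g_incr n : measurable_fun setT (h n : plane R -> R).
Proof.
rewrite g_incrE; apply: measurable_funD; last exact: (measurable_g_shift (n%:R^-1, n%:R^-1)).
apply: measurable_funB; last exact: (measurable_g_shift (0, n%:R^-1)).
apply: measurable_funB; last exact: (measurable_g_shift (n%:R^-1, 0)).
exact: (measurable_g_shift (0, 0)).
Qed.

Definition fat_square n : set (plane R) := `[0, 1 + n%:R^-1]%classic `*` `[0, 1 + n%:R^-1]%classic.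

Lemma measurable_fat_square n : measurable (fat_square n).
Proof. by apply: measurableX; exact: measurable_itv. Qed.

Lemma g_incr_negligible n :
  lam.-negligible [set z : plane R | ~ fat_square n z /\ h n z <> 0].
Proof.
have n0 : 0 <= n%:R^-1 :> R by rewrite invr_ge0.
pose N : set (plane R) := [set z | ~ unit_square z /\ g z <> 0].
have N0 : lam.-negligible N by exact: ess_supp_ae.
pose sh (a : R * R) : set (plane R) := [set z : plane R | N (z.1 - a.1, z.2 - a.2)].
have sh0 a : lam.-negligible (sh a) by exact: negligible_shift.
apply: (@negligibleS _ _ _ _ ((sh (0, 0) `|` sh (n%:R^-1, 0)) `|` (sh (0, n%:R^-1) `|` sh (n%:R^-1, n%:R^-1)))).
  move=> z [nz hz]; apply: contrapT => /not_orP[/not_orP[s1 s2] /not_orP[s3 s4]].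
  have key (a b : R) : 0 <= a <= n%:R^-1 -> 0 <= b <= n%:R^-1 -> ~ sh (a, b) z ->
      g (z.1 - a, z.2 - b) = 0.
    move=> a01 b01 sz; apply: contrapT => gz; apply: sz; split => //= uz; apply: nz.
    by move: uz; rewrite /fat_square /unit_square /= !in_itv/=; move=> [/andP[? ?] /andP[? ?]]; split; lra.
  apply: hz; rewrite g_incrE !key ?lexx ?n0//; lra.
by apply: negligibleU; exact: negligibleU.
Qed.

Lemma g_mass_ge0 n : 0 <= c n.
Proof. by apply: Rintegral_ge0 => z _; rewrite sqr_ge0. Qed.

Lemma concentration_density n (f : plane R -> \bar R) : measurable_fun setT f ->
  (forall z, 0 <= f z)%E ->
  (\int[concentration_measure g n]_z f z = \int[lam]_z (f z * (h n z ^+ 2 / c n)%:E))%E.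
Proof.
move=> mf f0; apply: ge0_integral_density => //.
- by apply: measurable_funM => //; apply: measurable_funX; exact: measurable_g_incr.
- by move=> z; rewrite divr_ge0 ?sqr_ge0// g_mass_ge0.
Qed.

Lemma concentration_fat n : concentration_measure g n (~` fat_square n) = 0%E.
Proof.
have mF : measurable (~` fat_square n) by apply: measurableC; exact: measurable_fat_square.
have mh := measurable_g_incr n.
have md : measurable_fun (~` fat_square n) (fun z => (h n z ^+ 2 / c n)%:E).
  apply: measurable_funTS; apply/measurable_EFinP; apply: measurable_funM => //.
  exact: measurable_funX.
rewrite /concentration_measure -[RHS](@integral0 _ _ _ lam (~` fat_square n)).
apply: ae_eq_integral => //; have [N [mN N0 NP]] := g_incr_negligible n.
exists N; split => // z /= hz; apply: NP => /=; apply: contrapT => H; apply: hz => nz.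
have [->|/eqP hz0] := eqVneq (h n z) 0; first by rewrite expr0n mul0r.
by exfalso; apply: H.
Qed.

Variable pi : probability (plane R) R.
Hypothesis piw : weak_cvg (concentration_measure g) pi.

Definition good_index n := 0 < c n /\ (\int[lam]_z (h n z ^+ 2)%:E = (c n)%:E)%E.

Lemma good_near : \forall n \near \oo, good_index n.
Proof.
have c1 : continuous (fun _ : R * R => 1 : R) by move=> z; exact: cvg_cst.
have b1 : bounded_fun (fun _ : R * R => 1 : R).
  by exists 1; split; rewrite ?num_real// => M M1 z _ /=; rewrite normr1 ltW.
have := piw c1 b1; rewrite integral_cst//= probability_setT mule1 => H.
have : \forall n \near \oo, ((0 : R)%:E < \int[concentration_measure g n]__ 1%:E)%E.
  move/fine_cvgP: (H) => [Hf /cvgrPdist_lt /(_ 1 ltr01) Hc].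
  near=> n.
  have fn : (\int[concentration_measure g n]__ 1%:E)%E \is a fin_num by near: n.
  have : `|1 - fine (\int[concentration_measure g n]__ 1%:E)%E| < 1 by near: n.
  by rewrite -(fineK fn) lte_fin/= ltr_norml; lra.
apply: filterS => n; rewrite integral_cst//= mul1e /concentration_measure => Hn.
have cn0 : c n != 0.
  apply/eqP => c0; move: Hn; rewrite c0; under eq_integral do rewrite invr0 mulr0.
  by rewrite integral0 ltxx.
split; first by rewrite lt_neqAle eq_sym cn0 g_mass_ge0.
rewrite /g_mass /Rintegral fineK// ge0_fin_numE; last first.
  by apply: integral_ge0 => z _; rewrite lee_fin sqr_ge0.
rewrite ltey; apply: contra cn0 => /eqP; rewrite /g_mass /Rintegral => ->.
by [].
Unshelve. all: by end_near. Qed.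


Lemma concentration_mass n : good_index n -> concentration_measure g n setT = 1%E.
Proof.
move=> [c0 ch]; rewrite /concentration_measure; under eq_integral do rewrite EFinM.
rewrite ge0_integralZr//.
- by rewrite ch -EFinM divff// gt_eqF.
- by apply/measurable_EFinP; apply: measurable_funX; exact: measurable_g_incr.
- by move=> z _; rewrite lee_fin sqr_ge0.
- by rewrite lee_fin invr_ge0 ltW.
Qed.

Lemma concentration_integrable n (f : R * R -> R) : good_index n -> continuous f ->
  bounded_fun f -> (concentration_measure g n).-integrable setT (EFin \o f).
Proof.
move=> gn cf bf; apply: measurable_bounded_integrable => //.
- by rewrite [X in (X < _)%E](concentration_mass gn) ltry.
- exact: continuous_measurable_plane.
Qed.

Lemma weak_cvgR (f : R * R -> R) : continuous f -> bounded_fun f ->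
  \int[concentration_measure g n]_z f z @[n --> \oo] --> \int[pi]_z f z.
Proof.
move=> cf bf; have := piw cf bf.
have ipi : pi.-integrable setT (EFin \o f).
  apply: measurable_bounded_integrable => //.
  - by rewrite (@le_lt_trans _ _ 1%E) ?ltry// probability_le1.
  - exact: continuous_measurable_plane.
have fpi : (\int[pi]_z (f z)%:E)%E = (\int[pi]_z f z)%:E.
  by rewrite /Rintegral fineK//; exact: integrable_fin_num.
by rewrite fpi => /fine_cvgP[_].
Qed.

Lemma dist_unit_fat n (z : R * R) : fat_square n z -> dist_to unit_square z <= n%:R^-1.
Proof.
have n0 : 0 <= n%:R^-1 :> R by rewrite invr_ge0.
case: z => z1 z2 [] /=; rewrite !in_itv/= => /andP[a1 a2] /andP[b1 b2].
have K : unit_square ((Num.min z1 1, Num.min z2 1) : R * R).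
  by split; rewrite /= in_itv/= le_min ?a1 ?b1 ler01 ge_min lexx orbT.
apply: (le_trans (dist_to_le _ K)).
rewrite /Num.norm/= ge_max; apply/andP; split => /=.
  by have [?|?] := leP z1 1; rewrite ?subrr ?normr0//; rewrite ger0_norm; lra.
by have [?|?] := leP z2 1; rewrite ?subrr ?normr0//; rewrite ger0_norm; lra.
Qed.

Lemma limit_unit_square : pi (~` unit_square) = 0%E.
Proof.
have us0 : (@unit_square R : set (R * R)) !=set0.
  by exists (0, 0); split; rewrite /= in_itv/= lexx ler01.
have us_cl := @unit_square_closed R.
pose f (z : R * R) : R := Num.min 1 (dist_to unit_square z).
have f0 z : 0 <= f z by rewrite le_min ler01 dist_to_ge0.
have f1 z : f z <= 1 by rewrite ge_min lexx.
have cf : continuous f.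
  move=> z; apply/cvgrPdist_le => e e0; near=> y.
  apply: (@le_trans _ _ `|z - y|); last by near: y; apply: cvgr_dist_le.
  have := dist_to_lip us0 z y; rewrite /f.
  set a := dist_to _ z; set b := dist_to _ y => ab; apply: le_trans ab.
  have [?|?] := leP 1 a; have [?|?] := leP 1 b; rewrite ?subrr ?normr0//.
    by rewrite !ger0_norm; lra.
  by rewrite !ler0_norm; lra.
have bf : bounded_fun f.
  by exists 1; split; rewrite ?num_real// => M M1 z _ /=; rewrite ger0_norm// (le_trans (f1 z))// ltW.
have mf : measurable_fun setT (EFin \o f).
  by apply/measurable_EFinP; exact: continuous_measurable_plane.
have cvf := weak_cvgR cf bf.
have small : \forall n \near \oo, 0 <= \int[concentration_measure g n]_z f z <= n%:R^-1.
  near=> n; have gn : good_index n by near: n; exact: good_near.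
  apply/andP; split; first by apply: Rintegral_ge0 => z _; exact: f0.
  have fi := concentration_integrable gn cf bf.
  rewrite -lee_fin /Rintegral fineK//; last exact: integrable_fin_num.
  apply: (@le_trans _ _ (\int[concentration_measure g n]__ (n%:R^-1)%:E)%E).
    apply: ae_ge0_le_integral => //.
    - by move=> z _; rewrite lee_fin.
    - exists (~` fat_square n); split.
      + by apply: measurableC; exact: measurable_fat_square.
      + exact: concentration_fat.
      + move=> z /= hz nz; apply: hz => _; rewrite lee_fin.
        by rewrite ge_min dist_unit_fat// orbT.
  by rewrite integral_cst//= [X in (_ * X)%E](concentration_mass gn) mule1.
have If0 : \int[pi]_z f z = 0.
  have c0 : \int[concentration_measure g n]_z f z @[n --> \oo] --> (0 : R).
    apply: (squeeze_cvgr small); first exact: cvg_cst.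
    by rewrite -(cvg_shiftS (fun n : nat => n%:R^-1 : R)); exact: cvg_harmonic.
  exact: (cvg_unique _ cvf c0).
have : (\int[pi]_z `|(f z)%:E| = 0)%E.
  under eq_integral do rewrite gee0_abs ?lee_fin//.
  by rewrite -[LHS]fineK; [rewrite -[fine _]/(\int[pi]_z f z) If0|
     apply: integrable_fin_num => //; apply: measurable_bounded_integrable => //;
     [rewrite (@le_lt_trans _ _ 1%E) ?ltry// probability_le1|exact: continuous_measurable_plane]].
move=> /ae_eq_integral_abs => /(_ measurableT mf) [N [mN N0 NP]].
apply/negligibleP; first by apply: measurableC; exact: closed_measurable_plane.
exists N; split => // z nz; apply: NP => /= /(_ I) [].
by rewrite /f => /eqP; apply/negP; rewrite gt_eqF// lt_min ltr01 dist_to_gt0.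
Unshelve. all: by end_near. Qed.

End concentration_facts.

Section uniform_continuity.
Context (R : realType).

Definition modulus (F : R * R -> R) (d k : R) := forall z y : R * R,
  `|z.1 - y.1| < d -> `|z.2 - y.2| < d -> `|F z - F y| <= k.

Definition ucont (F : R * R -> R) := forall k, 0 < k -> exists2 d, 0 < d & modulus F d k.

Lemma ucont_continuous F : ucont F -> continuous F.
Proof.
move=> uF z; apply/cvgrPdist_le => k /uF[d d0 dF].
have H : nbhs z (ball z d) by exact: nbhsx_ballx.
by apply: filterS H => y []; rewrite /ball/= => h1 h2; exact: dF.
Qed.

Lemma ucont_curry F : ucont F -> ucont2 (fun a b => F (a, b)).
Proof. by move=> uF k /uF[d d0 dF]; exists d => // u v u' v' h1 h2; exact: dF. Qed.

Lemma heine (K : set (R * R)) (f : R * R -> R) k : compact K -> 0 < k ->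
  {within K, continuous f} -> exists2 d, 0 < d & forall z y, K z -> K y ->
    `|z.1 - y.1| < d -> `|z.2 - y.2| < d -> `|f z - f y| <= k.
Proof.
move=> /compact_near_coveringP cK k0 /subspace_continuousP cf.
pose P (d : R) (z : R * R) := K z -> forall y, K y -> `|z.1 - y.1| < d -> `|z.2 - y.2| < d -> `|f z - f y| <= k.
have : \forall d \near 0^'+, K `<=` P d.
  apply: cK => z Kz; have k20 : 0 < k / 2 by lra.
  have /cvgrPdist_le /(_ _ k20) := cf z Kz.
  rewrite near_withinE => /nbhs_ballP[e /= e0 eK].
  near=> z' d => /= Kz' y Ky y1 y2.
  have de : d < e / 2.
    by near: d; apply: nbhs_right_lt; rewrite divr_gt0.
  have zz' : ball z (e / 2) z'.
    by near: z'; apply: nbhsx_ballx; rewrite divr_gt0.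
  have zz'e : ball z e z' by apply: (le_ball _ zz'); lra.
  have zy : ball z e y.
    move: zz' => [] /=; rewrite /ball/= => a1 a2; split; rewrite /= /ball/=.
      have := ler_normD (z.1 - z'.1) (z'.1 - y.1); rewrite subrKA; lra.
    by have := ler_normD (z.2 - z'.2) (z'.2 - y.2); rewrite subrKA; lra.
  have h1 := eK _ zz'e Kz'; have h2 := eK _ zy Ky.
  rewrite (_ : f z' - f y = (f z - f y) - (f z - f z')); last by ring.
  by apply: (le_trans (ler_normB _ _)); lra.
move=> H; near (0 : R)^'+ => d.
have d0 : 0 < d by [].
have KP : K `<=` P d by near: d.
by exists d => // z y Kz; exact: (KP z Kz Kz).
Unshelve. all: by end_near. Qed.

Lemma modulus_sqr (F : R * R -> R) B : (forall z, 0 <= F z <= B) -> ucont F -> ucont (fun z => F z ^+ 2).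
Proof.
move=> FB uF k k0.
have B0 : 0 <= B by have /andP[a b] := FB 0; exact: le_trans b.
have k1 : 0 < k / (2 * B + 1) by rewrite divr_gt0//; lra.
have [d d0 dF] := uF _ k1; exists d => // z y h1 h2.
rewrite subr_sqr normrM; apply: (@le_trans _ _ (k / (2 * B + 1) * (2 * B))).
  apply: ler_pM => //; first exact: dF.
  by have /andP[? ?] := FB z; have /andP[? ?] := FB y; rewrite ger0_norm; lra.
rewrite mulrAC ler_pdivrMr; last lra.
by rewrite ler_pM2l//; lra.
Qed.

End uniform_continuity.

Section convolution.
Context (R : realType).

Definition convol (mu : {measure set (plane R) -> \bar R}) (F : R * R -> R) (t : R * R) : R :=
  \int[mu]_y F (t.1 - y.1, t.2 - y.2).

Lemma ucont_flip (F : R * R -> R) t : ucont F -> ucont (fun y : R * R => F (t.1 - y.1, t.2 - y.2)).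
Proof.
move=> uF k /uF[d d0 dF]; exists d => // z y h1 h2; apply: dF => /=.
  by rewrite (_ : t.1 - z.1 - (t.1 - y.1) = y.1 - z.1) 1?distrC//; ring.
by rewrite (_ : t.2 - z.2 - (t.2 - y.2) = y.2 - z.2) 1?distrC//; ring.
Qed.

Lemma bounded_flip (F : R * R -> R) B t : (forall z, 0 <= F z <= B) ->
  bounded_fun (fun y : R * R => F (t.1 - y.1, t.2 - y.2)).
Proof.
move=> FB; exists B; split; rewrite ?num_real// => M M1 z _ /=.
by have /andP[a b] := FB (t.1 - z.1, t.2 - z.2); rewrite ger0_norm// (le_trans b)// ltW.
Qed.

Lemma convol_integrable (mu : {measure set (plane R) -> \bar R}) (F : R * R -> R) B t :
  mu setT = 1%E -> (forall z, 0 <= F z <= B) -> ucont F ->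
  mu.-integrable setT (EFin \o (fun y : R * R => F (t.1 - y.1, t.2 - y.2))).
Proof.
move=> mu1 FB uF; apply: measurable_bounded_integrable => //.
- by rewrite [X in (X < _)%E]mu1 ltry.
- by apply: continuous_measurable_plane; apply: ucont_continuous; exact: ucont_flip.
- exact: bounded_flip FB.
Qed.

Lemma Rintegral_mass1_le (mu : {measure set (plane R) -> \bar R}) (f : R * R -> R) k :
  mu setT = 1%E -> mu.-integrable setT (EFin \o f) -> (forall y, `|f y| <= k) ->
  `|\int[mu]_y f y| <= k.
Proof.
move=> mu1 fi fk; apply: (le_trans (le_normr_Rintegral _ _)) => //.
have i0 : mu.-integrable setT (EFin \o cst k).
  apply: measurable_bounded_integrable => //; first by rewrite [X in (X < _)%E]mu1 ltry.
  by exists `|k|; split; rewrite ?num_real// => M M1 z _ /=; exact: ltW.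
apply: (@le_trans _ _ (\int[mu]_y k)).
  by apply: le_Rintegral => //; exact: (integrable_abse fi).
by rewrite Rintegral_cst//= [X in _ * fine X]mu1 mulr1.
Qed.

Lemma convol_modulus (mu : {measure set (plane R) -> \bar R}) (F : R * R -> R) B d k :
  mu setT = 1%E -> (forall z, 0 <= F z <= B) -> ucont F -> modulus F d k ->
  modulus (convol mu F) d k.
Proof.
move=> mu1 FB uF dF z y h1 h2.
have iz := convol_integrable z mu1 FB uF; have iy := convol_integrable y mu1 FB uF.
rewrite /convol -RintegralB//; apply: Rintegral_mass1_le => //.
  exact: (integrableB measurableT iz iy).
by move=> u; apply: dF => /=; rewrite opprB addrA subrK.
Qed.

Lemma convol_ucont (mu : {measure set (plane R) -> \bar R}) (F : R * R -> R) B :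
  mu setT = 1%E -> (forall z, 0 <= F z <= B) -> ucont F -> ucont (convol mu F).
Proof. by move=> mu1 FB uF k /[dup] k0 /uF[d d0 dF]; exists d => //; exact: convol_modulus FB uF dF. Qed.

Lemma convol_bound (mu : {measure set (plane R) -> \bar R}) (F : R * R -> R) B t :
  mu setT = 1%E -> (forall z, 0 <= F z <= B) -> ucont F -> 0 <= convol mu F t <= B.
Proof.
move=> mu1 FB uF; apply/andP; split.
  by apply: Rintegral_ge0 => y _; have /andP[] := FB (t.1 - y.1, t.2 - y.2).
apply: le_trans (ler_norm _) _; apply: Rintegral_mass1_le => //.
  exact: convol_integrable FB uF.
by move=> y; have /andP[a b] := FB (t.1 - y.1, t.2 - y.2); rewrite ger0_norm.
Qed.

Lemma convol_cvg_unif (mu : nat -> {measure set (plane R) -> \bar R})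
    (nu : {measure set (plane R) -> \bar R}) (F : R * R -> R) B k :
  nu setT = 1%E -> (\forall n \near \oo, mu n setT = 1%E) ->
  (forall z, 0 <= F z <= B) -> ucont F ->
  (forall f : R * R -> R, continuous f -> bounded_fun f ->
    \int[mu n]_z f z @[n --> \oo] --> \int[nu]_z f z) ->
  0 < k ->
  \forall n \near \oo, forall t : R * R, 0 <= t.1 <= 1 -> 0 <= t.2 <= 1 ->
    `|convol (mu n) F t - convol nu F t| <= k.
Proof.
move=> nu1 mu1 FB uF cv k0; have k30 : 0 < k / 3 by lra.
have [d d0 dF] := uF _ k30.
pose M := (Num.truncn d^-1).+1.
have M0 : 0 < M%:R :> R by rewrite ltr0n.
have Md : M%:R^-1 < d by rewrite invf_plt ?posrE//; exact: truncnS_gt.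
have grid : \forall n \near \oo, forall ij : 'I_M.+1 * 'I_M.+1,
    `|convol (mu n) F (ij.1%:R / M%:R, ij.2%:R / M%:R) - convol nu F (ij.1%:R / M%:R, ij.2%:R / M%:R)| <= k / 3.
  apply: filter_forall => ij.
  have /cvgrPdist_le /(_ _ k30) := cv _ (ucont_continuous (ucont_flip (ij.1%:R / M%:R, ij.2%:R / M%:R) uF))
    (bounded_flip (ij.1%:R / M%:R, ij.2%:R / M%:R) FB).
  by apply: filterS => n; rewrite distrC.
have round (a : R) : 0 <= a <= 1 -> exists i : 'I_M.+1, `|a - i%:R / M%:R| < d.
  move=> /andP[a0 a1]; have aM0 : 0 <= a * M%:R by rewrite mulr_ge0// ltW.
  have iM : (Num.truncn (a * M%:R) < M.+1)%N.
    rewrite ltnS -(ler_nat R); apply: (@le_trans _ _ (a * M%:R)); first by rewrite truncn_le.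
    by rewrite ler_piMl// ltW.
  exists (Ordinal iM) => /=; apply: le_lt_trans Md.
  have := truncn_itv aM0; set i := Num.truncn _ => /andP[i1 i2].
  rewrite ger0_norm; last by rewrite subr_ge0 ler_pdivrMr.
  rewrite lerBlDr -[X in _ <= X + _]div1r -mulrDl ler_pdivlMr//.
  by rewrite ltW// (lt_le_trans i2)// -natr1 addrC.
near=> n => t t1 t2.
have [i it] := round _ t1; have [j jt] := round _ t2.
have mn : mu n setT = 1%E by near: n.
have gn : `|convol (mu n) F (i%:R / M%:R, j%:R / M%:R) - convol nu F (i%:R / M%:R, j%:R / M%:R)| <= k / 3.
  have H : forall ij : 'I_M.+1 * 'I_M.+1,
    `|convol (mu n) F (ij.1%:R / M%:R, ij.2%:R / M%:R) - convol nu F (ij.1%:R / M%:R, ij.2%:R / M%:R)| <= k / 3 by near: n.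
  exact: (H (i, j)).
have h1 := @convol_modulus (mu n) F B d (k / 3) mn FB uF dF t (i%:R / M%:R, j%:R / M%:R) it jt.
have h2 := @convol_modulus nu F B d (k / 3) nu1 FB uF dF t (i%:R / M%:R, j%:R / M%:R) it jt.
move: h1 h2 gn; rewrite !ler_norml; lra.
Unshelve. all: by end_near. Qed.

End convolution.

Section paths.
Context (R : realType).

Definition clampR (v : R) : R := Num.max (-1) (Num.min 1 v).

Lemma clampR_itv v : -1 <= clampR v <= 1.
Proof.
rewrite /clampR le_max lexx/= ge_max; apply/andP; split; first lra.
by rewrite ge_min lexx.
Qed.

Lemma clampR_id v : -1 <= v <= 1 -> clampR v = v.
Proof. by move=> /andP[a b]; rewrite /clampR min_r// max_r. Qed.

Lemma clampR_lip u v : `|clampR u - clampR v| <= `|u - v|.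
Proof.
rewrite /clampR; have [?|?] := leP 1 u; have [?|?] := leP 1 v; rewrite ?maxEle;
  do ?case: ifPn; rewrite -?ltNge; intros; rewrite ler_norml; have := ler_norm (u - v);
  have := ler_norm (v - u); rewrite (distrC v); lra.
Qed.

Variable x : vol_path R.

Definition ext (z : R * R) : R := x (clampR z.1, clampR z.2).

Lemma big_square_clamp (z : R * R) : big_square ((clampR z.1, clampR z.2) : plane R).
Proof. by split; rewrite /= in_itv/= clampR_itv. Qed.

Lemma ext_id (z : R * R) : -1 <= z.1 <= 1 -> -1 <= z.2 <= 1 -> ext z = x z.
Proof. by case: z => a b /= h1 h2; rewrite /ext/= !clampR_id. Qed.

Lemma compact_big_square : compact (@big_square R : set (R * R)).
Proof. by apply: compact_setX; exact: segment_compact. Qed.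

Lemma ext_ucont : ucont ext.
Proof.
move=> k k0; have [d d0 dx] := heine compact_big_square k0 (@path_continuous R x).
exists d => // z y h1 h2; apply: dx; try exact: big_square_clamp.
  by apply: le_lt_trans h1; exact: clampR_lip.
by apply: le_lt_trans h2; exact: clampR_lip.
Qed.

Lemma path_ge0' z : 0 <= x z.
Proof.
have [bz|bz] := pselect (big_square (z : plane R)); first exact: path_ge0.
by rewrite path_out.
Qed.

Lemma path_bound : exists2 B, 0 < B & forall z, 0 <= x z <= B.
Proof.
have cim := continuous_compact (@path_continuous R x) compact_big_square.
have [M [_ HM]] := compact_bounded cim.
pose B := Num.max 1 (`|M| + 1).
have B0 : 0 < B by rewrite lt_max ltr01.
exists B => // z; rewrite path_ge0'/=.
have [bz|bz] := pselect (big_square (z : plane R)); last by rewrite path_out ?ltW.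
rewrite le_max; apply/orP; right.
have M1 : M < `|M| + 1 by have := ler_norm M; lra.
have xz : (path_fun x @` big_square) (x z) by exists z.
by have := HM _ M1 _ xz; rewrite /= ger0_norm ?path_ge0'.
Qed.

Lemma measurable_path : measurable_fun setT (x : plane R -> R).
Proof.
have -> : (x : plane R -> R) = (fun z => ext z * \1_big_square z).
  apply/funext => z; rewrite indicE; have [|] := boolP (z \in big_square).
    rewrite inE mulr1 => -[]; rewrite /= !in_itv/= => h1 h2.
    by rewrite ext_id.
  rewrite notin_setE => bz; rewrite mulr0; exact: path_out.
apply: measurable_funM.
  by apply: continuous_measurable_plane; apply: ucont_continuous; exact: ext_ucont.
by apply: measurable_indic; apply: measurableX; exact: measurable_itv.
Qed.

Lemma ext_bound B : (forall z, 0 <= x z <= B) -> forall z, 0 <= ext z <= B.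
Proof. by move=> xB z; exact: xB. Qed.

Definition ext2 (z : R * R) : R := ext z ^+ 2.

Lemma ext2_bound B : 0 <= B -> (forall z, 0 <= x z <= B) -> forall z, 0 <= ext2 z <= B ^+ 2.
Proof.
move=> B0 xB z; rewrite /ext2 sqr_ge0/=; have /andP[a b] := xB (clampR z.1, clampR z.2).
by apply: lerXn2r; rewrite ?nnegrE.
Qed.

Lemma ext2_ucont : ucont ext2.
Proof.
have [B B0 xB] := path_bound.
exact: (modulus_sqr (ext_bound xB) ext_ucont).
Qed.

End paths.

Section weighted_cauchy_schwarz.
Context (R : realFieldType).

Lemma weighted_cauchy_schwarz (I : Type) (s : seq I) (p y : I -> R) : (forall i, 0 <= p i) ->
  (\sum_(i <- s) p i * y i) ^+ 2 <= (\sum_(i <- s) p i) * (\sum_(i <- s) p i * y i ^+ 2).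
Proof.
move=> p0; elim: s => [|i s IH]; first by rewrite !big_nil expr0n mul0r.
rewrite !big_cons; set Q := \sum_(_ <- _) _ in IH *; set S := (X in _ <= _ * X) in IH.
set P := (X in _ <= X * _) in IH.
have : 0 <= \sum_(j <- s) p j * (y j - y i) ^+ 2.
  by apply: sumr_ge0 => j _; rewrite mulr_ge0// sqr_ge0.
have -> : \sum_(j <- s) p j * (y j - y i) ^+ 2 = S - 2 * y i * Q + y i ^+ 2 * P.
  rewrite /S /Q /P !mulr_sumr -sumrB -big_split/=; apply: eq_bigr => j _; ring.
move=> /(mulr_ge0 (p0 i)); rewrite -/S -/P -/Q; lra.
Qed.

End weighted_cauchy_schwarz.

Section kernel.
Context (R : realType) (g : {mfun plane R >-> R}).
Hypothesis gsupp : ess_supp g `<=` unit_square.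
Local Notation lam := (@lambda2 R).
Local Notation h := (g_incr g).
Local Notation c := (g_mass g).
Variable x : vol_path R.
Variable B : R.
Hypothesis B0 : 0 < B.
Hypothesis xB : forall z, 0 <= x z <= B.

Definition kern n (t : R * R) (u : plane R) : R :=
  h n (t.1 - u.1, t.2 - u.2) * x u / Num.sqrt (c n).

Lemma measurable_flip_fun (f : plane R -> R) (t : R * R) : measurable_fun setT f ->
  measurable_fun setT (fun u : plane R => f (t.1 - u.1, t.2 - u.2)).
Proof. by move=> mf; apply: (@measurableT_comp _ _ _ _ _ _ f _ (flip2 t)). Qed.

Lemma measurable_kern n t : measurable_fun setT (kern n t).
Proof.
apply: measurable_funM => //; apply: measurable_funM; last exact: measurable_path.
by apply: measurable_flip_fun; exact: measurable_g_incr.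
Qed.

Lemma concentration_flip n (t : R * R) (f : plane R -> \bar R) : measurable_fun setT f ->
  (forall y, 0 <= f y)%E ->
  (\int[lam]_u (f ((t.1 - u.1)%R, (t.2 - u.2)%R) * (h n (t.1 - u.1, t.2 - u.2) ^+ 2 / c n)%:E)%E =
   \int[concentration_measure g n]_y f y)%E.
Proof.
move=> mf f0; rewrite concentration_density//.
pose F y := (f y * (h n y ^+ 2 / c n)%:E)%E.
rewrite -(@ge0_integral_flip2 R t F)//.
- apply: emeasurable_funM => //; apply/measurable_EFinP; apply: measurable_funM => //.
  by apply: measurable_funX; exact: measurable_g_incr.
- by move=> y; rewrite mule_ge0// lee_fin divr_ge0 ?sqr_ge0// g_mass_ge0.
Qed.

Lemma kern_sqr n t u : 0 < c n ->
  kern n t u ^+ 2 = x u ^+ 2 * (h n (t.1 - u.1, t.2 - u.2) ^+ 2 / c n).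
Proof.
move=> c0; rewrite /kern !exprMn exprVn sqr_sqrtr ?(ltW c0)//; ring.
Qed.

Lemma kern_norm n (t : R * R) : good_index g n -> n%:R^-1 <= t.1 <= 1 -> n%:R^-1 <= t.2 <= 1 ->
  (\int[lam]_u (kern n t u ^+ 2)%:E = (convol (concentration_measure g n) (ext2 x) t)%:E)%E.
Proof.
move=> gn t1 t2; have [c0 _] := gn.
have x2B := ext2_bound (ltW B0) xB.
have x2u := ext2_ucont x.
pose f (y : plane R) : \bar R := (x (t.1 - y.1, t.2 - y.2) ^+ 2)%:E.
have mf : measurable_fun setT f.
  apply/measurable_EFinP; apply: (measurable_funX 2).
  exact: measurable_flip_fun (measurable_path x).
transitivity (\int[concentration_measure g n]_y f y)%E.
  rewrite -(@concentration_flip n t)//; last by move=> y; rewrite lee_fin sqr_ge0.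
  apply: eq_integral => -[u1 u2] _; rewrite kern_sqr// EFinM /f/=; congr (_ * _)%E.
  by congr ((x (_, _) ^+ 2)%:E); ring.
have i2 := convol_integrable t (concentration_mass gn) x2B x2u.
rewrite /convol /Rintegral fineK; last exact: integrable_fin_num.
apply: ae_eq_integral => //.
  by apply/measurable_EFinP; apply: continuous_measurable_plane; apply: ucont_continuous; exact: ucont_flip.
exists (~` fat_square n); split.
- by apply: measurableC; exact: measurable_fat_square.
- exact: concentration_fat.
- move=> y /= hy fy; apply: hy => _; congr EFin; rewrite /ext2.
  move: fy; rewrite /fat_square /= !in_itv/= => -[y1 y2].
  by rewrite ext_id//=; lra.
Qed.

Lemma kern_weight n (t : R * R) (f : R * R -> R) : 0 < c n ->
  measurable_fun setT (f : plane R -> R) -> (forall z, 0 <= f z) ->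
  (\int[lam]_u (kern n t u ^+ 2 * f (t.1 - u.1, t.2 - u.2))%:E <=
   (B ^+ 2)%:E * \int[concentration_measure g n]_y (f y)%:E)%E.
Proof.
move=> c0 mf f0.
have mh : measurable_fun setT (fun u : plane R => h n (t.1 - u.1, t.2 - u.2) ^+ 2 / c n).
  apply: measurable_funM => //; apply: measurable_funX.
  exact: measurable_flip_fun (measurable_g_incr g n).
have mft := measurable_flip_fun t mf.
have hc0 u : 0 <= h n u ^+ 2 / c n by rewrite divr_ge0 ?sqr_ge0// ltW.
rewrite -(@concentration_flip n t (EFin \o f)); last 2 first.
- exact/measurable_EFinP.
- by move=> y; rewrite lee_fin.
rewrite -ge0_integralZl//; last 3 first.
- by apply: emeasurable_funM; exact/measurable_EFinP.
- by move=> u _; rewrite mule_ge0// lee_fin.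
- by rewrite lee_fin sqr_ge0.
apply: ge0_le_integral => //.
- by move=> u _; rewrite lee_fin mulr_ge0// sqr_ge0.
- apply/measurable_EFinP; apply: measurable_funM => //; apply: measurable_funX.
  exact: measurable_kern.
- by apply: measurable_funeM; apply: emeasurable_funM; exact/measurable_EFinP.
- move=> u _; rewrite kern_sqr// -!EFinM lee_fin -[leLHS]mulrA [f _ * _]mulrC.
  apply: ler_wpM2r; first by rewrite mulr_ge0.
  by have /andP[a b] := xB u; apply: lerXn2r; rewrite ?nnegrE// ltW.
Qed.

Lemma kern_sqint n t : good_index g n -> sqint lam (kern n t).
Proof.
move=> gn; have [c0 _] := gn; split; first exact: measurable_kern.
have := @kern_weight n t (fun=> 1) c0 (measurable_cst _) (fun=> ler01).
under [X in (X <= _)%E]eq_integral do rewrite mulr1.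
move=> /le_lt_trans; apply.
by rewrite integral_cst//= mul1e [X in (_ * X)%E](concentration_mass gn) mule1 ltry.
Qed.

Lemma kern_covariance_sum n (s : seq (R * R)) (w A : R) (psi : R * R -> R) :
  good_index g n -> 0 <= w -> w * (size s)%:R <= 1 -> continuous psi ->
  (forall z, 0 <= psi z <= 1) ->
  (forall u : R * R, w * (\sum_(t <- s) psi (t.1 - u.1, t.2 - u.2)) <= A) ->
  w ^+ 2 * (\sum_(t <- s) \sum_(t' <- s) `|inner lam (kern n t) (kern n t')|) <=
  2 * B ^+ 2 * (A + \int[concentration_measure g n]_y (1 - psi y)).
Proof.
move=> gn w0 ws cpsi psi01 psiA; have [c0 _] := gn.
have sk t := kern_sqint t gn.
have ska t : sqint lam (fun u => `|kern n t u|).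
  apply: le_sqint (sk t); last by move=> u; rewrite normr_id.
  by apply: measurableT_comp => //; exact: measurable_kern.
have A0 : 0 <= A.
  apply: le_trans (psiA (0, 0)); rewrite mulr_ge0// sumr_ge0// => t _.
  by have /andP[] := psi01 (t.1 - 0, t.2 - 0).
pose S (u : plane R) := \sum_(t <- s) w * `|kern n t u|.
have sS : sqint lam S by exact: (sqint_sum s (fun=> w) ska).
apply: (@le_trans _ _ (inner lam S S)).
  rewrite (inner_sum s (fun=> w) ska) mulr_sumr; apply: ler_sum => t _.
  rewrite mulr_sumr; apply: ler_sum => t' _; rewrite -expr2 ler_wpM2l ?sqr_ge0//.
  apply: (le_trans (le_normr_Rintegral _ _)) => //; first exact: sqint_mul.
  by rewrite /inner; under eq_Rintegral do rewrite normrM.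
pose phi (z : R * R) := A + (1 - psi z).
have phi0 z : 0 <= phi z by have /andP[a b] := psi01 z; rewrite addr_ge0// subr_ge0.
have cphi : continuous phi.
  by move=> z; apply: cvgD; [exact: cvg_cst|apply: cvgB; [exact: cvg_cst|exact: cpsi]].
have mphi := continuous_measurable_plane cphi.
have bpsi : bounded_fun (fun z => 1 - psi z).
  exists 1; split; rewrite ?num_real// => M M1 z _ /=.
  by have /andP[a b] := psi01 z; rewrite ger0_norm; lra.
have cpsi1 : continuous (fun z => 1 - psi z).
  by move=> z; apply: cvgB; [exact: cvg_cst|exact: cpsi].
have ipsi := concentration_integrable gn cpsi1 bpsi.
set D := (X in _ <= _ * (_ + X)).
have D0 : 0 <= D.
  by apply: Rintegral_ge0 => y _; have /andP[a b] := psi01 y; rewrite subr_ge0.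
have Iphi : (\int[concentration_measure g n]_y (phi y)%:E = (A + D)%:E)%E.
  under eq_integral do rewrite EFinD.
  rewrite integralD//; last first.
    apply: measurable_bounded_integrable => //.
      by rewrite [X in (X < _)%E](concentration_mass gn) ltry.
    by exists `|A|; split; rewrite ?num_real// => M M1 z _ /=; exact: ltW.
  rewrite integral_cst//= [X in (_ * X)%E](concentration_mass gn) mule1 EFinD.
  by rewrite /D /Rintegral fineK//; exact: integrable_fin_num.
rewrite -lee_fin -innerxx//.
pose F (t : R * R) (u : plane R) := 2 * w * (kern n t u ^+ 2 * phi (t.1 - u.1, t.2 - u.2)).
have F0 t u : 0 <= F t u.
  by apply: mulr_ge0; [exact: mulr_ge0|apply: mulr_ge0 => //; exact: sqr_ge0].
have mkp t : measurable_fun setT (fun u => kern n t u ^+ 2 * phi (t.1 - u.1, t.2 - u.2)).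
  apply: measurable_funM; last exact: measurable_flip_fun mphi.
  by apply: measurable_funX; exact: measurable_kern.
have mF t : measurable_fun setT (F t) by apply: measurable_funM.
apply: (@le_trans _ _ (\int[lam]_u (\sum_(t <- s) (F t u)%:E))%E).
  apply: ge0_le_integral => //.
  - by move=> u _; rewrite lee_fin sqr_ge0.
  - by apply/measurable_EFinP; apply: measurable_funX; have [] := sS.
  - by apply: emeasurable_sum => t; exact/measurable_EFinP.
  move=> u _; rewrite sumEFin lee_fin /S -mulr_sumr exprMn.
  pose p (t : R * R) := psi (t.1 - u.1, t.2 - u.2).
  have p01 t : 0 <= p t <= 1 by exact: psi01.
  have p0 t : 0 <= p t by have /andP[] := p01 t.
  have p1 t : 0 <= 1 - p t by have /andP[] := p01 t; rewrite subr_ge0.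
  have wcs1 := weighted_cauchy_schwarz s (fun t => `|kern n t u|) p0.
  have wcs2 := weighted_cauchy_schwarz s (fun t => `|kern n t u|) p1.
  have -> : \sum_(t <- s) `|kern n t u| = \sum_(t <- s) p t * `|kern n t u| + \sum_(t <- s) (1 - p t) * `|kern n t u|.
    by rewrite -big_split/=; apply: eq_bigr => t _; ring.
  set Q1 := \sum_(t <- s) p t * `|kern n t u| in wcs1 *.
  set Q2 := \sum_(t <- s) (1 - p t) * `|kern n t u| in wcs2 *.
  have h1 : w ^+ 2 * Q1 ^+ 2 <= w * A * \sum_(t <- s) kern n t u ^+ 2.
    rewrite expr2 -!mulrA ler_wpM2l//; apply: (@le_trans _ _ (w * ((\sum_(t <- s) p t) * \sum_(t <- s) p t * `|kern n t u| ^+ 2))).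
      by rewrite ler_wpM2l.
    rewrite mulrA; apply: ler_pM => //.
    - by rewrite mulr_ge0// sumr_ge0.
    - by rewrite sumr_ge0// => t _; rewrite mulr_ge0// sqr_ge0.
    - exact: psiA.
    - apply: ler_sum => t _; rewrite real_normK ?num_real// ler_piMl ?sqr_ge0//.
      by have /andP[] := p01 t.
  have h2 : w ^+ 2 * Q2 ^+ 2 <= w * \sum_(t <- s) kern n t u ^+ 2 * (1 - p t).
    rewrite expr2 -!mulrA ler_wpM2l//; apply: (@le_trans _ _ (w * ((\sum_(t <- s) (1 - p t)) * \sum_(t <- s) (1 - p t) * `|kern n t u| ^+ 2))).
      by rewrite ler_wpM2l.
    rewrite mulrA -[leRHS]mul1r; apply: ler_pM => //.
    - by rewrite mulr_ge0// sumr_ge0.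
    - by rewrite sumr_ge0// => t _; rewrite mulr_ge0// sqr_ge0.
    - apply: le_trans ws; rewrite ler_wpM2l//.
      apply: (@le_trans _ _ (\sum_(t <- s) 1)).
        by apply: ler_sum => t _; rewrite gerBl.
      by rewrite big_const_seq count_predT iter_addr addr0.
    - by apply: ler_sum => t _; rewrite real_normK ?num_real// mulrC.
  have -> : \sum_(t <- s) F t u = 2 * (w * A * \sum_(t <- s) kern n t u ^+ 2) + 2 * (w * \sum_(t <- s) kern n t u ^+ 2 * (1 - p t)).
    rewrite !mulr_sumr -big_split/=; apply: eq_bigr => t _; rewrite /F /phi /p; ring.
  have : w ^+ 2 * (Q1 + Q2) ^+ 2 <= 2 * (w ^+ 2 * Q1 ^+ 2) + 2 * (w ^+ 2 * Q2 ^+ 2).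
    have -> : 2 * (w ^+ 2 * Q1 ^+ 2) + 2 * (w ^+ 2 * Q2 ^+ 2) = w ^+ 2 * (2 * Q1 ^+ 2 + 2 * Q2 ^+ 2) by ring.
    rewrite ler_wpM2l ?sqr_ge0//; have := sqr_ge0 (Q1 - Q2); rewrite !expr2; nra.
  lra.
rewrite ge0_integral_sum//; last 2 first.
- by move=> t; exact/measurable_EFinP.
- by move=> t u _; rewrite lee_fin.
apply: (@le_trans _ _ (\sum_(t <- s) (2 * w * (B ^+ 2 * (A + D)))%:E)%E).
  apply: lee_sum => t _; under eq_integral do rewrite /F EFinM.
  rewrite ge0_integralZl//; last 3 first.
  - exact/measurable_EFinP.
  - by move=> u _; rewrite lee_fin mulr_ge0// sqr_ge0.
  - by rewrite lee_fin mulr_ge0.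
  rewrite [leRHS]EFinM; apply: lee_wpmul2l; first by rewrite lee_fin mulr_ge0.
  by rewrite EFinM -Iphi; exact: kern_weight.
rewrite sumEFin lee_fin big_const_seq count_predT iter_addr addr0.
have -> : 2 * w * (B ^+ 2 * (A + D)) *+ size s = w * (size s)%:R * (2 * B ^+ 2 * (A + D)).
  by rewrite -[LHS]mulr_natr; ring.
apply: ler_piMl => //; apply: mulr_ge0; last exact: addr_ge0.
by apply: mulr_ge0 => //; exact: sqr_ge0.
Qed.

End kernel.

Section grids.
Context (R : realType).
Local Notation lam := (@lambda2 R).
Local Notation leb := (@lebesgue_measure R).

Definition grid (e : R) (N M : nat) : seq (R * R) :=
  [seq (i%:R * e, j%:R * e) | i <- index_iota 1 N.+1, j <- index_iota 1 M.+1].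

Lemma big_grid (e : R) N M (f : R * R -> R) :
  \sum_(t <- grid e N M) f t = \sum_(1 <= i < N.+1) \sum_(1 <= j < M.+1) f (i%:R * e, j%:R * e).
Proof. by rewrite /grid big_allpairs_dep. Qed.

Lemma size_grid (e : R) N M : size (grid e N M) = (N * M)%N.
Proof. by rewrite size_allpairs !size_iota !subSS !subn0. Qed.

Definition iter_int (F : R -> R -> R) (a b : R) : R :=
  \int[leb]_(u in `[0, a]) \int[leb]_(v in `[0, b]) F u v.

Lemma iter_int_lip (F : R -> R -> R) K a a' b b' : ucont2 F -> (forall u v, `|F u v| <= K) ->
  0 <= a -> 0 <= b -> 0 <= a' <= 1 -> 0 <= b' <= 1 -> a <= 1 ->
  `|iter_int F a' b' - iter_int F a b| <= K * (`|a' - a| + `|b' - b|).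
Proof.
move=> uF FK a0 b0 /andP[a'0 a'1] /andP[b'0 b'1] a1.
have K0 : 0 <= K by apply: le_trans (FK 0 0).
have c1 u : continuous (F u) by exact: ucont2_continuousr.
have inner_le u b1 : 0 <= b1 -> `|\int[leb]_(v in `[0, b1]) F u v| <= K * b1.
  by move=> b10; have := @le_norm_Rintegral_cc R (F u) 0 b1 K b10 (c1 u) (fun x _ => FK u x); rewrite subr0.
have cG b1 : 0 <= b1 -> continuous (fun u => \int[leb]_(v in `[0, b1]) F u v).
  by move=> b10; exact: ucont2_int_continuous.
have step1 : `|iter_int F a' b' - iter_int F a b'| <= K * `|a' - a|.
  wlog aa : a a' a0 a1 a'0 a'1 / a <= a'.
    move=> H; have [aa|/ltW aa] := leP a a'; first exact: H.
    by rewrite distrC (distrC a'); exact: H.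
  rewrite /iter_int Rintegral_cc_diff//; last exact: cG.
  rewrite (ger0_norm (_ : 0 <= a' - a)) ?subr_ge0//.
  apply: le_norm_Rintegral_cc => //; first exact: cG.
  move=> u _; apply: (le_trans (inner_le u b' b'0)); exact: ler_piMr.
have step2 : `|iter_int F a b' - iter_int F a b| <= K * `|b' - b|.
  rewrite /iter_int -RintegralB//; last 2 first.
  - by apply: continuous_integrable_cc; exact: cG.
  - by apply: continuous_integrable_cc; exact: cG.
  apply: (@le_trans _ _ (K * `|b' - b| * (a - 0))); last first.
    by rewrite subr0 ler_piMr// mulr_ge0.
  apply: le_norm_Rintegral_cc => //.
    by move=> u; apply: cvgB; exact: cG.
  move=> u _.
  wlog bb : b b' b0 b'0 {b'1 step1} / b <= b'.
    move=> H; have [bb|/ltW bb] := leP b b'; first exact: H.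
    by rewrite distrC (distrC b'); exact: H.
  rewrite Rintegral_cc_diff// (ger0_norm (_ : 0 <= b' - b)) ?subr_ge0//.
  exact: le_norm_Rintegral_cc.
by apply: (le_trans (ler_distD (iter_int F a b') _ _)); rewrite mulrDr; exact: lerD.
Qed.

Lemma iter_int_mono (F : R -> R -> R) a a' b b' : ucont2 F -> (forall u v, 0 <= F u v) ->
  0 <= a -> a <= a' -> 0 <= b -> b <= b' -> iter_int F a b <= iter_int F a' b'.
Proof.
move=> uF F0 a0 aa b0 bb.
have c1 u : continuous (F u) by exact: ucont2_continuousr.
have a'0 : 0 <= a' by exact: le_trans aa.
have b'0 : 0 <= b' by exact: le_trans bb.
have cG b1 : 0 <= b1 -> continuous (fun u => \int[leb]_(v in `[0, b1]) F u v).
  by move=> b10; exact: ucont2_int_continuous.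
apply: (@le_trans _ _ (iter_int F a b')).
  apply: le_Rintegral => //.
  - by apply: continuous_integrable_cc; exact: cG.
  - by apply: continuous_integrable_cc; exact: cG.
  move=> u _; rewrite -subr_ge0 Rintegral_cc_diff//.
  by apply: Rintegral_ge0 => v _.
rewrite -subr_ge0 /iter_int Rintegral_cc_diff//; last exact: cG.
by apply: Rintegral_ge0 => u _; apply: Rintegral_ge0 => v _.
Qed.

Lemma iter_int_le_plane (F : R * R -> R) (u : R * R) a b : ucont F -> (forall z, 0 <= F z) ->
  (\int[lam]_z (F z)%:E < +oo)%E -> 0 <= a -> 0 <= b ->
  iter_int (fun s t => F (s - u.1, t - u.2)) a b <= \int[lam]_z F z.
Proof.
move=> uF F0 Ffin a0 b0.
pose G (z : R * R) := F (z.1 - u.1, z.2 - u.2).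
have uG : ucont G.
  move=> k /uF[d d0 dF]; exists d => // z y h1 h2; apply: dF => /=.
    by rewrite opprB addrA subrK.
  by rewrite opprB addrA subrK.
have mG : measurable_fun setT (G : plane R -> R).
  by apply: continuous_measurable_plane; exact: ucont_continuous.
have uG2 := ucont_curry uG.
have cG s : continuous (fun t => G (s, t)) by have := @ucont2_continuousr R _ s uG2.
have finE : ((\int[lam]_z F z)%:E = \int[lam]_z (F z)%:E)%E.
  by rewrite /Rintegral fineK// ge0_fin_numE// integral_ge0// => z _; rewrite lee_fin.
rewrite -lee_fin finE {finE}.
have -> : (\int[lam]_z (F z)%:E = \int[lam]_z (G z)%:E)%E.
  have mF : measurable_fun setT (fun z : plane R => (F z)%:E).
    by apply/measurable_EFinP; apply: continuous_measurable_plane; exact: ucont_continuous.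
  have F0' (z : plane R) : (0 <= (F z)%:E)%E by rewrite lee_fin.
  rewrite -(ge0_integral_flip2 (- u.1, - u.2) mF F0').
  have mF' : measurable_fun setT (fun z : plane R => (F (flip2 (- u.1, - u.2) z))%:E).
    exact: (measurableT_comp mF (measurable_flip2 _)).
  have F0'' (z : plane R) : (0 <= (F (flip2 (- u.1, - u.2) z))%:E)%E by rewrite lee_fin.
  rewrite -(ge0_integral_flip2 (0, 0) mF' F0'').
  by apply: eq_integral => z _; rewrite /G /flip2 /flip/=; congr ((F (_, _))%:E); ring.
have icc (f : R -> R) (c : R) : continuous f -> (\int[leb]_(t in `[0%R, c]) (f t)%:E =
    (\int[leb]_(t in `[0%R, c]) f t)%:E)%E.
  move=> cf; rewrite /Rintegral fineK//; apply: integrable_fin_num => //.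
  exact: continuous_integrable_cc.
rewrite /iter_int -icc; last exact: (ucont2_int_continuous uG2).
have mGE : measurable_fun setT (fun z : plane R => (G z)%:E) by exact/measurable_EFinP.
have GE0 (z : plane R) : (0 <= (G z)%:E)%E by rewrite lee_fin; exact: F0.
have tonelli := @fubini_tonelli1 _ _ (measurableTypeR R) (measurableTypeR R) R leb leb _ mGE GE0; rewrite [X in (_ <= X)%E]tonelli {tonelli}.
have mfub : measurable_fun setT (fubini_F leb (fun z : plane R => (G z)%:E)).
  exact: measurable_fun_fubini_tonelli_F.
have fub0 s : (0 <= fubini_F leb (fun z : plane R => (G z)%:E) s)%E.
  by apply: integral_ge0 => t _; rewrite lee_fin; exact: F0.
apply: (@le_trans _ _ (\int[leb]_(s in `[0%R, a]) fubini_F leb (fun z : plane R => (G z)%:E) s)%E); last first.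
  by apply: ge0_subset_integral.
apply: ge0_le_integral => //.
- by move=> s _; rewrite lee_fin; apply: Rintegral_ge0 => t _; exact: F0.
- apply/measurable_EFinP; apply: measurable_funTS; apply: continuous_measurable_fun.
  exact: (ucont2_int_continuous uG2).
- exact: measurable_funTS.
move=> s _; rewrite -icc; last exact: cG.
apply: ge0_subset_integral => //.
  by apply/measurable_EFinP; exact: (continuous_measurable_fun (cG s)).
by move=> t _; rewrite lee_fin; exact: F0.
Qed.

Lemma grid_sum_le (F : R * R -> R) (u : R * R) e k N M : ucont F -> (forall z, 0 <= F z) ->
  (\int[lam]_z (F z)%:E < +oo)%E -> 0 < e -> N%:R * e <= 1 -> M%:R * e <= 1 ->
  (forall z y : R * R, `|z.1 - y.1| <= e -> `|z.2 - y.2| <= e -> `|F z - F y| <= k) ->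
  e ^+ 2 * (\sum_(t <- grid e N M) F (t.1 - u.1, t.2 - u.2)) <= \int[lam]_z F z + 2 * k.
Proof.
move=> uF F0 Ffin e0 N1 M1 Fk.
have k0 : 0 <= k.
  by apply: le_trans (Fk (0, 0) (0, 0) _ _) => //=; rewrite subrr normr0 ltW.
have uG : ucont2 (fun s t => F (s - u.1, t - u.2)).
  move=> k' /uF[d d0 dF]; exists d => // z y z' y' h1 h2; apply: dF => /=;
    by rewrite opprB addrA subrK.
have N0 : 0 <= N%:R * e by rewrite mulr_ge0// ltW.
have M0 : 0 <= M%:R * e by rewrite mulr_ge0// ltW.
have Fk' s t s' t' : `|s - s'| <= e -> `|t - t'| <= e ->
    `|F (s - u.1, t - u.2) - F (s' - u.1, t' - u.2)| <= k.
  by move=> h1 h2; apply: Fk => /=; rewrite opprB addrA subrK.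
rewrite big_grid; have := riemann2 N M uG e0 Fk'; rewrite ler_distl => /andP[_ H].
have h1 : iter_int (fun s t => F (s - u.1, t - u.2)) (N%:R * e) (M%:R * e) <= \int[lam]_z F z.
  exact: iter_int_le_plane.
have h2 : N%:R * e * (M%:R * e) * k <= k by rewrite ler_piMl// mulr_ile1.
by apply: (le_trans H); apply: lerD => //; rewrite ler_pM2l.
Qed.

End grids.

Lemma chain_dist (R : realFieldType) (a b c d k C : R) : `|a - b| <= k -> `|b - c| <= 2 * k ->
  `|d - c| <= C * (k + k) -> 0 <= k -> `|a - d| <= k * (3 + 2 * C + 1).
Proof.
have -> : C * (k + k) = 2 * (k * C) by ring.
have -> : k * (3 + 2 * C + 1) = 4 * k + 2 * (k * C) by ring.
rewrite !ler_norml => /andP[? ?] /andP[? ?] /andP[? ?] ?; apply/andP; split; lra.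
Qed.

Section asymptotics.
Context (R : realType) (g : {mfun plane R >-> R}).
Hypothesis gsupp : ess_supp g `<=` unit_square.
Variable pi : probability (plane R) R.
Hypothesis pi0 : lambda2 (msupp pi) = 0%E.
Hypothesis piw : weak_cvg (concentration_measure g) pi.
Local Notation lam := (@lambda2 R).
Local Notation K := (msupp pi).

Lemma msupp_unit : K `<=` unit_square.
Proof.
move=> z; apply; split; first exact: unit_square_closed.
have mus : measurable (@unit_square R) by exact: closed_measurable_plane (@unit_square_closed R).
have := probability_setC pi mus; rewrite (limit_unit_square gsupp piw).
have := probability_le1 pi mus; have := measure_ge0 pi unit_square.
case: (pi unit_square) => // r _ _ /esym/eqP.
by rewrite -EFinB eqe subr_eq0 => /eqP <-.
Qed.

Lemma msupp_neq0 : (K : set (R * R)) !=set0.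
Proof.
apply/set0P/negP => /eqP K0; have := msupp_full pi; rewrite K0 setC0 probability_setT.
by move=> /eqP; rewrite eqe oner_eq0.
Qed.

Local Notation tent := (tent K).

Lemma tent_ucont m : ucont (tent m).
Proof.
move=> k k0; exists (k / m.+1%:R); first by rewrite divr_gt0.
move=> z y h1 h2; apply: (le_trans (tent_lip msupp_neq0 m z y)).
rewrite mulrC -ler_pdivlMr// /Num.norm/= ge_max; apply/andP; split; exact: ltW.
Qed.

Lemma tent_modulus m (e : R) (z y : R * R) : `|z.1 - y.1| <= e -> `|z.2 - y.2| <= e ->
  `|tent m z - tent m y| <= m.+1%:R * e.
Proof.
move=> h1 h2; apply: (le_trans (tent_lip msupp_neq0 m z y)).
by rewrite ler_pM2l// /Num.norm/= ge_max; apply/andP.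
Qed.

Definition hull : set (plane R) := `[(-1)%R, 2%R]%classic `*` `[(-1)%R, 2%R]%classic.

Lemma hull_fin : (lam hull < +oo)%E.
Proof.
rewrite /lambda2 /hull [X in (X < _)%E]product_measure1E//=.
by rewrite !lebesgue_measure_itv/= lte_fin; case: ifPn => _; rewrite -?EFinB -?EFinM ?mule0 ltry.
Qed.

Lemma measurable_hull : measurable hull.
Proof. by apply: measurableX; exact: measurable_itv. Qed.

Lemma tent_hull m z : tent m z <= \1_hull z.
Proof.
rewrite indicE; have [|] := boolP (z \in hull).
  by rewrite /=; move=> _; exact: tent_le1 msupp_neq0 _ _.
rewrite notin_setE => nz; rewrite /= /tent ge_max lexx/= subr_le0.
have d1 : 1 <= dist_to K z.
  apply: lb_le_inf; first by have [k Kk] := msupp_neq0; exists `|z - k|; exists k.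
  move=> _ [k Kk <-]; have [] := msupp_unit Kk.
  rewrite /= !in_itv/= => /andP[a1 a2] /andP[b1 b2].
  rewrite leNgt; apply/negP; rewrite /Num.norm/= gt_max !ltr_norml => /andP[/andP[c1 c2] /andP[c3 c4]].
  by apply: nz; split; rewrite /= in_itv/=; lra.
by rewrite (le_trans d1)// ler_peMl ?ler1n// (le_trans _ d1).
Qed.

Lemma measurable_tent m : measurable_fun setT (fun z : plane R => (tent m z)%:E).
Proof.
apply/measurable_EFinP; apply: continuous_measurable_plane; apply: ucont_continuous.
exact: tent_ucont.
Qed.

Lemma tent_fin m : (\int[lam]_z (tent m z)%:E < +oo)%E.
Proof.
apply: (@le_lt_trans _ _ (\int[lam]_z (\1_hull z)%:E)%E).
  apply: ge0_le_integral => //.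
  - by move=> z _; rewrite lee_fin tent_ge0.
  - exact: measurable_tent.
  - by apply/measurable_EFinP; apply: measurable_indic; exact: measurable_hull.
  - by move=> z _; rewrite lee_fin; exact: tent_hull.
by rewrite integral_indic ?setIT ?hull_fin//; exact: measurable_hull.
Qed.

Lemma tent_integral_cvg0 : \int[lam]_z tent m z @[m --> \oo] --> (0 : R).
Proof.
have mK : measurable (K : set (plane R)) by apply: closed_measurable_plane; exact: msupp_closed.
have mh := measurable_hull.
have d1 n : measurable_fun setT (fun z : plane R => (tent n z)%:E) by exact: measurable_tent.
have d2 : measurable_fun setT (fun z : plane R => (\1_(K : set (plane R)) z : R)%:E).
  by apply/measurable_EFinP; exact: measurable_indic.
have d3 : {ae lam, forall z : plane R, setT z -> (tent m z)%:E @[m --> \oo] --> ((\1_(K : set (plane R)) z : R)%:E : \bar R)}.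
  apply: aeW => z _; rewrite indicE; have [|] := boolP (z \in (K : set (plane R))).
    by rewrite inE => Kz; apply: cvg_near_cst; apply: nearW => m; rewrite tent1//; exact: msupp_neq0.
  rewrite notin_setE => nz; apply: cvg_EFin; first exact: nearW.
  by apply: tent_cvg => //; [exact: msupp_neq0|exact: msupp_closed].
have d4 : lam.-integrable setT (fun z : plane R => (\1_hull z : R)%:E).
  apply/integrableP; split; first by apply/measurable_EFinP; exact: measurable_indic.
  under eq_integral do rewrite gee0_abs ?lee_fin//.
  by rewrite integral_indic// setIT hull_fin.
have d5 : {ae lam, forall (z : plane R) n, setT z -> (`|(tent n z)%:E| <= (\1_hull z)%:E)%E}.
  apply: aeW => z n _; rewrite gee0_abs ?lee_fin; first exact: tent_hull.
  exact: tent_ge0.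
have [_ _] := dominated_convergence measurableT d1 d2 d3 d4 d5.
have -> : (\int[lam]_z (\1_(K : set (plane R)) z : R)%:E = 0)%E.
  by rewrite integral_indic// setIT; exact: pi0.
by move=> /fine_cvgP[_].
Qed.

Lemma tent_complement m : \int[pi]_z (1 - tent m z) = 0.
Proof.
have mK : measurable (K : set (plane R)) by apply: closed_measurable_plane; exact: msupp_closed.
rewrite /Rintegral (_ : (\int[pi]_z (1 - tent m z)%:E)%E = 0%E)//.
rewrite -[RHS](@integral0 _ _ _ pi setT); apply: ae_eq_integral => //.
  apply/measurable_EFinP; apply: measurable_funB => //.
  by apply/measurable_EFinP; exact: measurable_tent.
exists (~` K); split; [exact: measurableC|exact: msupp_full|].
move=> z /= hz Kz; apply: hz => _; rewrite tent1 ?subrr//; exact: msupp_neq0.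
Qed.

Variable x : vol_path R.
Variable B : R.
Hypothesis B0 : 0 < B.
Hypothesis xB : forall z, 0 <= x z <= B.
Variable e_ : nat -> R.
Hypothesis e_pos : \forall n \near \oo, 0 < e_ n.
Hypothesis e_cvg : e_ n @[n --> \oo] --> 0.

Lemma covariance_vanishes (k : R) : 0 < k -> \forall n \near \oo, forall N M : nat,
  N%:R * e_ n <= 1 -> M%:R * e_ n <= 1 ->
  (e_ n ^+ 2) ^+ 2 * (\sum_(t <- grid (e_ n) N M) \sum_(t' <- grid (e_ n) N M)
    `|inner lam (kern g x n t) (kern g x n t')|) <= k.
Proof.
move=> k0; pose h := k / (6 * B ^+ 2).
have B20 : 0 < B ^+ 2 by rewrite exprn_gt0.
have h0 : 0 < h by rewrite divr_gt0// mulr_gt0.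
have /cvgrPdist_le /(_ _ h0) [m0 _ Hm0] := tent_integral_cvg0.
pose m := m0; have Im : \int[lam]_z tent m z <= h.
  have := Hm0 m (leqnn _); rewrite sub0r normrN; exact: le_trans (ler_norm _).
have b01 z : 0 <= tent m z <= 1.
  by rewrite tent_ge0 tent_le1//; exact: msupp_neq0.
have cb1 : continuous (fun z => 1 - tent m z).
  by move=> z; apply: cvgB; [exact: cvg_cst|exact: ucont_continuous (tent_ucont m) z].
have bb1 : bounded_fun (fun z => 1 - tent m z).
  exists 1; split; rewrite ?num_real// => M M1 z _ /=.
  by have /andP[a b] := b01 z; rewrite ger0_norm; lra.
have /cvgrPdist_le /(_ _ h0) Dn := weak_cvgR piw cb1 bb1.
have h20 : 0 < h / 2 / m.+1%:R by apply: divr_gt0 => //; apply: divr_gt0.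
have /cvgrPdist_le /(_ _ h20) en := e_cvg.
near=> n => N M N1 M1.
have gn : good_index g n by near: n; exact: (good_near piw).
have e0 : 0 < e_ n by near: n.
have D : \int[concentration_measure g n]_z (1 - tent m z) <= h.
  have : `|\int[pi]_z (1 - tent m z) - \int[concentration_measure g n]_z (1 - tent m z)| <= h by near: n.
  by rewrite tent_complement sub0r normrN; exact: le_trans (ler_norm _).
have me : m.+1%:R * e_ n <= h / 2.
  have : `|0 - e_ n| <= h / 2 / m.+1%:R by near: n.
  by rewrite sub0r normrN gtr0_norm// ler_pdivlMr// [e_ n * _]mulrC.
have A u : e_ n ^+ 2 * (\sum_(t <- grid (e_ n) N M) tent m (t.1 - u.1, t.2 - u.2)) <= 2 * h.
  have := @grid_sum_le R (tent m) u (e_ n) (h / 2) N M (tent_ucont m) (tent_ge0 K m) (tent_fin m) e0 N1 M1.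
  move=> H; apply: (le_trans (H _)); last by move: Im; lra.
  by move=> z y h1 h2; apply: le_trans me; exact: tent_modulus.
have sz : e_ n ^+ 2 * (size (grid (e_ n) N M))%:R <= 1.
  rewrite size_grid natrM (_ : _ * _ = (N%:R * e_ n) * (M%:R * e_ n)); last by ring.
  by rewrite mulr_ile1 ?mulr_ge0// ltW.
have := kern_covariance_sum B0 xB gn (sqr_ge0 (e_ n)) sz (ucont_continuous (tent_ucont m)) b01 A.
move=> /le_trans; apply.
have -> : k = 2 * B ^+ 2 * (3 * h) by rewrite /h; field; rewrite gt_eqF.
by apply: ler_wpM2l; [rewrite mulr_ge0// ltW|move: D; lra].
Unshelve. all: by end_near. Qed.

Definition limit_density (p : R) (u v : R) : R := convol pi (ext2 x) (u, v) `^ (p / 2).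

Lemma pi_mass : pi setT = 1%E. Proof. exact: probability_setT. Qed.

Lemma limit_convol_bound t : 0 <= convol pi (ext2 x) t <= B ^+ 2.
Proof. exact: (convol_bound t pi_mass (ext2_bound (ltW B0) xB) (ext2_ucont x)). Qed.

Lemma limit_density_bound (p u v : R) : 0 < p -> 0 <= limit_density p u v <= (B ^+ 2) `^ (p / 2).
Proof.
move=> p0; have /andP[a b] := limit_convol_bound (u, v); rewrite powR_ge0/=.
by apply: ge0_ler_powR => //; rewrite ?nnegrE ?sqr_ge0// divr_ge0// ltW.
Qed.

Lemma limit_density_ucont (p : R) : 0 < p -> ucont2 (limit_density p).
Proof.
move=> p0 k k0; have p20 : 0 < p / 2 by rewrite divr_gt0.
have [d d0 Hd] := powR_ucont p20 (sqr_ge0 B) k0; have d20 : 0 < d / 2 by lra.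
have [r r0 Hr] := convol_ucont pi_mass (ext2_bound (ltW B0) xB) (ext2_ucont x) d20.
exists r => // u v u' v' h1 h2; apply: Hd; try exact: limit_convol_bound.
by apply: (@le_lt_trans _ _ (d / 2)); [exact: Hr|lra].
Qed.

Lemma means_cvg (p k : R) : 0 < p -> 0 < k -> \forall n \near \oo, forall (s t : R) (N M : nat),
  0 <= s <= 1 -> 0 <= t <= 1 -> n%:R^-1 <= e_ n ->
  N%:R * e_ n <= s -> s <= N.+1%:R * e_ n -> M%:R * e_ n <= t -> t <= M.+1%:R * e_ n ->
  `|e_ n ^+ 2 * (\sum_(z <- grid (e_ n) N M) inner lam (kern g x n z) (kern g x n z) `^ (p / 2))
    - iter_int (limit_density p) s t| <= k.
Proof.
move=> p0 k0; have p20 : 0 < p / 2 by rewrite divr_gt0.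
pose C := (B ^+ 2) `^ (p / 2).
have C0 : 0 <= C by exact: powR_ge0.
pose k' := k / (3 + 2 * C + 1).
have k'0 : 0 < k' by rewrite divr_gt0//; lra.
have [d d0 Hd] := powR_ucont p20 (sqr_ge0 B) k'0; have d20 : 0 < d / 2 by lra.
have [r r0 Hr] := limit_density_ucont p0 k'0.
have mass1 : \forall n \near \oo, concentration_measure g n setT = 1%E.
  by apply: filterS (good_near piw) => n; exact: concentration_mass.
have unif := convol_cvg_unif (mu := fun n => concentration_measure g n) pi_mass mass1
  (ext2_bound (ltW B0) xB) (ext2_ucont x) (weak_cvgR piw) d20.
have rk0 : 0 < Num.min r k' by rewrite lt_min r0.
have /cvgrPdist_lt /(_ _ rk0) en := e_cvg.
near=> n => s t N M /andP[s0 s1] /andP[t0 t1] ne Ns sN Mt tM.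
have gn : good_index g n by near: n; exact: (good_near piw).
have e0 : 0 < e_ n by near: n.
have : `|0 - e_ n| < Num.min r k' by near: n.
rewrite sub0r normrN gtr0_norm// lt_min => /andP[er ek].
have N0 : 0 <= N%:R * e_ n by rewrite mulr_ge0// ltW.
have M0 : 0 <= M%:R * e_ n by rewrite mulr_ge0// ltW.
have N1 : N%:R * e_ n <= 1 by exact: le_trans s1.
have M1 : M%:R * e_ n <= 1 by exact: le_trans t1.
have NM1 : 0 <= N%:R * e_ n * (M%:R * e_ n) <= 1 by rewrite mulr_ge0//= mulr_ile1.
have un : forall z : R * R, 0 <= z.1 <= 1 -> 0 <= z.2 <= 1 ->
    `|convol (concentration_measure g n) (ext2 x) z - convol pi (ext2 x) z| <= d / 2 by near: n.
have term i j : (1 <= i < N.+1)%N -> (1 <= j < M.+1)%N ->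
    `|inner lam (kern g x n (i%:R * e_ n, j%:R * e_ n)) (kern g x n (i%:R * e_ n, j%:R * e_ n)) `^ (p / 2)
      - limit_density p (i%:R * e_ n) (j%:R * e_ n)| <= k'.
  move=> /andP[i1 iN] /andP[j1 jM].
  have bnd (a Q : nat) : (1 <= a)%N -> (a < Q.+1)%N -> Q%:R * e_ n <= 1 -> n%:R^-1 <= a%:R * e_ n <= 1.
    move=> a1 aQ Q1; apply/andP; split.
      by apply: (le_trans ne); rewrite ler_peMl ?ler1n// ltW.
    by apply: le_trans Q1; rewrite ler_pM2r// ler_nat.
  have bi := bnd i N i1 iN N1; have bj := bnd j M j1 jM M1.
  have sk := kern_sqint B0 xB (i%:R * e_ n, j%:R * e_ n) gn.
  have := kern_norm gsupp B0 xB gn (t := (i%:R * e_ n, j%:R * e_ n)) bi bj.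
  rewrite innerxx// => -[->].
  have n0 : 0 <= n%:R^-1 :> R by rewrite invr_ge0.
  have bi0 : 0 <= i%:R * e_ n <= 1 by move: bi; lra.
  have bj0 : 0 <= j%:R * e_ n <= 1 by move: bj; lra.
  apply: Hd.
  - exact: (convol_bound _ (concentration_mass gn) (ext2_bound (ltW B0) xB) (ext2_ucont x)).
  - exact: limit_convol_bound.
  - by apply: (@le_lt_trans _ _ (d / 2)); [exact: un|lra].
pose S2 := e_ n ^+ 2 * (\sum_(1 <= i < N.+1) \sum_(1 <= j < M.+1) limit_density p (i%:R * e_ n) (j%:R * e_ n)).
have h1 : `|e_ n ^+ 2 * (\sum_(z <- grid (e_ n) N M) inner lam (kern g x n z) (kern g x n z) `^ (p / 2)) - S2| <= k'.
  rewrite big_grid -mulrBr normrM (ger0_norm (sqr_ge0 _)) -sumrB.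
  apply: (@le_trans _ _ (e_ n ^+ 2 * (\sum_(1 <= i < N.+1) \sum_(1 <= j < M.+1) k'))).
    rewrite ler_wpM2l ?sqr_ge0//; apply: (le_trans (ler_norm_sum _ _ _)).
    rewrite big_nat [leRHS]big_nat; apply: ler_sum => i iN; rewrite -sumrB.
    apply: (le_trans (ler_norm_sum _ _ _)).
    by rewrite big_nat [leRHS]big_nat; apply: ler_sum => j jM; exact: term.
  rewrite !sumr_const_nat !subSS !subn0.
  have -> : e_ n ^+ 2 * (k' *+ M *+ N) = N%:R * e_ n * (M%:R * e_ n) * k'.
    by rewrite -[k' *+ M]mulr_natl -[X in _ * X]mulr_natl; ring.
  by rewrite ler_piMl ?(ltW k'0)//; case/andP: NM1.
have h2 : `|S2 - iter_int (limit_density p) (N%:R * e_ n) (M%:R * e_ n)| <= 2 * k'.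
  apply: (@le_trans _ _ (2 * ((N%:R * e_ n) * (M%:R * e_ n) * k'))).
    apply: riemann2 => //; first exact: limit_density_ucont.
    by move=> u v u' v' a b; apply: Hr; [exact: le_lt_trans er|exact: le_lt_trans er].
  by rewrite ler_pM2l// ler_piMl ?(ltW k'0)//; case/andP: NM1.
have LB u v : `|limit_density p u v| <= C.
  by have /andP[a b] := limit_density_bound u v p0; rewrite ger0_norm.
have h3 : `|iter_int (limit_density p) s t - iter_int (limit_density p) (N%:R * e_ n) (M%:R * e_ n)| <= C * (k' + k').
  apply: (le_trans (iter_int_lip (limit_density_ucont p0) LB N0 M0 _ _ N1)); rewrite ?s0 ?t0//.
  rewrite ler_wpM2l//; apply: lerD; (rewrite ger0_norm ?subr_ge0//; apply: le_trans (ltW ek)).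
    by rewrite lerBlDr (le_trans sN)// -natr1 mulrDl mul1r addrC.
  by rewrite lerBlDr (le_trans tM)// -natr1 mulrDl mul1r addrC.
have -> : k = k' * (3 + 2 * C + 1) by rewrite /k' mulfVK// gt_eqF//; lra.
exact: chain_dist h1 h2 h3 (ltW k'0).
Unshelve. all: by end_near. Qed.

End asymptotics.

Section weak_law_on_support.
Context d (T : measurableType d) (R : realType) (P : probability T R).
Variable W : set (plane R) -> T -> R.
Hypothesis hW : white_noise P W.
Local Notation lam := (@lambda2 R).

Lemma noise_abs_powR_lln_in (p V e : R) : 0 < p -> 0 <= V -> 0 < e -> exists2 t, 0 < t &
  forall (I : eqType) (s : seq I) (w : R) (A : I -> T -> R) (H : I -> plane R -> R),
  0 <= w -> w * (size s)%:R <= 1 ->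
  (forall i, i \in s -> noise_limit P W (H i) (A i)) ->
  (forall i, i \in s -> inner lam (H i) (H i) <= V) ->
  w ^+ 2 * (\sum_(i <- s) \sum_(j <- s) `|inner lam (H i) (H j)|) <= t ->
  (\int[P]_x `|\sum_(i <- s) w * (`|A i x| `^ p -
     normal_abs_moment p * inner lam (H i) (H i) `^ (p / 2))|%:E <= e%:E)%E.
Proof.
move=> p0 V0 e0; have [t t0 Ht] := noise_abs_powR_lln hW p0 V0 e0; exists t => // I s w A H w0 ws.
case: s ws => [|i0 s'] ws nA iV Hs.
  under eq_integral do rewrite big_nil normr0.
  by rewrite integral0 lee_fin ltW.
set s := i0 :: s' in ws nA iV Hs *; have i0s : i0 \in s by rewrite mem_head.
pose r i := if i \in s then i else i0.
have rs i : r i \in s by rewrite /r; case: ifP.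
have rE i : i \in s -> r i = i by rewrite /r => ->.
have := Ht I s w (fun i => A (r i)) (fun i => H (r i)) w0 ws (fun i => nA _ (rs i)) (fun i => iV _ (rs i)).
rewrite (_ : w ^+ 2 * _ = w ^+ 2 * (\sum_(i <- s) \sum_(j <- s) `|inner lam (H i) (H j)|)).
  move=> /(_ Hs); apply: le_trans; rewrite le_eqVlt; apply/orP; left; apply/eqP.
  suff sE x : \sum_(i <- s) w * (`|A (r i) x| `^ p - normal_abs_moment p * inner lam (H (r i)) (H (r i)) `^ (p / 2)) =
      \sum_(i <- s) w * (`|A i x| `^ p - normal_abs_moment p * inner lam (H i) (H i) `^ (p / 2)).
    by apply: eq_integral => x _; rewrite sE.
  by rewrite big_seq [RHS]big_seq; apply: eq_bigr => i /rE ->.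
congr (_ * _); rewrite big_seq [RHS]big_seq; apply: eq_bigr => i /rE ->.
by rewrite big_seq [RHS]big_seq; apply: eq_bigr => j /rE ->.
Qed.

Lemma markov_abs (S : T -> R) (a b : R) : measurable_fun setT S -> 0 < a ->
  (\int[P]_w `|S w|%:E <= (b * a)%:E)%E -> (P [set w | (a <= `|S w|)%R] <= b%:E)%E.
Proof.
move=> mS a0 Sb; have mE : measurable [set w | a <= `|S w|].
  rewrite (_ : [set w | _] = (fun w => `|S w|) @^-1` `[a, +oo[%classic).
    rewrite -[X in measurable X]setTI; apply: (measurableT_comp (@normr_measurable R setT) mS) => //.
  by apply/seteqP; split => w /=; rewrite in_itv/= andbT.
rewrite -(@lee_pmul2l _ a%:E)// -EFinM [a * b]mulrC; apply: le_trans Sb.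
rewrite -integral_cst//.
have mn : measurable_fun setT (fun w => `|S w|%:E).
  by apply/measurable_EFinP; exact: (measurableT_comp (@normr_measurable R setT) mS).
apply: (@le_trans _ _ (\int[P]_(w in [set w | (a <= `|S w|)%R]) `|S w|%:E)%E).
  by apply: ge0_le_integral => //; [move=> w _; rewrite lee_fin ltW|exact: measurable_funTS].
by apply: ge0_subset_integral.
Qed.

Lemma ae_seq (I : eqType) (s : seq I) (Q : I -> T -> Prop) :
  (forall i, i \in s -> \forall w \ae P, Q i w) -> \forall w \ae P, forall i, i \in s -> Q i w.
Proof.
case: s => [|i0 s'] Qs; first by apply: aeW.
set s := i0 :: s' in Qs *.
have : \forall w \ae P, forall m : nat, (m < size s)%N -> Q (nth i0 s m) w.
  apply: ae_foralln => m; have [ms|ms] := boolP (m < size s)%N.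
    by apply: filterS (Qs _ (mem_nth i0 ms)) => w.
  exact: aeW.
by apply: filterS => w Hw i /(nthP i0)[m ms <-]; exact: Hw.
Qed.

End weak_law_on_support.

Definition unit_increment (R : realType) (T : Type) (Yx : R * R -> T -> R) n (t : R * R) (w : T) : R :=
  increment Yx (t.1 - n%:R^-1) t.1 (t.2 - n%:R^-1) t.2 w.

Section path_increments.
Context d (T : measurableType d) (R : realType) (P : probability T R).
Variable W : set (plane R) -> T -> R.
Hypothesis hW : white_noise P W.
Variables (g : {mfun plane R >-> R}) (x : vol_path R) (Yx : R * R -> T -> R).
Local Notation lam := (@lambda2 R).

Definition wiener_value (z : R * R) := exists X : T -> R,
  wiener_integral P W (fun u => g (z.1 - u.1, z.2 - u.2) * x u) X /\
  \forall w \ae P, Yx z w = X w.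

Lemma wiener_value_noise z : wiener_value z -> exists X : T -> R,
  noise_limit P W (fun u => g (z.1 - u.1, z.2 - u.2) * x u) X /\ \forall w \ae P, Yx z w = X w.
Proof.
move=> [X [wX aX]]; exists X; split => //; apply: wiener_noise_limit wX.
  apply: measurable_funM; last exact: measurable_path.
  exact: (measurable_flip_fun z (measurable_funP g)).
by move=> u nu; rewrite path_out// mulr0.
Qed.

Lemma increment_noise n t : wiener_value t -> wiener_value (t.1 - n%:R^-1, t.2) ->
  wiener_value (t.1, t.2 - n%:R^-1) -> wiener_value (t.1 - n%:R^-1, t.2 - n%:R^-1) ->
  exists A : T -> R, noise_limit P W (kern g x n t) A /\
    \forall w \ae P, unit_increment Yx n t w / Num.sqrt (g_mass g n) = A w.
Proof.
move=> /wiener_value_noise[X1 [n1 a1]] /wiener_value_noise[X2 [n2 a2]].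
move=> /wiener_value_noise[X3 [n3 a3]] /wiener_value_noise[X4 [n4 a4]].
set q := (Num.sqrt (g_mass g n))^-1.
have N := noise_limitD hW 1 1 (noise_limitD hW q (- q) n1 n2) (noise_limitD hW (- q) q n3 n4).
eexists; split.
  rewrite (_ : kern g x n t = (fun u => 1 * (q * (g (t.1 - u.1, t.2 - u.2) * x u) +
    - q * (g (t.1 - n%:R^-1 - u.1, t.2 - u.2) * x u)) + 1 * (- q * (g (t.1 - u.1, t.2 - n%:R^-1 - u.2) * x u)
     + q * (g (t.1 - n%:R^-1 - u.1, t.2 - n%:R^-1 - u.2) * x u)))); first exact: N.
  apply/funext => u; rewrite /kern /g_incr -/q /=.
  rewrite ![_ - u.1 - _]addrAC ![_ - u.2 - _]addrAC.
  by ring.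
apply: filterS2 (filterI a1 a2) (filterI a3 a4) => w [e1 e2] [e3 e4].
rewrite /unit_increment /increment -e2 -e3 -e4 -/q /=.
have -> : Yx (t.1, t.2) w = X1 w by rewrite -e1 -surjective_pairing.
by ring.
Qed.

End path_increments.

Section normalized_variation.
Context (R : realType) (T : Type) (g : {mfun plane R >-> R}) (Yx : R * R -> T -> R).
Variables (p : R) (k : nat -> nat).

Definition normalized_variation n (w : T) (z : R * R) : R :=
  ((k n)%:R / n%:R) ^+ 2 / (g_mass g n) `^ (p / 2) * power_variation p Yx (k n) n w z.

Lemma powR_div_sqrt (a c : R) : 0 < c -> (`|a / Num.sqrt c| `^ p) = `|a| `^ p / c `^ (p / 2).
Proof.
move=> c0; have s0 : 0 < Num.sqrt c by rewrite sqrtr_gt0.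
rewrite normrM powRM// (_ : `|(Num.sqrt c)^-1| = (Num.sqrt c)^-1); last first.
  by rewrite ger0_norm// invr_ge0 ltW.
congr (_ * _); rewrite -(powR12_sqrt (ltW c0)) -[(c `^ 2^-1)^-1]powRN -powRrM -powRN.
by congr (_ `^ _); rewrite mulNr mulrC.
Qed.

Lemma normalized_variation_grid n w z : (0 < n)%N -> 0 < g_mass g n ->
  normalized_variation n w z =
  \sum_(t <- grid ((k n)%:R / n%:R) (Num.truncn (n%:R * z.1 / (k n)%:R)) (Num.truncn (n%:R * z.2 / (k n)%:R)))
    ((k n)%:R / n%:R) ^+ 2 * (`|unit_increment Yx n t w / Num.sqrt (g_mass g n)| `^ p).
Proof.
move=> n0 c0; have n0' : n%:R != 0 :> R by rewrite pnatr_eq0 -lt0n.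
have eqm (i : nat) : ((k n * i)%:R - 1) / n%:R = i%:R * ((k n)%:R / n%:R) - n%:R^-1 :> R.
  by rewrite natrM; field.
have eqi (i : nat) : (k n * i)%:R / n%:R = i%:R * ((k n)%:R / n%:R) :> R.
  by rewrite natrM; field.
rewrite big_grid /normalized_variation /power_variation mulr_sumr; apply: eq_bigr => i _.
rewrite mulr_sumr; apply: eq_bigr => j _; rewrite powR_div_sqrt// /unit_increment/= !eqm !eqi.
by rewrite mulrAC -mulrA.
Qed.

End normalized_variation.

Section path_convergence.
Context d (T : measurableType d) (R : realType) (P : probability T R).
Variable W : set (plane R) -> T -> R.
Hypothesis hW : white_noise P W.
Variable g : {mfun plane R >-> R}.
Hypothesis gsupp : ess_supp g `<=` unit_square.
Variable pi : probability (plane R) R.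
Hypothesis pi0 : lambda2 (msupp pi) = 0%E.
Hypothesis piw : weak_cvg (concentration_measure g) pi.
Variables (x : vol_path R) (Yx : R * R -> T -> R).
Hypothesis hYx : forall n a b : nat, unit_square (a%:R / n%:R, b%:R / n%:R : R) ->
  wiener_value P W g x Yx (a%:R / n%:R, b%:R / n%:R).
Variable k : nat -> nat.
Hypothesis k_gt0 : forall n, (0 < n)%N -> (0 < k n)%N.
Hypothesis k_cvg : ((k n)%:R / n%:R : R) @[n --> \oo] --> (0 : R).
Variable p : R.
Hypothesis p_gt0 : 0 < p.
Local Notation lam := (@lambda2 R).
Local Notation e_ := (fun n => (k n)%:R / n%:R : R).

Lemma mesh_pos : \forall n \near \oo, 0 < e_ n.
Proof.
near=> n; have n0 : (0 < n)%N by near: n; exact: nbhs_infty_gt.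
by rewrite divr_gt0// ltr0n ?k_gt0.
Unshelve. all: by end_near. Qed.

Lemma mesh_truncn n (s : R) : (0 < n)%N -> 0 <= s ->
  (Num.truncn (n%:R * s / (k n)%:R))%:R * e_ n <= s < (Num.truncn (n%:R * s / (k n)%:R)).+1%:R * e_ n.
Proof.
move=> n0 s0; have k0 := k_gt0 n0.
have q0 : 0 <= n%:R * s / (k n)%:R by rewrite divr_ge0// mulr_ge0.
have e0 : 0 < e_ n by rewrite divr_gt0// ltr0n.
have sE : s = n%:R * s / (k n)%:R * e_ n.
  by field; rewrite !pnatr_eq0 -!lt0n n0.
have /andP[h1 h2] := truncn_itv q0.
by rewrite [X in _ <= X < _]sE ler_pM2r// h1 ltr_pM2r.
Qed.

Lemma grid_increment n (z : R * R) (t : R * R) : (0 < n)%N -> good_index g n -> unit_square z ->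
  t \in grid (e_ n) (Num.truncn (n%:R * z.1 / (k n)%:R)) (Num.truncn (n%:R * z.2 / (k n)%:R)) ->
  exists A : T -> R, noise_limit P W (kern g x n t) A /\
    \forall w \ae P, unit_increment Yx n t w / Num.sqrt (g_mass g n) = A w.
Proof.
move=> n0 gn [/=]; rewrite !in_itv/= => /andP[z10 z11] /andP[z20 z21] tg.
have k0 := k_gt0 n0; have n0' : 0 < n%:R :> R by rewrite ltr0n.
have e0 : 0 < e_ n by rewrite divr_gt0// ltr0n.
have /allpairsP[[i j] /= [+ + ->]] := tg.
rewrite !mem_index_iota !ltnS => /andP[i1 iN] /andP[j1 jM].
pose r (a : nat) : R := a%:R / n%:R.
have r0 a : 0 <= r a by rewrite divr_ge0.
have idx (m : nat) (s : R) : 0 <= s -> s <= 1 -> (1 <= m)%N -> (m <= Num.truncn (n%:R * s / (k n)%:R))%N ->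
    [/\ m%:R * e_ n = r (m * k n)%N, m%:R * e_ n - n%:R^-1 = r (m * k n).-1,
        0 <= r (m * k n)%N <= 1 & 0 <= r (m * k n).-1 <= 1].
  move=> s0 s1 m1 mN; have mk : (0 < m * k n)%N by rewrite muln_gt0 m1 k0.
  have e1 : m%:R * e_ n = r (m * k n)%N by rewrite /r natrM mulrA.
  have u : r (m * k n)%N <= 1.
    rewrite -e1; have /andP[h _] := mesh_truncn n0 s0.
    by apply: le_trans s1; apply: le_trans h; rewrite ler_pM2r// ler_nat.
  split => //; rewrite ?r0 ?u//=.
  - by rewrite e1 /r -[in LHS](prednK mk) -natr1 mulrDl mul1r addrK.
  - by apply: le_trans u; rewrite /r ler_pM2r ?invr_gt0// ler_nat; exact: leq_pred.
have [a1 a2 a3 a4] := idx _ _ z10 z11 i1 iN.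
have [b1 b2 b3 b4] := idx _ _ z20 z21 j1 jM.
by apply: (increment_noise hW) => /=; rewrite ?a2 ?b2 ?a1 ?b1; apply: hYx; split; rewrite /= in_itv.
Qed.

Lemma kern_energy B n t : 0 < B -> (forall z, 0 <= x z <= B) -> good_index g n ->
  inner lam (kern g x n t) (kern g x n t) <= B ^+ 2.
Proof.
move=> B0 xB gn; have [c0 _] := gn.
have := @kern_weight R g x B B0 xB n t (fun=> 1) c0 (measurable_cst _) (fun=> ler01).
under [X in (X <= _)%E -> _]eq_integral do rewrite mulr1.
rewrite innerxx; last exact: (kern_sqint B0 xB t gn).
by rewrite integral_cst//= mul1e [X in (_ * X)%E](concentration_mass gn) mule1 lee_fin.
Qed.

Lemma path_variation_cvg (e del : R) : 0 < e -> 0 < del -> \forall n \near \oo, forall z : R * R,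
  unit_square z -> exists2 E, measurable E /\ (P E <= del%:E)%E &
   forall w, ~ E w -> `|normalized_variation g Yx p k n w z
     - normal_abs_moment p * iter_int (limit_density pi x p) z.1 z.2| <= e.
Proof.
move=> e0 d0; have [B B0 xB] := path_bound x.
set m := normal_abs_moment p; have m0 : 0 <= m.
  by apply: Rintegral_ge0 => y _; exact: powR_ge0.
have e20 : 0 < e / 2 by lra.
have h0 : 0 < e / 2 / (m + 1) by rewrite divr_gt0//; lra.
have de : 0 < del * (e / 2) by rewrite mulr_gt0.
have [t t0 Ht] := noise_abs_powR_lln_in hW p_gt0 (sqr_ge0 B) de.
have C := covariance_vanishes gsupp pi0 piw B0 xB mesh_pos k_cvg t0.
have M := means_cvg gsupp piw B0 xB mesh_pos k_cvg p_gt0 h0.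
have G := good_near piw.
near=> n => z zU.
have n0 : (0 < n)%N by near: n; exact: nbhs_infty_gt.
have gn : good_index g n by near: n.
have [c0 _] := gn; have ep : 0 < e_ n by near: n; exact: mesh_pos.
have k0 := k_gt0 n0.
have [/=] := zU; rewrite !in_itv/= => /andP[z10 z11] /andP[z20 z21].
set N1 := Num.truncn (n%:R * z.1 / (k n)%:R); set N2 := Num.truncn (n%:R * z.2 / (k n)%:R).
have /andP[l1 u1] := mesh_truncn n0 z10; have /andP[l2 u2] := mesh_truncn n0 z20.
rewrite -/N1 -/N2 in l1 u1 l2 u2.
set s := grid (e_ n) N1 N2.
have Cn : (e_ n ^+ 2) ^+ 2 * (\sum_(t <- s) \sum_(t' <- s) `|inner lam (kern g x n t) (kern g x n t')|) <= t.
  have H : forall N M : nat, N%:R * e_ n <= 1 -> M%:R * e_ n <= 1 ->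
    (e_ n ^+ 2) ^+ 2 * (\sum_(t <- grid (e_ n) N M) \sum_(t' <- grid (e_ n) N M)
    `|inner lam (kern g x n t) (kern g x n t')|) <= t by near: n.
  by apply: H; [exact: le_trans z11|exact: le_trans z21].
have Mn : `|e_ n ^+ 2 * (\sum_(y <- s) inner lam (kern g x n y) (kern g x n y) `^ (p / 2))
    - iter_int (limit_density pi x p) z.1 z.2| <= e / 2 / (m + 1).
  have H : forall (s t : R) (N M : nat),
    0 <= s <= 1 -> 0 <= t <= 1 -> n%:R^-1 <= e_ n ->
    N%:R * e_ n <= s -> s <= N.+1%:R * e_ n -> M%:R * e_ n <= t -> t <= M.+1%:R * e_ n ->
    `|e_ n ^+ 2 * (\sum_(z <- grid (e_ n) N M) inner lam (kern g x n z) (kern g x n z) `^ (p / 2))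
    - iter_int (limit_density pi x p) s t| <= e / 2 / (m + 1) by near: n.
  apply: H => //; rewrite ?z10 ?z20//; last by exact: ltW. 
  - by rewrite -[leLHS]mul1r ler_pM2r ?invr_gt0 ?ltr0n// ler1n.
  - exact: ltW.
have /choice[A HA] : forall y : R * R, exists A : T -> R, measurable_fun setT A /\
    (y \in s -> noise_limit P W (kern g x n y) A /\
    \forall w \ae P, unit_increment Yx n y w / Num.sqrt (g_mass g n) = A w).
  move=> y; have [ys|ys] := boolP (y \in s); last by exists (fun=> 0); split => //; exact: measurable_cst.
  have [A [nA aA]] := grid_increment n0 gn zU ys.
  by exists A; split => //; case: nA.
have sz : e_ n ^+ 2 * (size s)%:R <= 1.
  rewrite size_grid natrM (_ : _ * _ = (N1%:R * e_ n) * (N2%:R * e_ n)); last by ring.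
  by rewrite mulr_ile1 ?mulr_ge0// ?(ltW ep)//; [exact: le_trans z11|exact: le_trans z21].
have LLN := Ht (R * R)%type s (e_ n ^+ 2) A (kern g x n) (sqr_ge0 _) sz
  (fun y ys => ((HA y).2 ys).1) (fun y _ => kern_energy y B0 xB gn) Cn.
pose S w := \sum_(y <- s) e_ n ^+ 2 * (`|A y w| `^ p - m * inner lam (kern g x n y) (kern g x n y) `^ (p / 2)).
have mS : measurable_fun setT S.
  apply: measurable_sum => y; apply: measurable_funM => //; apply: measurable_funB => //.
  by have /measurableT_comp := measurable_abs_powR p; apply; exact: (HA y).1.
have PE := markov_abs mS e20 LLN.
have [Nn [mN N0 NN]] : \forall w \ae P, forall y, y \in s -> unit_increment Yx n y w / Num.sqrt (g_mass g n) = A y w.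
  by apply: ae_seq => y ys; exact: ((HA y).2 ys).2.
have mE : measurable [set w | e / 2 <= `|S w|].
  rewrite (_ : [set w | _] = (fun w => `|S w|) @^-1` `[e / 2, +oo[%classic).
    rewrite -[X in measurable X]setTI; apply: (measurableT_comp (@normr_measurable R setT) mS) => //.
  by apply/seteqP; split => w /=; rewrite in_itv/= andbT.
exists ([set w | e / 2 <= `|S w|] `|` Nn).
  split; first exact: measurableU.
  apply: (le_trans (measureU2 P mE mN)).
  by rewrite [X in (_ + X <= _)%E](_ : _ = 0%E)// adde0.
move=> w /not_orP[/negP]; rewrite -ltNge => Sw nNw.
have Aw : forall y, y \in s -> unit_increment Yx n y w / Num.sqrt (g_mass g n) = A y w.
  by apply: contrapT => h; apply: nNw; apply: NN.
rewrite normalized_variation_grid// -/N1 -/N2 -/s.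
have -> : \sum_(t <- s) e_ n ^+ 2 * (`|unit_increment Yx n t w / Num.sqrt (g_mass g n)| `^ p) =
   S w + m * (e_ n ^+ 2 * (\sum_(y <- s) inner lam (kern g x n y) (kern g x n y) `^ (p / 2))).
  rewrite /S !mulr_sumr -big_split/= big_seq [RHS]big_seq; apply: eq_bigr => y ys.
  by rewrite Aw//; ring.
set I := _ * \sum_(y <- s) _ in Mn *; set J := iter_int _ _ _ in Mn *.
rewrite -addrA -mulrBr; apply: (le_trans (ler_normD _ _)); rewrite normrM (ger0_norm m0).
have : m * `|I - J| <= e / 2.
  apply: (@le_trans _ _ (m * (e / 2 / (m + 1)))); first exact: ler_wpM2l.
  rewrite mulrA ler_pdivrMr; last by lra.
  by rewrite mulrC ler_pM2l//; lra.
by move: Sw; lra.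
Unshelve. all: by end_near. Qed.

End path_convergence.

Section finite_union.
Context d (T : measurableType d) (R : realType) (P : probability T R).

Lemma probability_bigU_le (I : eqType) (s : seq I) (E : I -> set T) (c : R) :
  (forall i, i \in s -> measurable (E i)) -> (forall i, i \in s -> (P (E i) <= c%:E)%E) ->
  measurable (\big[setU/set0]_(i <- s) E i) /\
  (P (\big[setU/set0]_(i <- s) E i) <= ((size s)%:R * c)%:E)%E.
Proof.
elim: s => [|i s IH] mE Pc; first by rewrite big_nil measure0 mul0r.
have [||m1 P1] := IH; [by move=> j js; apply: mE; rewrite inE js orbT
  |by move=> j js; apply: Pc; rewrite inE js orbT|].
have mi : measurable (E i) by apply: mE; rewrite mem_head.
rewrite big_cons; split; first exact: measurableU.
apply: (le_trans (measureU2 P mi m1)).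
have -> : (size (i :: s))%:R * c = c + (size s)%:R * c by rewrite /= -natr1; ring.
by rewrite EFinD; apply: leeD => //; apply: Pc; rewrite mem_head.
Qed.

End finite_union.

Lemma unit_cell (R : realType) (M : nat) (s : R) : 0 <= s <= 1 -> exists2 i : nat,
  (i <= M)%N & i%:R / M.+1%:R <= s <= i.+1%:R / M.+1%:R.
Proof.
move=> /andP[s0 s1]; have M0 : 0 < M.+1%:R :> R by [].
have q0 : 0 <= M.+1%:R * s by rewrite mulr_ge0.
have /andP[h1 h2] := truncn_itv q0.
have [iM|Mi] := leqP (Num.truncn (M.+1%:R * s)) M.
  exists (Num.truncn (M.+1%:R * s)) => //.
  by rewrite ler_pdivrMr// ler_pdivlMr// ![s * _]mulrC h1 (ltW h2).
exists M => //; rewrite divff ?gt_eqF// s1 andbT.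
rewrite ler_pdivrMr// [s * _]mulrC; apply: le_trans h1.
by rewrite ler_nat ltnW.
Qed.

Section variation_mono.
Context (R : realType) (T : Type) (g : {mfun plane R >-> R}) (Yx : R * R -> T -> R).
Variables (p : R) (k : nat -> nat).

Lemma normalized_variation_mono n w (z y : R * R) : z.1 <= y.1 -> z.2 <= y.2 ->
  normalized_variation g Yx p k n w z <= normalized_variation g Yx p k n w y.
Proof.
move=> h1 h2; rewrite /normalized_variation ler_wpM2l//.
  by rewrite divr_ge0 ?sqr_ge0// powR_ge0.
have idx (s t : R) : s <= t -> (Num.truncn (n%:R * s / (k n)%:R) <= Num.truncn (n%:R * t / (k n)%:R))%N.
  by move=> st; apply: le_truncn; rewrite ler_wpM2r ?invr_ge0// ler_wpM2l.
have incr (F : nat -> R) (N N' : nat) : (forall i, 0 <= F i) -> (N <= N')%N ->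
    \sum_(1 <= i < N.+1) F i <= \sum_(1 <= i < N'.+1) F i.
  by move=> F0 NN'; rewrite [leRHS](big_cat_nat (n := N.+1))//= lerDl sumr_ge0.
rewrite /power_variation; apply: (le_trans (incr _ _ _ _ (idx _ _ h1))).
  by move=> i; apply: sumr_ge0 => j _; exact: powR_ge0.
by apply: ler_sum => i _; apply: incr; [move=> j; exact: powR_ge0|exact: idx].
Qed.

End variation_mono.

Lemma sandwich (R : realFieldType) (v vl vh f fl fh e c : R) : vl <= v -> v <= vh ->
  `|vl - fl| <= e -> `|vh - fh| <= e -> `|fl - f| <= c -> `|fh - f| <= c -> `|v - f| <= e + c.
Proof.
move=> h1 h2; rewrite !ler_norml => /andP[? ?] /andP[? ?] /andP[? ?] /andP[? ?].
by apply/andP; split; lra.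
Qed.

Section path_uniform.
Context d (T : measurableType d) (R : realType) (P : probability T R).
Variable W : set (plane R) -> T -> R.
Hypothesis hW : white_noise P W.
Variable g : {mfun plane R >-> R}.
Hypothesis gsupp : ess_supp g `<=` unit_square.
Variable pi : probability (plane R) R.
Hypothesis pi0 : lambda2 (msupp pi) = 0%E.
Hypothesis piw : weak_cvg (concentration_measure g) pi.
Variables (x : vol_path R) (Yx : R * R -> T -> R).
Hypothesis hYx : forall n a b : nat, unit_square (a%:R / n%:R, b%:R / n%:R : R) ->
  wiener_value P W g x Yx (a%:R / n%:R, b%:R / n%:R).
Variable k : nat -> nat.
Hypothesis k_gt0 : forall n, (0 < n)%N -> (0 < k n)%N.
Hypothesis k_cvg : ((k n)%:R / n%:R : R) @[n --> \oo] --> (0 : R).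
Variable p : R.
Hypothesis p_gt0 : 0 < p.

Lemma normal_abs_moment_ge0 : 0 <= normal_abs_moment p.
Proof. by apply: Rintegral_ge0 => y _; exact: powR_ge0. Qed.

Lemma limit_lipschitz : exists2 L, 0 <= L & forall z y : R * R, unit_square z -> unit_square y ->
  `|normal_abs_moment p * iter_int (limit_density pi x p) z.1 z.2 -
    normal_abs_moment p * iter_int (limit_density pi x p) y.1 y.2| <= L * (`|z.1 - y.1| + `|z.2 - y.2|).
Proof.
have [B B0 xB] := path_bound x; have m0 := normal_abs_moment_ge0.
exists (normal_abs_moment p * (B ^+ 2) `^ (p / 2)); first by rewrite mulr_ge0// powR_ge0.
move=> z y [/=]; rewrite !in_itv/= => z1 z2 [/=]; rewrite !in_itv/= => /andP[y10 y11] /andP[y20 y21].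
rewrite -mulrBr normrM (ger0_norm m0) -mulrA ler_wpM2l//.
apply: iter_int_lip => //; first exact: (limit_density_ucont pi B0 xB p_gt0).
move=> u v; have /andP[a b] := limit_density_bound pi B0 xB u v p_gt0; by rewrite ger0_norm.
Qed.

Lemma path_sup_cvg (e del : R) : 0 < e -> 0 < del -> \forall n \near \oo,
  exists2 E, measurable E /\ (P E <= del%:E)%E & forall w, ~ E w -> forall z : R * R, unit_square z ->
    `|normalized_variation g Yx p k n w z
     - normal_abs_moment p * iter_int (limit_density pi x p) z.1 z.2| <= e.
Proof.
move=> e0 d0; have [L L0 lipL] := limit_lipschitz.
set m := normal_abs_moment p in lipL *.
pose M := Num.truncn (4 * L / e).
have /andP[_ hM] : M%:R <= 4 * L / e < M.+1%:R.
  by apply: truncn_itv; rewrite divr_ge0 ?mulr_ge0// ltW.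
clearbody M.
have ML : L * (M.+1%:R^-1 + M.+1%:R^-1) <= e / 2.
  have M1 : 0 < M.+1%:R :> R by [].
  rewrite (_ : _ * _ = 2 * L / M.+1%:R); last by ring.
  by rewrite ler_pdivrMr//; move: hM; rewrite ltr_pdivrMr//; lra.
pose pts : seq (R * R) := [seq (i%:R / M.+1%:R, j%:R / M.+1%:R) | i <- iota 0 M.+2, j <- iota 0 M.+2].
have ptsU y : y \in pts -> unit_square y.
  move=> /allpairsP[[i j] [+ + ->]]; rewrite !mem_iota !add0n !ltnS /= => iM jM.
  by split; rewrite /= in_itv/= divr_ge0//= ler_pdivrMr// mul1r ler_nat.
have e20 : 0 < e / 2 by lra.
have s0 : 0 < (size pts)%:R :> R by rewrite ltr0n size_allpairs !size_iota.
have ds : 0 < del / (size pts)%:R by rewrite divr_gt0.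
have := path_variation_cvg hW gsupp pi0 piw hYx k_gt0 k_cvg p_gt0 e20 ds.
apply: filterS => n Hn.
have /choice[E HE] : forall y : R * R, exists E, y \in pts -> (measurable E /\ (P E <= (del / (size pts)%:R)%:E)%E) /\
   forall w, ~ E w -> `|normalized_variation g Yx p k n w y - m * iter_int (limit_density pi x p) y.1 y.2| <= e / 2.
  move=> y; have [ys|ys] := boolP (y \in pts); last by exists set0.
  by have [E ? ?] := Hn y (ptsU _ ys); exists E.
have [mU PU] := @probability_bigU_le _ _ _ P _ pts E (del / (size pts)%:R)
  (fun y ys => (HE y ys).1.1) (fun y ys => (HE y ys).1.2).
exists (\big[setU/set0]_(y <- pts) E y).
  by split => //; move: PU; rewrite mulrC mulfVK// gt_eqF.
move=> w nE z zU; have nEy y : y \in pts -> ~ E y w.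
  by move=> ys Ey; apply: nE; rewrite -bigcup_seq; exists y.
have [/=] := zU; rewrite !in_itv/= => z1 z2.
have [i iM /andP[i1 i2]] := unit_cell M z1; have [j jM /andP[j1 j2]] := unit_cell M z2.
pose lo : R * R := (i%:R / M.+1%:R, j%:R / M.+1%:R).
pose hi : R * R := (i.+1%:R / M.+1%:R, j.+1%:R / M.+1%:R).
have lop : lo \in pts.
  by apply/allpairsP; exists (i, j); rewrite !mem_iota !add0n !ltnS !(leq_trans _ (leqnSn _)).
have hip : hi \in pts.
  by apply/allpairsP; exists (i.+1, j.+1); rewrite !mem_iota !add0n !ltnS.
have step (a : nat) : a.+1%:R / M.+1%:R = a%:R / M.+1%:R + M.+1%:R^-1 :> R.
  by rewrite -natr1 mulrDl mul1r.
have dl : L * (`|lo.1 - z.1| + `|lo.2 - z.2|) <= e / 2.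
  apply: le_trans ML; apply: ler_wpM2l => //; apply: lerD; rewrite /= distrC ger0_norm ?subr_ge0// lerBlDr addrC -step//.
have dh : L * (`|hi.1 - z.1| + `|hi.2 - z.2|) <= e / 2.
  apply: le_trans ML; apply: ler_wpM2l => //; apply: lerD; rewrite /= ger0_norm ?subr_ge0// lerBlDr step addrC lerD2l//.
have -> : e = e / 2 + e / 2 by lra.
have V := normalized_variation_mono g Yx p k n w.
apply: (sandwich (V lo z _ _) (V z hi _ _) ((HE _ lop).2 _ (nEy _ lop)) ((HE _ hip).2 _ (nEy _ hip))) => //.
- exact: le_trans (lipL _ _ (ptsU _ lop) zU) dl.
- exact: le_trans (lipL _ _ (ptsU _ hip) zU) dh.
Qed.

End path_uniform.

Section step_functions.
Context (R : realType).

Lemma truncn_right (c s : R) : 0 <= c -> 0 <= s -> exists2 r, 0 < r &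
  forall u, s <= u -> u - s < r -> Num.truncn (c * u) = Num.truncn (c * s).
Proof.
move=> c0 s0; have q0 : 0 <= c * s by rewrite mulr_ge0.
have /andP[h1 h2] := truncn_itv q0.
set N := Num.truncn (c * s) in h1 h2 *.
exists ((N.+1%:R - c * s) / (c + 1)); first by rewrite divr_gt0 ?subr_gt0//; lra.
move=> u su; rewrite ltr_pdivlMr; last by lra.
move=> us; apply: truncn_def; apply/andP; split; first by rewrite (le_trans h1)// ler_wpM2l.
by move: us; rewrite mulrDr mulr1 [_ * c]mulrC mulrBr; lra.
Qed.

Lemma truncn_left (c s : R) : 0 <= c -> 0 <= s -> exists N, exists2 r, 0 < r &
  forall u, 0 <= u -> u < s -> s - u < r -> Num.truncn (c * u) = N.
Proof.
move=> c0 s0; have q0 : 0 <= c * s by rewrite mulr_ge0.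
have /andP[] := truncn_itv q0; set N := Num.truncn (c * s).
have c1 : 0 < c + 1 by lra.
rewrite le_eqVlt => /orP[/eqP h1 _|h1 h2].
  have [N0|Npos] := posnP N.
    exists 0%N, 1 => // u u0 us _; apply: truncn_def; rewrite mulr_ge0//=.
    move: h1; rewrite N0 => /esym/eqP; rewrite mulf_eq0 => /orP[/eqP->|/eqP s00]; first by rewrite mul0r.
    by move: us; rewrite s00 ltNge u0.
  exists N.-1, (c + 1)^-1; first by rewrite invr_gt0.
  move=> u u0 us; rewrite -[_^-1]mul1r ltr_pdivlMr// mulrDr mulr1 [_ * c]mulrC mulrBr -h1 => H.
  apply: truncn_def; rewrite prednK//.
  have cpos : 0 < c.
    rewrite lt_neqAle c0 andbT; apply/eqP => c00; move: h1; rewrite -c00 mul0r => /eqP.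
    by rewrite pnatr_eq0; case: (N) Npos.
  rewrite [X in _ && (_ < X)]h1 ltr_pM2l// us andbT -(lerD2r 1) natr1 prednK//; lra.
exists N, ((c * s - N%:R) / (c + 1)); first by rewrite divr_gt0// subr_gt0.
move=> u u0 us; rewrite ltr_pdivlMr// mulrDr mulr1 [_ * c]mulrC mulrBr => H.
apply: truncn_def; apply/andP; split; first by move: H; lra.
by apply: le_lt_trans h2; rewrite ler_wpM2l// ltW.
Qed.

Lemma cvg_within (A : set (R * R)) (f : R * R -> R) (z : R * R) (l : R) :
  (forall e, 0 < e -> exists2 r, 0 < r & forall y, A y -> `|z.1 - y.1| < r -> `|z.2 - y.2| < r -> `|l - f y| <= e) ->
  f y @[y --> within A (nbhs z)] --> l.
Proof.
move=> H; apply/cvgrPdist_le => e e0; have [r r0 Hr] := H e e0.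
rewrite near_withinE; apply: filterS (nbhsx_ballx z r r0) => y [y1 y2] Ay.
exact: Hr.
Qed.

Lemma cadlag2_step (c : R) (H : nat -> nat -> R) : 0 <= c ->
  cadlag2 (fun z : R * R => H (Num.truncn (c * z.1)) (Num.truncn (c * z.2))).
Proof.
move=> c0 s t [/=]; rewrite !in_itv/= => /andP[s0 _] /andP[t0 _].
have [rs rs0 Hrs] := truncn_right c0 s0; have [rt rt0 Hrt] := truncn_right c0 t0.
have [Ns [ls ls0 Hls]] := truncn_left c0 s0; have [Nt [lt lt0 Hlt]] := truncn_left c0 t0.
split; [|exists (H Ns (Num.truncn (c * t)))|exists (H Ns Nt)|exists (H (Num.truncn (c * s)) Nt)];
  apply: cvg_within => e e0.
- exists (Num.min rs rt); first by rewrite lt_min rs0.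
  move=> y [/=]; rewrite !in_itv/= => /andP[a _] /andP[b _].
  rewrite !lt_min => /andP[h1 _] /andP[_ h2].
  move: h1; rewrite distrC gtr0_norm ?subr_gt0// => h1.
  move: h2; rewrite distrC gtr0_norm ?subr_gt0// => h2.
  by rewrite (Hrs y.1) ?(Hrt y.2) ?subrr ?normr0 ?(ltW e0) ?(ltW a) ?(ltW b)//.
- exists (Num.min ls rt); first by rewrite lt_min ls0.
  move=> y [/=]; rewrite !in_itv/= => /andP[a a'] /andP[b _].
  rewrite !lt_min => /andP[h1 _] /andP[_ h2].
  move: h1; rewrite gtr0_norm ?subr_gt0// => h1.
  move: h2; rewrite distrC gtr0_norm ?subr_gt0// => h2.
  by rewrite (Hls y.1) ?(Hrt y.2) ?subrr ?normr0 ?(ltW e0) ?(ltW b)//.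
- exists (Num.min ls lt); first by rewrite lt_min ls0.
  move=> y [/=]; rewrite !in_itv/= => /andP[a a'] /andP[b b'].
  rewrite !lt_min => /andP[h1 _] /andP[_ h2].
  move: h1; rewrite gtr0_norm ?subr_gt0// => h1.
  move: h2; rewrite gtr0_norm ?subr_gt0// => h2.
  by rewrite (Hls y.1) ?(Hlt y.2) ?subrr ?normr0 ?(ltW e0)//.
- exists (Num.min rs lt); first by rewrite lt_min rs0.
  move=> y [/=]; rewrite !in_itv/= => /andP[a _] /andP[b b'].
  rewrite !lt_min => /andP[h1 _] /andP[_ h2].
  move: h1; rewrite distrC gtr0_norm ?subr_gt0// => h1.
  move: h2; rewrite gtr0_norm ?subr_gt0// => h2.
  by rewrite (Hrs y.1) ?(Hlt y.2) ?subrr ?normr0 ?(ltW e0) ?(ltW a)//.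
Qed.

Lemma cadlag2_lipschitz (f : R * R -> R) (L : R) : 0 <= L ->
  (forall z y, unit_square z -> unit_square y -> `|f z - f y| <= L * (`|z.1 - y.1| + `|z.2 - y.2|)) ->
  cadlag2 f.
Proof.
move=> L0 fL s t stU; have [/=] := stU; rewrite !in_itv/= => /andP[s0 s1] /andP[t0 t1].
have C (A : set (R * R)) : (forall y, A y -> unit_square y) -> f y @[y --> within A (nbhs (s, t))] --> f (s, t).
  move=> AU; apply: cvg_within => e e0.
  have L1 : 0 < 2 * L + 1 by lra.
  exists (e / (2 * L + 1)); first by rewrite divr_gt0.
  move=> y /AU yU /= h1 h2; apply: (le_trans (fL _ _ stU yU)) => /=.
  apply: (@le_trans _ _ (L * (e / (2 * L + 1) + e / (2 * L + 1)))).
    by rewrite ler_wpM2l// lerD// ltW.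
  rewrite -mulrDl mulrA ler_pdivrMr//; nra.
split; [|exists (f (s, t))|exists (f (s, t))|exists (f (s, t))]; apply: C => y [/=];
  rewrite !in_itv/= => /andP[a b] /andP[a' b']; split; rewrite /= in_itv/=; apply/andP; split => //; lra.
Qed.

End step_functions.

Lemma gap_transfer (R : realFieldType) (a b c e : R) : a <= b + c -> c < a - e -> e < b.
Proof. by move=> ? ?; lra. Qed.

Section limit_field_facts.
Context (R : realType) (pi : probability (plane R) R) (p : R).
Hypothesis piU : pi (~` unit_square) = 0%E.

Lemma limit_field_iter (x : vol_path R) z : unit_square z ->
  limit_field p pi x z = iter_int (limit_density pi x p) z.1 z.2.
Proof.
move=> [/=]; rewrite !in_itv/= => /andP[z10 z11] /andP[z20 z21].
rewrite /limit_field /iter_int; apply: eq_Rintegral => u; rewrite inE/= in_itv/= => /andP[u0 u1].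
apply: eq_Rintegral => v; rewrite inE/= in_itv/= => /andP[v0 v1].
rewrite /limit_density /convol/=; congr (_ `^ _); rewrite /Rintegral; congr fine.
have mU : measurable (@unit_square R) by exact: closed_measurable_plane (@unit_square_closed R).
apply: ae_eq_integral => //.
- apply/measurable_EFinP; apply: measurable_funX.
  exact: (measurable_flip_fun (u, v) (measurable_path x)).
- apply/measurable_EFinP.
  apply: (measurable_flip_fun (u, v)); apply: continuous_measurable_plane.
  exact: (ucont_continuous (ext2_ucont x)).
- exists (~` unit_square); split => //; first exact: measurableC.
  move=> y /= h yU; apply: h => _.
  case: yU => /=; rewrite !in_itv/= => /andP[y10 y11] /andP[y20 y21].
  by rewrite /ext2 ext_id//=; lra.
Qed.

Lemma cadlag2_limit_field (x : vol_path R) : 0 < p ->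
  cadlag2 (fun z => normal_abs_moment p * limit_field p pi x z).
Proof.
move=> p0; have [L L0 HL] := limit_lipschitz pi x p0.
apply: (cadlag2_lipschitz L0) => z y zU yU; rewrite !limit_field_iter//; exact: HL.
Qed.

Lemma cadlag2_variation (T : Type) (g : {mfun plane R >-> R}) (Yx : R * R -> T -> R) k n w :
  cadlag2 (normalized_variation g Yx p k n w).
Proof.
pose H (N M : nat) := ((k n)%:R / n%:R) ^+ 2 / (g_mass g n) `^ (p / 2) *
  \sum_(1 <= i < N.+1) \sum_(1 <= j < M.+1)
      `| increment Yx (((k n * i)%:R - 1) / n%:R) ((k n * i)%:R / n%:R)
                     (((k n * j)%:R - 1) / n%:R) ((k n * j)%:R / n%:R) w | `^ p.
rewrite (_ : normalized_variation _ _ _ _ _ _ =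
  fun z : R * R => H (Num.truncn (n%:R / (k n)%:R * z.1)) (Num.truncn (n%:R / (k n)%:R * z.2))).
  by apply: cadlag2_step; rewrite divr_ge0.
by apply/funext => z; rewrite /H ![n%:R / _ * _]mulrAC.
Qed.

Lemma sup_dist_rational (T : Type) (g : {mfun plane R >-> R}) (Yx : R * R -> T -> R) k n w (x : vol_path R) (e : R) : 0 < p ->
  (e%:E < sup_dist (normalized_variation g Yx p k n w) (fun z => (normal_abs_moment p * limit_field p pi x z)%R))%E ->
  exists a b c : nat, unit_square (a%:R / c.+1%:R, b%:R / c.+1%:R : R) /\
   e < `|normalized_variation g Yx p k n w (a%:R / c.+1%:R, b%:R / c.+1%:R) -
      normal_abs_moment p * limit_field p pi x (a%:R / c.+1%:R, b%:R / c.+1%:R)|.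
Proof.
move=> p0 /ereal_sup_gt[_ [z zU <-]]; rewrite lte_fin => ez.
have [L L0 HL] := limit_lipschitz pi x p0.
set f := normalized_variation g Yx p k n w in ez *.
set h := (fun z => normal_abs_moment p * limit_field p pi x z).
have hL y : unit_square y -> `|h z - h y| <= L * (`|z.1 - y.1| + `|z.2 - y.2|).
  by move=> yU; rewrite /h !limit_field_iter//; exact: HL.
have [/=] := zU; rewrite !in_itv/= => z1 z2.
have z10 : 0 <= z.1 by case/andP: z1.
have z20 : 0 <= z.2 by case/andP: z2.
have c0 : 0 <= n%:R / (k n)%:R :> R by rewrite divr_ge0.
have [r1 r10 H1] := truncn_right c0 z10; have [r2 r20 H2] := truncn_right c0 z20.
set gap := `|f z - h z| - e.
have gap0 : 0 < gap by rewrite subr_gt0.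
pose r3 := gap / (2 * L + 1).
have L1 : 0 < 2 * L + 1 by lra.
have r30 : 0 < r3 by rewrite divr_gt0.
pose r := Num.min r1 (Num.min r2 r3).
have r0 : 0 < r by rewrite !lt_min r10 r20.
pose M := Num.truncn r^-1.
have rM : M.+1%:R^-1 < r.
  rewrite -[ltRHS]invrK ltf_pV2 ?posrE ?invr_gt0//.
  by have /andP[] := truncn_itv (ltW (etrans (invr_gt0 r) r0)).
have [i iM /andP[i1 i2]] := unit_cell M z1; have [j jM /andP[j1 j2]] := unit_cell M z2.
have step (a : nat) : a.+1%:R / M.+1%:R = a%:R / M.+1%:R + M.+1%:R^-1 :> R.
  by rewrite -natr1 mulrDl mul1r.
exists i.+1, j.+1, M; set y : R * R := (_, _).
have yU : unit_square y.
  by split; rewrite /= in_itv/= divr_ge0//= ler_pdivrMr// mul1r ler_nat ltnS.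
have d1 : 0 <= y.1 - z.1 < r.
  by rewrite subr_ge0 i2/=; apply: le_lt_trans rM; rewrite lerBlDr /= step addrC lerD2l.
have d2 : 0 <= y.2 - z.2 < r.
  by rewrite subr_ge0 j2/=; apply: le_lt_trans rM; rewrite lerBlDr /= step addrC lerD2l.
split; first exact: yU.
have fy : f y = f z.
  have E (s : R) : n%:R * s / (k n)%:R = n%:R / (k n)%:R * s by rewrite mulrAC.
  move: d1 d2 => /andP[d10 d1r] /andP[d20 d2r].
  move: d10 d20; rewrite !subr_ge0 => zy1 zy2.
  move: d1r d2r; rewrite !lt_min => /and3P[q1 _ _] /and3P[_ q2 _].
  by rewrite /f /normalized_variation /power_variation !E (H1 y.1) ?(H2 y.2).
have hyz : `|h z - h y| < gap.
  apply: (le_lt_trans (hL y yU)).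
  move: d1 d2; rewrite !lt_min => /andP[d10 /and3P[_ _ d13]] /andP[d20 /and3P[_ _ d23]].
  rewrite distrC (ger0_norm d10) distrC (ger0_norm d20).
  apply: (@le_lt_trans _ _ (L * (r3 + r3))); first by rewrite ler_wpM2l// lerD// ltW.
  by rewrite /r3 -mulrDl mulrA ltr_pdivrMr//; nra.
rewrite distrC in hyz.
have tri := ler_distD (h y) (f z) (h z).
by rewrite fy; exact: gap_transfer tri hyz.
Qed.

End limit_field_facts.

Section volatility_measurability.
Context (R : realType) (pi : probability (plane R) R).

Lemma measurable_eval (z : R * R) : measurable_fun setT (fun x : vol_space R => (x : vol_path R) z).
Proof.
have [zB|zB] := pselect (big_square z).
  move=> _ B mB; rewrite setTI; apply: sub_sigma_algebra.
  by exists z, B.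
rewrite (_ : (fun x : vol_space R => _) = cst 0); first exact: measurable_cst.
by apply/funext => x; rewrite path_out.
Qed.

Lemma measurable_ext2 (z : R * R) : measurable_fun setT (fun x : vol_space R => ext2 (x : vol_path R) z).
Proof. by apply: measurable_funX; exact: measurable_eval. Qed.

Definition snap (m : nat) (v : R) : R := (Num.floor (m.+1%:R * v))%:~R / m.+1%:R.

Lemma snap_dist m v : `|snap m v - v| <= m.+1%:R^-1.
Proof.
have m0 : 0 < m.+1%:R :> R by [].
have /andP[h1 h2] : (Num.floor (m.+1%:R * v))%:~R <= m.+1%:R * v < (Num.floor (m.+1%:R * v))%:~R + 1.
  by rewrite floor_le -[1]/(1%:~R) -rmorphD/= floorD1_gt.
have -> : snap m v - v = ((Num.floor (m.+1%:R * v))%:~R - m.+1%:R * v) / m.+1%:R.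
  by rewrite /snap; field; rewrite nat1r pnatr_eq0.
rewrite normrM (ger0_norm (x := _^-1))// ler_piMl// ler_norml; lra.
Qed.

Lemma measurable_snap_level m (a : int) : measurable [set v : R | Num.floor (m.+1%:R * v) = a].
Proof.
rewrite (_ : [set v : R | _] = (fun v => m.+1%:R * v) @^-1` `[a%:~R, (a + 1)%:~R[%classic).
  rewrite -[X in measurable X]setTI.
  have mm : measurable_fun setT (fun v : R => m.+1%:R * v) by apply: measurable_funM.
  exact: (mm measurableT _ (measurable_itv _)).
apply/seteqP; split => v /=; rewrite in_itv/=.
  by move=> <-; rewrite floor_le floorD1_gt.
by move=> h; apply: floor_def.
Qed.

Lemma measurable_ext2_snap m : measurable_fun setT
  (fun q : vol_space R * plane R => ext2 (q.1 : vol_path R) (snap m q.2.1, snap m q.2.2)).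
Proof.
move=> _ B mB; rewrite setTI.
pose S (c : int * int) : set (vol_space R * plane R) :=
  [set x : vol_space R | B (ext2 (x : vol_path R) (c.1%:~R / m.+1%:R, c.2%:~R / m.+1%:R))] `*`
  ([set v : R | Num.floor (m.+1%:R * v) = c.1] `*` [set v : R | Num.floor (m.+1%:R * v) = c.2]).
rewrite (_ : _ @^-1` B = \bigcup_c S c).
  apply: countable_bigcupT_measurable; first exact: countableP.
  move=> c; apply: measurableX.
    by have := measurable_ext2 (c.1%:~R / m.+1%:R, c.2%:~R / m.+1%:R) measurableT mB; rewrite setTI.
  by apply: measurableX; exact: measurable_snap_level.
apply/seteqP; split => -[x [u v]] /=.
  by move=> Bx; exists (Num.floor (m.+1%:R * u), Num.floor (m.+1%:R * v)).
by move=> [[a b] _ [/= Bx [/= ua vb]]]; rewrite /snap ua vb.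
Qed.

Lemma measurable_ext2_joint : measurable_fun setT
  (fun q : vol_space R * plane R => ext2 (q.1 : vol_path R) q.2).
Proof.
apply: (measurable_fun_cvg measurable_ext2_snap) => -[x [u v]] _ /=.
apply/cvgrPdist_le => e e0; have [d d0 Hd] := ext2_ucont x e0.
near=> m; have md : m.+1%:R^-1 < d.
  rewrite -[ltRHS]invrK ltf_pV2 ?posrE ?invr_gt0//; apply: (@lt_trans _ _ m%:R); last by rewrite ltr_nat.
  by near: m; exact: nbhs_infty_gtr.
by apply: Hd => /=; rewrite distrC; apply: le_lt_trans md; exact: snap_dist.
Unshelve. all: by end_near. Qed.

Lemma measurable_convol_ext2 (t : R * R) :
  measurable_fun setT (fun x : vol_space R => convol pi (ext2 (x : vol_path R)) t).
Proof.
pose f (q : vol_space R * plane R) : \bar R := (ext2 (q.1 : vol_path R) (t.1 - q.2.1, t.2 - q.2.2))%:E.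
have mf : measurable_fun setT f.
  apply/measurable_EFinP.
  have mp : measurable_fun setT (fun q : vol_space R * plane R => (q.1, (t.1 - q.2.1, t.2 - q.2.2) : plane R)).
    apply: measurable_fun_pair; first exact: measurable_fst.
    have m2 : measurable_fun setT (fun q : vol_space R * plane R => q.2) by exact: measurable_snd.
    apply: measurable_fun_pair; apply: measurable_funB => //.
      exact: (measurableT_comp (@measurable_fst _ _ _ _) m2).
    exact: (measurableT_comp (@measurable_snd _ _ _ _) m2).
  exact: (measurableT_comp measurable_ext2_joint mp).
have f0 q : (0 <= f q)%E by rewrite lee_fin sqr_ge0.
have := @measurable_fun_fubini_tonelli_F _ _ _ _ _ pi f mf f0.
by move=> mF; exact: (measurableT_comp (fine_measurable measurableT) mF).
Qed.

Lemma measurable_limit_density (p u v : R) :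
  measurable_fun setT (fun x : vol_space R => limit_density pi (x : vol_path R) p u v).
Proof. exact: (measurableT_comp (measurable_powR (p / 2)) (measurable_convol_ext2 (u, v))). Qed.

Lemma measurable_limit_field (p : R) (a b c : nat) : 0 < p -> pi (~` unit_square) = 0%E ->
  unit_square (a%:R / c.+1%:R, b%:R / c.+1%:R : R) ->
  measurable_fun setT (fun x : vol_space R =>
    limit_field p pi (x : vol_path R) (a%:R / c.+1%:R, b%:R / c.+1%:R)).
Proof.
move=> p0 piU zU.
rewrite (_ : (fun x : vol_space R => _) = (fun x : vol_space R =>
    iter_int (limit_density pi (x : vol_path R) p) (a%:R / c.+1%:R) (b%:R / c.+1%:R))); last first.
  by apply/funext => x; rewrite (limit_field_iter _ piU).
pose e (m : nat) : R := (c.+1%:R * m.+1%:R)^-1.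
pose S m (x : vol_space R) := e m ^+ 2 * \sum_(1 <= i < (a * m.+1).+1) \sum_(1 <= j < (b * m.+1).+1)
  limit_density pi (x : vol_path R) p (i%:R * e m) (j%:R * e m).
apply: (@measurable_fun_cvg _ _ _ _ S).
  move=> m; apply: measurable_funM => //; apply: measurable_sum => i; apply: measurable_sum => j.
  exact: measurable_limit_density.
move=> x _; have [B B0 xB] := path_bound x.
have uF := limit_density_ucont pi B0 xB p0.
have [/=] := zU; rewrite !in_itv/= => a01 b01.
apply/cvgrPdist_le => k k0; have k20 : 0 < k / 2 by lra.
have [d d0 Hd] := uF _ k20.
near=> m; have e0 : 0 < e m by rewrite invr_gt0 mulr_gt0.
have md : e m < d.
  rewrite -[ltRHS]invrK ltf_pV2 ?posrE ?invr_gt0 ?mulr_gt0//.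
  apply: (@lt_le_trans _ _ m.+1%:R); last by rewrite ler_peMl// ler1n.
  apply: (@lt_trans _ _ m%:R); last by rewrite ltr_nat.
  by near: m; exact: nbhs_infty_gtr.
have eE (q : nat) : (q * m.+1)%:R * e m = q%:R / c.+1%:R.
  by rewrite natrM /e invfM; field; rewrite !nat1r !pnatr_eq0.
have Fd u v u' v' : `|u - u'| <= e m -> `|v - v'| <= e m ->
    `|limit_density pi (x : vol_path R) p u v - limit_density pi (x : vol_path R) p u' v'| <= k / 2.
  by move=> h1 h2; apply: Hd; apply: le_lt_trans md.
have := riemann2 (a * m.+1) (b * m.+1) uF e0 Fd.
rewrite !eE -/(iter_int _ _ _) distrC => /le_trans; apply.
pose q : R := a%:R / c.+1%:R * (b%:R / c.+1%:R).
have q1 : q <= 1 by case/andP: a01 => ? ?; case/andP: b01 => ? ?; rewrite /q mulr_ile1.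
rewrite -/q (_ : 2 * (q * (k / 2)) = q * k); last by field.
by rewrite ler_piMl// ltW.
Unshelve. all: by end_near. Qed.

End volatility_measurability.

Section completed_product.
Context d (T : measurableType d) (R : realType).
Variables (PW : probability T R) (Psigma : probability (vol_space R) R).
Local Notation Omega := (ambit_space PW Psigma).

Lemma measurable_completed (A : set (T * vol_space R)) :
  measurable A -> measurable (A : set Omega).
Proof.
move=> mA; exists A => //; exists set0; first exact: negligible_set0.
by rewrite setU0.
Qed.

Lemma measurable_fun_completed (f : T * vol_space R -> R) :
  measurable_fun setT f -> measurable_fun setT (f : Omega -> R).
Proof.
move=> mf _ B mB; rewrite setTI; apply: measurable_completed.
by have := mf measurableT B mB; rewrite setTI.
Qed.

Lemma product_measure_sections (B : set (T * vol_space R)) : measurable B ->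
  ((PW \x Psigma) B = \int[Psigma]_x PW (ysection B x))%E.
Proof.
move=> mB.
rewrite (@product_measure_unique _ _ _ _ _ PW Psigma (PW \x^ Psigma)%E)//.
by move=> A1 A2 m1 m2; exact: product_measure2E.
Qed.

Lemma completed_core (D : set Omega) : measurable D ->
  exists2 B : set (T * vol_space R), measurable B /\ B `<=` D &
    (ambit_prob D <= \int[Psigma]_x PW (ysection B x))%E.
Proof.
move=> [B mB [N [M [mM M0 NM]] <-]]; exists B; first by split => //; exact: subsetUl.
rewrite -product_measure_sections//.
have : (mu_ext (PW \x Psigma) (B `|` N) <= mu_ext (PW \x Psigma) (B `|` M))%E.
  by apply: le_mu_ext; exact: setUS.
move=> /le_trans; apply; rewrite measurable_mu_extE; last exact: measurableU.
pose mu : {measure set (T * vol_space R)%type -> \bar R} := (PW \x Psigma)%E.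
have U : (mu (B `|` M) <= mu B + mu M)%E by exact: measureU2.
apply: le_trans U _.
by rewrite [X in (_ + X <= _)%E](_ : _ = 0%E)// adde0.
Qed.

Lemma sectionwise_cvg (D : nat -> set Omega) : (forall n, measurable (D n)) ->
  (\forall x \ae Psigma, forall del : R, 0 < del -> \forall n \near \oo,
     exists2 E, measurable E /\ (PW E <= del%:E)%E & forall w, D n (w, x) -> E w) ->
  ambit_prob (D n) @[n --> \oo] --> 0%E.
Proof.
move=> mD aD; have /choice[B HB] : forall n, exists B : set (T * vol_space R), [/\ measurable B, B `<=` D n &
    (ambit_prob (D n) <= \int[Psigma]_x PW (ysection B x))%E].
  by move=> n; have [B [? ?] ?] := completed_core (mD n); exists B.
pose f n (x : vol_space R) := PW (ysection (B n) x).
have mf n : measurable_fun setT (f n).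
  by have [mB _ _] := HB n; exact: (measurable_fun_ysection PW mB).
have f0 : {ae Psigma, forall x, setT x -> f n x @[n --> \oo] --> (0%E : \bar R)}.
  apply: filterS aD => x Hx _; apply/fine_cvgP; split.
    by apply: nearW => n; rewrite /f fin_num_measure//; have [mB _ _] := HB n; exact: measurable_ysection.
  apply/cvgrPdist_le => e e0; apply: filterS (Hx e e0) => n [E [mE Ee] DE].
  have [mB BD _] := HB n.
  have mY : measurable (ysection (B n) x) by exact: measurable_ysection.
  have fE : (f n x <= e%:E)%E.
    apply: le_trans Ee; apply: le_measure; rewrite ?inE//.
    by move=> w; rewrite /ysection/= inE => /BD /DE.
  have ff : f n x \is a fin_num by rewrite fin_num_measure.
  rewrite sub0r normrN ger0_norm; last by rewrite fine_ge0.
  by rewrite -lee_fin fineK.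
have dom : {ae Psigma, forall x n, setT x -> (`|f n x| <= (cst 1%E : vol_space R -> \bar R) x)%E}.
  apply: aeW => x n _; have [mB _ _] := HB n; rewrite gee0_abs//.
  by apply: probability_le1; exact: measurable_ysection.
have i1 : Psigma.-integrable setT (cst 1%E : vol_space R -> \bar R) by exact: finite_measure_integrable_cst.
have [_ _] := dominated_convergence measurableT mf (measurable_cst 0%E) f0 i1 dom.
rewrite integral0 => c; apply: (@squeeze_cvge _ _ _ _ (fun=> 0%E) _ (fun n => \int[Psigma]_x f n x)%E) => //.
  by apply: nearW => n; rewrite measure_ge0; have [_ _ ->] := HB n.
exact: cvg_cst.
Qed.

End completed_product.

Section measurable_variation.
Context d (T : measurableType d) (R : realType).

Lemma measurable_sum_in (I : eqType) (s : seq I) (h : I -> T -> R) :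
  (forall i, i \in s -> measurable_fun setT (h i)) ->
  measurable_fun setT (fun x => \sum_(i <- s) h i x).
Proof.
elim: s => [|i s IH] mh.
  by under eq_fun do rewrite big_nil; exact: measurable_cst.
under eq_fun do rewrite big_cons; apply: measurable_funD; first by apply: mh; rewrite mem_head.
by apply: IH => j js; apply: mh; rewrite inE js orbT.
Qed.

Lemma mesh_point (k n m : nat) (s : R) : (0 < n)%N -> (0 < k)%N -> 0 <= s <= 1 ->
  (0 < m <= Num.truncn (n%:R * s / k%:R))%N ->
  `[0, 1]%classic ((k * m)%:R / n%:R : R) /\ `[0, 1]%classic (((k * m)%:R - 1) / n%:R : R).
Proof.
move=> n0 k0 /andP[s0 s1] /andP[m0 mN].
have n0' : 0 < n%:R :> R by rewrite ltr0n.
have k0' : 0 < k%:R :> R by rewrite ltr0n.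
have q0 : 0 <= n%:R * s / k%:R by rewrite divr_ge0// mulr_ge0.
have /andP[h1 _] := truncn_itv q0.
have u : (k * m)%:R <= n%:R :> R.
  rewrite natrM mulrC -ler_pdivlMr//; apply: (@le_trans _ _ (n%:R * s / k%:R)).
    by apply: le_trans h1; rewrite ler_nat.
  by rewrite ler_pM2r ?invr_gt0// ler_piMr.
have l : 1 <= (k * m)%:R :> R by rewrite ler1n muln_gt0 k0.
split; rewrite /= in_itv/= ler_pdivrMr// mul1r.
  by rewrite u andbT divr_ge0.
rewrite (_ : 0 <= _ / _) /=; first by apply: le_trans u; rewrite gerBl.
by apply: divr_ge0 => //; rewrite subr_ge0.
Qed.

Lemma measurable_variation (g : {mfun plane R >-> R}) (Y : R * R -> T -> R) (p : R) (k : nat -> nat) n (z : R * R) :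
  (forall n, (0 < n)%N -> (0 < k n)%N) ->
  (forall z, unit_square z -> measurable_fun setT (Y z)) -> unit_square z ->
  measurable_fun setT (fun w => normalized_variation g Y p k n w z).
Proof.
move=> k_gt0 mY [/=]; rewrite !in_itv/= => z1 z2.
have [->|n0] := posnP n.
  rewrite (_ : (fun w => _) = cst 0); first exact: measurable_cst.
  by apply/funext => w; rewrite /normalized_variation invr0 mulr0 expr0n/= !mul0r.
have k0 := k_gt0 n n0.
rewrite /normalized_variation /power_variation.
apply: measurable_funM => //; apply: measurable_sum_in => i; rewrite mem_index_iota ltnS => iN.
apply: measurable_sum_in => j; rewrite mem_index_iota ltnS => jN.
have /measurableT_comp := measurable_abs_powR p; apply.
have [a1 a2] := mesh_point n0 k0 z1 iN; have [b1 b2] := mesh_point n0 k0 z2 jN.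
apply: measurable_funD; last by apply: mY.
by apply: measurable_funB; [apply: measurable_funB|]; apply: mY.
Qed.

End measurable_variation.

Theorem theorem2p9 (R : realType)
  (d : measure_display) (TW : measurableType d) (PW : probability TW R)
  (W : set (plane R) -> TW -> R)
  (hW : white_noise PW W)
  (hFW : generated_by_noise W)
  (Psigma : probability (vol_space R) R)
  (hsigma : \forall x \ae Psigma,
     forall z, big_square z -> 0 < (x : vol_path R) z)
  (g : {mfun plane R >-> R})
  (hgL2 : (g : R * R -> R) \in Lfun (lambda2) 2%:E)
  (hg0 : ~ (\forall z \ae lambda2, g z = 0))
  (hgsupp : ess_supp g `<=` unit_square)
  (Y : R * R -> ambit_space PW Psigma -> R)
  (hY : ambit_field W g Y)
  (k : nat -> nat)
  (hk0 : forall n : nat, (0 < n)%N -> (0 < k n)%N)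
  (hkmon : forall m n : nat, (0 < m)%N -> (m <= n)%N -> (k m <= k n)%N)
  (hkeps : ((k n)%:R / n%:R : R) @[n --> \oo] --> (0 : R))
  (p : R) (hp : 0 < p)
  (pi : probability (plane R) R)
  (hpi0 : lambda2 (msupp pi) = 0%E)
  (hpiw : weak_cvg (concentration_measure g) pi) :
  cvg_in_probability_D (@ambit_prob _ _ _ PW Psigma)
    (fun n w z => ((k n)%:R / n%:R) ^+ 2 / (g_mass g n) `^ (p / 2)
                  * power_variation p Y (k n) n w z)
    (fun w z => normal_abs_moment p
                * limit_field p pi (w : TW * vol_space R).2 z).
Proof.
have piU := limit_unit_square hgsupp hpiw.
split.
- by move=> n w; exact: (cadlag2_variation p g Y k n w).
- by move=> w; exact: cadlag2_limit_field.
move=> e e0.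
pose V n (w : ambit_space PW Psigma) z := normalized_variation g Y p k n w z.
pose S (w : ambit_space PW Psigma) z := normal_abs_moment p * limit_field p pi (w : TW * vol_space R).2 z.
pose D n : set (ambit_space PW Psigma) := [set w | (e%:E < sup_dist (V n w) (S w))%E].
have mYz z : unit_square z -> measurable_fun setT (Y z) by move=> /hY[].
apply: (@sectionwise_cvg _ _ _ _ _ D).
  move=> n.
  pose q (c : nat * nat * nat) : R * R := (c.1.1%:R / c.2.+1%:R, c.1.2%:R / c.2.+1%:R).
  pose F (c : nat * nat * nat) : set (ambit_space PW Psigma) :=
    [set w | unit_square (q c) /\ e < `|V n w (q c) - S w (q c)|].
  rewrite (_ : D n = \bigcup_c F c); last first.
    apply/seteqP; split => w.
      by move=> /(sup_dist_rational piU hp)[a [b [c [cU ce]]]]; exists (a, b, c).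
    move=> [c _ [cU ce]]; rewrite /D /=; apply: (@lt_le_trans _ _ (`|V n w (q c) - S w (q c)|)%:E).
      by rewrite lte_fin.
    by apply: ereal_sup_ubound; exists (q c).
  apply: countable_bigcupT_measurable; first exact: countableP.
  move=> c; have [cU|cU] := pselect (unit_square (q c)); last first.
    by rewrite (_ : F c = set0)//; apply/seteqP; split => // w [].
  have mV : measurable_fun setT (fun w => V n w (q c)) by exact: measurable_variation.
  have mS : measurable_fun setT (fun w => S w (q c)).
    apply: measurable_fun_completed; apply: measurable_funM => //.
    exact: (measurableT_comp (measurable_limit_field hp piU cU) (@measurable_snd _ _ _ _)).
  have mVS := measurableT_comp (@normr_measurable R setT) (measurable_funB mV mS).
  rewrite (_ : F c = (fun w => `|V n w (q c) - S w (q c)|) @^-1` `]e, +oo[%classic).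
    rewrite -[X in measurable X]setTI; exact: (mVS measurableT _ (measurable_itv _)).
  apply/seteqP; split => w /=; rewrite in_itv/= andbT; first by case.
  by split.
have aeF := ae_filter_ringOfSetsType Psigma.
have aY : \forall x \ae Psigma, forall n a b : nat, unit_square (a%:R / n%:R, b%:R / n%:R : R) ->
    wiener_value PW W g (x : vol_path R) (fun z w => Y z (w, x)) (a%:R / n%:R, b%:R / n%:R).
  apply: ae_foralln => n; apply: ae_foralln => a; apply: ae_foralln => b.
  have [zU|zU] := pselect (unit_square (a%:R / n%:R, b%:R / n%:R : R)); last exact: aeW.
  have [_ aX] := hY _ zU.
  by apply: filterS aX => x Hx _.
apply: filterS aY => x hYx del del0.
have := path_sup_cvg hW hgsupp hpi0 hpiw hYx hk0 hkeps hp e0 del0.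
apply: filterS => n [E ? HE]; exists E => // w; apply: contraPP => nE.
rewrite /D /=; apply/negP; rewrite -leNgt; apply: ge_ereal_sup => _ [z zU <-].
by rewrite lee_fin /V /S /= (limit_field_iter _ piU)//; exact: (HE _ nE).
Qed.
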